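(* The Continuous Nontangential Skolem problem reduces to the LTI Set Reachability problem with a single saturated input, i.e. restricted to systems $x'(t)=Ax(t)+bu(t)$ with $A\in\mathbb{R}^{n\times n}$ stable, $b\in\mathbb{R}^n$ and $u(t)\in[-1,1]$. Moreover, the target set can be chosen to be either a hyperplane of $\mathbb{R}^n$, or a compact convex set of dimension $n-1$.
   Context: Continuous Nontangential Skolem problem: given a matrix $A\in\mathbb{R}^{n\times n}$ and vectors $c,b\in\mathbb{R}^n$ with rational (or algebraic) entries, let $f(t)=c^Te^{At}b$; decide whether there exists $t\geqslant 0$ such that $f(t)=0$ and $f'(t)\neq 0$ (such a $t$ is called a nontangential zero, or zero-crossing). A continuous-time linear time-invariant (LTI) system of dimension $n$ with $m$ inputs is given by a matrix $A\in\mathbb{R}^{n\times n}$, a control matrix $B\in\mathbb{R}^{n\times m}$, both with real algebraic entries, and a control (input) set $U\subseteq\mathbb{R}^m$. Its evolution is $x'(t)=Ax(t)+Bu(t)$ with $u$ a measurable function into $U$. A state $x_0\in\mathbb{R}^n$ can reach $y\in\mathbb{R}^n$ if there exist $T\geqslant 0$ and a measurable control $u:[0,T]\to U$ such that the unique solution of $x'(t)=Ax(t)+Bu(t)$ on $(0,T)$ with $x(0)=x_0$ satisfies $x(T)=y$. In the present statement $m=1$, $B=b$ and $U=[-1,1]$. LTI Set Reachability problem: given an LTI system and an (effectively described) target set $Y\subseteq\mathbb{R}^n$, decide whether there exists $y\in Y$ such that the origin $\mathbf{0}$ can reach $y$. A matrix is stable if all its eigenvalues have negative real part. A problem $P$ reduces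 to a problem $Q$ if there is an algorithm transforming instances of $P$ into instances of $Q$ with the same answer, up to negating the answer. The integer $n$ in the claim is the dimension of the LTI system produced by the reduction. *)

(* Defs.v *)
From HB Require Import structures.
From mathcomp Require Import all_boot all_order all_algebra.
From mathcomp Require Import complex.
From mathcomp Require Import all_classical all_reals all_analysis.

Set Implicit Arguments.
Unset Strict Implicit.
Unset Printing Implicit Defensive.

Import Order.TTheory GRing.Theory Num.Theory.
Import numFieldNormedType.Exports.

Local Open Scope classical_set_scope.
Local Open Scope ring_scope.

(* Algorithms are programs of Jones's WHILE language (Computability and       *)
(* Complexity from a Programming Perspective), whose data are binary trees;   *)
(* it is Turing-complete. Leaf doubles as nil and as the boolean false, and   *)
(* programs are written in point-free form, acting on a single datum.         *)
Inductive tree := Leaf | Node of tree & tree.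

Definition hd (t : tree) : tree := if t is Node a _ then a else Leaf.
Definition tl (t : tree) : tree := if t is Node _ b then b else Leaf.

Inductive prog :=
  | PId
  | PLeaf
  | PHd
  | PTl
  | PCons of prog & prog
  | PSeq of prog & prog
  | PIf of prog & prog & prog
  | PWhile of prog & prog.

(* eval p s t : p halts on input s, with output t *)
Inductive eval : prog -> tree -> tree -> Prop :=
  | EId s : eval PId s s
  | ELeaf s : eval PLeaf s Leaf
  | EHd s : eval PHd s (hd s)
  | ETl s : eval PTl s (tl s)
  | ECons p q s a b : eval p s a -> eval q s b -> eval (PCons p q) s (Node a b)
  | ESeq p q s r t : eval p s r -> eval q r t -> eval (PSeq p q) s t
  | EIfTrue c p q s a b t :
      eval c s (Node a b) -> eval p s t -> eval (PIf c p q) s t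
  | EIfFalse c p q s t :
      eval c s Leaf -> eval q s t -> eval (PIf c p q) s t
  | EWhileTrue c p s a b r t :
      eval c s (Node a b) -> eval p s r -> eval (PWhile c p) r t ->
      eval (PWhile c p) s t
  | EWhileFalse c p s : eval c s Leaf -> eval (PWhile c p) s s.

Record problem := Problem {
  instance : tree -> Prop;
  answer : tree -> Prop
}.

(* Many-one reducibility, up to a uniform negation of the answer. *)
Definition reduces (P Q : problem) : Prop :=
  exists p : prog,
    (forall t, instance P t -> exists t',
       [/\ eval p t t', instance Q t' & (answer P t <-> answer Q t')]) \/
    (forall t, instance P t -> exists t',
       [/\ eval p t t', instance Q t' & (answer P t <-> ~ answer Q t')]).

(* Trees as codes. Decoding is total: missing entries are read as 0, and      *)
(* codes need not be unique (fractions need not be in lowest terms).          *)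
Fixpoint nat_of (t : tree) : nat := if t is Node _ b then (nat_of b).+1 else 0%N.

Definition int_of (t : tree) : int :=
  if hd t is Leaf then Posz (nat_of (tl t)) else - Posz (nat_of (tl t)).

Definition rat_of (t : tree) : rat :=
  (int_of (hd t))%:~R / ((nat_of (tl t)).+1)%:R.

Fixpoint seq_of (T : Type) (dec : tree -> T) (t : tree) : seq T :=
  if t is Node a b then dec a :: seq_of dec b else [::].

Definition poly_of (t : tree) : {poly rat} := Poly (seq_of rat_of t).

Definition mx_of (m n : nat) (t : tree) : 'M[{poly rat}]_(m, n) :=
  \matrix_(i < m, j < n) nth 0 (nth [::] (seq_of (seq_of poly_of) t) i) j.

(* item k [t_0; t_1; ...] = t_k *)
Definition item (k : nat) (t : tree) : tree := hd (iter k tl t).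

(* A finite family of real algebraic numbers is presented by a primitive      *)
(* element x, given by its minimal polynomial (up to a nonzero factor) and an *)
(* isolating interval, together with polynomials q over the rationals         *)
(* standing for the numbers q(x). Rational data is the special case of        *)
(* constant polynomials, e.g. with minpol = 'X, lo = -1 and hi = 1.           *)
Record number_field := NumberField {
  minpol : {poly rat};
  lo : rat;
  hi : rat
}.

Definition field_of (t : tree) : number_field :=
  NumberField (poly_of (item 0 t)) (rat_of (item 1 t)) (rat_of (item 2 t)).

Section Semantics.
Variable R : realType.

Definition isolated (K : number_field) : set R :=
  [set x | ratr (lo K) <= x <= ratr (hi K) /\ root (map_poly ratr (minpol K)) x].

Definition valid_field (K : number_field) : Prop :=
  irreducible_poly (minpol K) /\ exists! x : R, isolated K x.

Definition generator (K : number_field) : R := get (isolated K).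

Definition real_of (K : number_field) (q : {poly rat}) : R :=
  (map_poly ratr q).[generator K].

Definition realmx (K : number_field) (m n : nat) (M : 'M[{poly rat}]_(m, n)) :
  'M[R]_(m, n) := map_mx (real_of K) M.

Definition expmx (n : nat) (A : 'M[R]_n) : 'M[R]_n :=
  \matrix_(i, j) limn (series (fun k => (A ^+ k) i j / k`!%:R)).

Definition skolem_fun (n : nat) (A : 'M[R]_n) (b c : 'cV[R]_n) (t : R) : R :=
  (c^T *m expmx (t *: A) *m b) 0 0.

Definition nontangential_zero (f : R -> R) (t : R) : Prop :=
  f t = 0 /\ derive1 f t != 0.

(* x is the (Caratheodory) solution of x'(t) = A x(t) + B u(t) on [0, T] with *)
(* x(0) = x0, in integral form.                                               *)
Definition lti_solution (n m : nat) (A : 'M[R]_n) (B : 'M[R]_(n, m))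
    (T : R) (u : R -> 'cV[R]_m) (x0 : 'cV[R]_n) (x : R -> 'cV[R]_n) : Prop :=
  let v s := A *m x s + B *m u s in
  [/\ {within `[0, T], continuous x},
      x 0 = x0,
      forall i, (@lebesgue_measure R).-integrable `[0, T]
                  (fun s => (v s i 0)%:E) &
      forall t, 0 <= t <= T -> forall i,
        x t i 0 = x0 i 0 + \int[@lebesgue_measure R]_(s in `[0, t]) v s i 0].

Definition can_reach (n m : nat) (A : 'M[R]_n) (B : 'M[R]_(n, m))
    (U : set 'cV[R]_m) (x0 y : 'cV[R]_n) : Prop :=
  exists (T : R) (u : R -> 'cV[R]_m) (x : R -> 'cV[R]_n),
    [/\ 0 <= T,
        forall j, measurable_fun `[0, T] (fun s => u s j 0),
        forall s, 0 <= s <= T -> U (u s),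
        lti_solution A B T u x0 x &
        x T = y].

Definition saturated : set 'cV[R]_1 := [set v | -1 <= v 0 0 <= 1].

Definition stable (n : nat) (A : 'M[R]_n) : Prop :=
  forall z : R[i], eigenvalue (map_mx (real_complex R) A) z -> complex.Re z < 0.

Definition polyhedron (k n : nat) (M : 'M[R]_(k, n)) (d : 'cV[R]_k) :
  set 'cV[R]_n := [set x | forall i, (M *m x) i 0 <= d i 0].

Definition hyperplane (n : nat) (Y : set 'cV[R]_n) : Prop :=
  exists (w : 'cV[R]_n) (a : R),
    w != 0 /\ Y = [set x | (w^T *m x) 0 0 = a].

(* The affine hull of Y has dimension k: it is x0 plus the row space of D. *)
Definition affine_dim (n : nat) (Y : set 'cV[R]_n) (k : nat) : Prop :=
  exists (x0 : 'cV[R]_n) (D : 'M[R]_(k, n)),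
    [/\ Y x0,
        row_free D,
        forall i, Y (x0 + (row i D)^T) &
        forall y, Y y -> ((y - x0)^T <= D)%MS].

(* n = k.+1 rather than k = n.-1, so that n = 0 is excluded *)
Definition compact_convex_codim1 (n : nat) (Y : set 'cV[R]_n) : Prop :=
  [/\ compact Y, convex_set Y & exists2 k, n = k.+1 & affine_dim Y k].

(* A code of an instance is a list [K; n; A; b; c] *)
Definition skolem_field (t : tree) : number_field := field_of (item 0 t).
Definition skolem_dim (t : tree) : nat := nat_of (item 1 t).
Definition skolem_A (t : tree) : 'M[R]_(skolem_dim t) :=
  realmx (skolem_field t) (mx_of _ _ (item 2 t)).
Definition skolem_b (t : tree) : 'cV[R]_(skolem_dim t) :=
  realmx (skolem_field t) (mx_of _ _ (item 3 t)).
Definition skolem_c (t : tree) : 'cV[R]_(skolem_dim t) :=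
  realmx (skolem_field t) (mx_of _ _ (item 4 t)).

Definition continuous_nontangential_skolem : problem := Problem
  (fun t => valid_field (skolem_field t))
  (fun t => exists2 s : R, 0 <= s &
     nontangential_zero (skolem_fun (skolem_A t) (skolem_b t) (skolem_c t)) s).

(* A code of a single-input instance is a list [K; n; A; b; k; M; d]; the     *)
(* target set is the polyhedron M x <= d with k constraints.                  *)
Definition lti_field (t : tree) : number_field := field_of (item 0 t).
Definition lti_dim (t : tree) : nat := nat_of (item 1 t).
Definition lti_A (t : tree) : 'M[R]_(lti_dim t) :=
  realmx (lti_field t) (mx_of _ _ (item 2 t)).
Definition lti_b (t : tree) : 'cV[R]_(lti_dim t) :=
  realmx (lti_field t) (mx_of _ _ (item 3 t)).
Definition lti_target (t : tree) : set 'cV[R]_(lti_dim t) :=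
  let k := nat_of (item 4 t) in
  polyhedron (realmx (lti_field t) (mx_of k _ (item 5 t)))
             (realmx (lti_field t) (mx_of k 1 (item 6 t))).

(* LTI Set Reachability restricted to stable systems with a single saturated  *)
(* input and to target sets of a given shape.                                 *)
Definition stable_saturated_reachability
    (shape : forall n, set 'cV[R]_n -> Prop) : problem := Problem
  (fun t => [/\ valid_field (lti_field t), stable (lti_A t) &
                shape _ (@lti_target t)])
  (fun t => exists2 y, @lti_target t y &
     can_reach (lti_A t) (lti_b t) saturated 0 y).

End Semantics.

(* Main.v *)
(* Put [f t = c^T e^(At) b]. Multiplying [f] by a decaying exponential makes
   [f], [f'] and [f''] bounded, by M say, without changing the nontangential
   zeros. If [f] is not identically 0 and does not have a simple zero at 0, then
   [G t = (2 M f t)^2 - ((1 - e^(-t)) (f' t)^2)^2] is positive somewhere close to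
   0, by comparison of orders of vanishing, and it is negative somewhere exactly
   when [f] has a simple zero: it is negative at a simple zero, and where it is
   negative [f] is so steep that it must vanish nearby. The two excluded cases
   are decided by finitely many zero tests in the number field; there
   [G] is replaced by [1], resp. by [1 - 2 e^(-t)].
   G is again of the form [w^T e^(At) b], by sums and tensor products, and a
   further exponential factor makes A stable. The point reached at time T under
   the control u satisfies [w^T x = \int_0^T u s G (T - s) ds]. Let
   [d = - A^-1 b] be the equilibrium under u = 1, so that [w^T d] is the integral
   of G over [0, +oo). If [0 <= G], the level [w^T d] is never reached. If G takes
   both signs, an integral of |G| exceeds [|w^T d|], and already a piecewise
   constant control attains the level. The number [w^T d] is a quotient of two
   numbers computed from A and b by the Faddeev-LeVerrier recurrence. All
   reachable states lie in a box computed from b, which yields the compact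
   target. *)

From HB Require Import structures.
Require Import Defs.
From mathcomp Require Import all_boot all_order all_algebra.
From mathcomp Require Import zify ring lra.
From mathcomp Require Import perm complex mxtens.
From mathcomp Require Import all_classical all_reals all_analysis.
From mathcomp Require Import measurable_realfun.

Set Implicit Arguments.
Unset Strict Implicit.
Unset Printing Implicit Defensive.

Import Order.TTheory GRing.Theory Num.Theory.
Import numFieldNormedType.Exports.
Local Open Scope classical_set_scope.
Local Open Scope ring_scope.

(** * Programs *)

(** The programs use only ring operations and zero tests in the number field, with inverses of
    rationals alone. Hence [x^2 + 1] stands for [|x|] in the bounds, the recurrence divides by
    integers only, and the equation of the target is multiplied by the pivot instead of being
    divided by it. Functions [w^T e^(At) b] are closed under products but not under absolute values:
    [G] has the sign of [2 M |f| - (1 - e^(-t)) f'^2], both terms being squared. Where this is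
    negative, a double Newton step from [t] passes a zero; the bound [1 - e^(-t) <= t] keeps that
    step inside [[0, +oo)]. The factor vanishes at 0, where a simple zero could thus go unnoticed:
    this is the source of the second excluded case. The positivity of [G] somewhere serves the
    hyperplane: the constant control 1 reaches the level only in the limit of infinite time. A
    finite time misses a tail of the integral of [G], which is positive when [G] is nonnegative,
    since such a function vanishing on a half-line vanishes everywhere. *)

Definition computable (f : tree -> tree) : Prop :=
  exists p, forall t, Defs.eval p t (f t).

Definition computable2 F := computable (fun e => F (hd e) (tl e)).
Definition computable3 F :=
  computable (fun e => F (hd (hd e)) (tl (hd e)) (tl e)).
Definition computable4 F :=
  computable (fun e => F (hd (hd (hd e))) (tl (hd (hd e))) (tl (hd e)) (tl e)).

(* A tree tests as true when it is not [Leaf], i.e. when [nat_of] it is > 0. *)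
Definition iteT (c a b : tree) : tree := if c is Node _ _ then a else b.

Definition natT (n : nat) : tree := iter n (Node Leaf) Leaf.

(** Primitive recursion is the only form of loop used below, so that every program halts on every
    tree, including trees that code no valid instance. *)
Fixpoint rec (F : tree -> tree -> tree) (x : tree) (n : nat) : tree :=
  if n is n'.+1 then F (natT n') (rec F x n') else x.

Lemma comp_id : computable (fun t => t).
Proof. by exists PId => t; exact: EId. Qed.

Lemma comp_comp f g :
  computable f -> computable g -> computable (fun t => f (g t)).
Proof.
by move=> [p Hp] [q Hq]; exists (PSeq q p) => t; apply: ESeq (Hq t) (Hp _).
Qed.

Lemma comp_hd f : computable f -> computable (fun t => hd (f t)).
Proof. by apply: comp_comp; exists PHd => t; exact: EHd. Qed.

Lemma comp_tl f : computable f -> computable (fun t => tl (f t)).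
Proof. by apply: comp_comp; exists PTl => t; exact: ETl. Qed.

Lemma comp_Node f g :
  computable f -> computable g -> computable (fun t => Node (f t) (g t)).
Proof. by move=> [p Hp] [q Hq]; exists (PCons p q) => t; apply: ECons. Qed.

Lemma comp_const c : computable (fun _ => c).
Proof.
elim: c => [|a IHa b IHb]; first by exists PLeaf => t; exact: ELeaf.
exact: comp_Node.
Qed.

Lemma comp_iteT c f g : computable c -> computable f -> computable g ->
  computable (fun t => iteT (c t) (f t) (g t)).
Proof.
move=> [p Hp] [q Hq] [r Hr]; exists (PIf p q r) => t.
case E : (c t) (Hp t) => [|a b] Ht; first exact: EIfFalse Ht (Hr t).
exact: EIfTrue Ht (Hq t).
Qed.

Lemma comp_app2 F f g : computable2 F -> computable f -> computable g ->
  computable (fun t => F (f t) (g t)).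
Proof.
by move=> HF Hf Hg; exact: (comp_comp HF (comp_Node Hf Hg)).
Qed.

Lemma comp_app3 F f g h : computable3 F ->
  computable f -> computable g -> computable h ->
  computable (fun t => F (f t) (g t) (h t)).
Proof.
by move=> HF Hf Hg Hh; exact: (comp_comp HF (comp_Node (comp_Node Hf Hg) Hh)).
Qed.

Lemma comp_app4 F f g h k : computable4 F ->
  computable f -> computable g -> computable h -> computable k ->
  computable (fun t => F (f t) (g t) (h t) (k t)).
Proof.
move=> HF Hf Hg Hh Hk.
exact: (comp_comp HF (comp_Node (comp_Node (comp_Node Hf Hg) Hh) Hk)).
Qed.

Local Ltac step := repeat first
  [exact: EHd | exact: ETl | exact: EId | exact: ELeaf
  | eapply ECons | eapply ESeq].

(** The step function receives the input [t] as an extra argument: this is how the body of a nested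
    loop sees the variables of the outer ones. *)
Lemma comp_rec (F : tree -> tree -> tree -> tree) X N :
  computable (fun e => F (hd (hd e)) (tl (hd e)) (tl e)) ->
  computable X -> computable N ->
  computable (fun t => rec (F t) (X t) (nat_of (N t))).
Proof.
move=> [pF HF] [pX HX] [pN HN].
(* The state of the loop is [remaining steps . (input . (index . value))] *)
pose body := PCons (PSeq PHd PTl) (PCons (PSeq PTl PHd)
  (PCons (PCons PLeaf (PSeq PTl (PSeq PTl PHd)))
    (PSeq (PCons (PCons (PSeq PTl PHd) (PSeq PTl (PSeq PTl PHd)))
                 (PSeq PTl (PSeq PTl PTl))) pF))).
exists (PSeq (PSeq (PCons pN (PCons PId (PCons PLeaf pX))) (PWhile PHd body))
             (PSeq PTl (PSeq PTl PTl))) => t.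
have loop r k : Defs.eval (PWhile PHd body)
    (Node r (Node t (Node (natT k) (rec (F t) (X t) k))))
    (Node Leaf (Node t (Node (natT (k + nat_of r))
                             (rec (F t) (X t) (k + nat_of r))))).
  elim: r k => [|a _ r IHr] k /=.
    by rewrite addn0; apply: EWhileFalse; exact: EHd.
  apply: (@EWhileTrue _ _ _ a r); first exact: EHd; last first.
    by rewrite addnS -addSn; exact: IHr.
  apply: ECons; first by step.
  apply: ECons; first by step.
  apply: ECons; first by step.
  by apply: ESeq (HF (Node (Node t (natT k)) (rec (F t) (X t) k))); step.
apply: (@ESeq _ _ _ _ _ (ESeq _ (loop (N t) 0%N))); last by step.
by apply: ECons (HN t) _; apply: ECons (EId _) _; apply: ECons (ELeaf _) (HX t).
Qed.

Create HintDb comp.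

(** The program is read off from the shape of the function: constructors and loops by their lemmas,
    a call of a named function by its entry in [comp]. *)
Ltac comp_step :=
  cbv beta;
  lazymatch goal with
  | |- computable2 _ => unfold computable2
  | |- computable3 _ => unfold computable3
  | |- computable4 _ => unfold computable4
  | |- computable (fun t => t) => exact comp_id
  | |- computable (fun _ => ?c) => exact (comp_const c)
  | |- computable (fun t => hd (@?f t)) => apply (@comp_hd f)
  | |- computable (fun t => tl (@?f t)) => apply (@comp_tl f)
  | |- computable (fun t => Node (@?f t) (@?g t)) => apply (@comp_Node f g)
  | |- computable (fun t => iteT (@?c t) (@?f t) (@?g t)) =>
      apply (@comp_iteT c f g)
  | |- computable (fun t => rec (@?F t) (@?X t) (nat_of (@?N t))) =>
      apply (@comp_rec F X N)
  | |- computable ?f => first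
    [ lazymatch f with fun t => ?F (@?f t) (@?g t) (@?h t) (@?k t) =>
        apply (@comp_app4 F f g h k); [solve [auto with comp]|..] end
    | lazymatch f with fun t => ?F (@?f t) (@?g t) (@?h t) =>
        apply (@comp_app3 F f g h); [solve [auto with comp]|..] end
    | lazymatch f with fun t => ?F (@?f t) (@?g t) =>
        apply (@comp_app2 F f g); [solve [auto with comp]|..] end
    | lazymatch f with fun t => ?F (@?f t) =>
        apply (@comp_comp F f); [solve [auto with comp]|..] end ]
  end.
Ltac comp_tac := repeat comp_step.

(** * Unary arithmetic, list access and tables *)

Lemma iteTE c a b : iteT c a b = if (0 < nat_of c)%N then a else b.
Proof. by case: c. Qed.

Lemma natTK n : nat_of (natT n) = n.
Proof. by elim: n => //= n ->. Qed.

Lemma nat_of_tl t : nat_of (tl t) = (nat_of t).-1.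
Proof. by case: t. Qed.

Definition addT a b := rec (fun _ r => Node Leaf r) b (nat_of a).
Definition mulT a b := rec (fun _ r => addT b r) Leaf (nat_of a).
Definition subT a b := rec (fun _ r => tl r) a (nat_of b).
Definition itemT t i := hd (rec (fun _ r => tl r) t (nat_of i)).

Lemma addTE a b : nat_of (addT a b) = (nat_of a + nat_of b)%N.
Proof. by rewrite /addT; elim: (nat_of a) => //= n ->. Qed.

Lemma mulTE a b : nat_of (mulT a b) = (nat_of a * nat_of b)%N.
Proof. by rewrite /mulT; elim: (nat_of a) => //= n; rewrite addTE => ->. Qed.

Lemma subTE a b : nat_of (subT a b) = (nat_of a - nat_of b)%N.
Proof.
rewrite /subT; elim: (nat_of b) => [|n IH] /=; first by rewrite subn0.
by rewrite nat_of_tl IH; lia.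
Qed.

Lemma itemTE t i : itemT t i = item (nat_of i) t.
Proof. by rewrite /itemT /item; congr hd; elim: (nat_of i) => //= n ->. Qed.

Lemma comp_addT : computable2 addT. Proof. rewrite /addT; comp_tac. Qed.
#[export] Hint Resolve comp_addT : comp.
Lemma comp_mulT : computable2 mulT. Proof. rewrite /mulT; comp_tac. Qed.
Lemma comp_subT : computable2 subT. Proof. rewrite /subT; comp_tac. Qed.
Lemma comp_itemT : computable2 itemT. Proof. rewrite /itemT; comp_tac. Qed.
#[export] Hint Resolve comp_mulT comp_subT comp_itemT : comp.

(** The quotient is the number of [k < a] with [(k + 1) b <= a]. *)
Definition divT a b :=
  rec (fun k r => iteT (subT (mulT (Node Leaf k) b) a) r (Node Leaf r)) Leaf
    (nat_of a).
Definition modT a b := subT a (mulT (divT a b) b).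

Lemma comp_divT : computable2 divT. Proof. rewrite /divT; comp_tac. Qed.
#[export] Hint Resolve comp_divT : comp.
Lemma comp_modT : computable2 modT. Proof. rewrite /modT; comp_tac. Qed.
#[export] Hint Resolve comp_modT : comp.

Lemma divTE a b : (0 < nat_of b)%N -> nat_of (divT a b) = (nat_of a %/ nat_of b)%N.
Proof.
move=> b0; rewrite /divT; set q := (_ %/ _)%N.
suff H n : nat_of (rec (fun k r =>
    iteT (subT (mulT (Node Leaf k) b) a) r (Node Leaf r)) Leaf n) = minn n q.
  by rewrite H; apply/minn_idPr; exact: leq_div.
elim: n => [|n IH] /=; first by rewrite min0n.
rewrite iteTE subTE mulTE /= natTK subn_gt0 ltnNge -leq_divRL // -/q.
by case: leqP => /= nq; rewrite IH; lia.
Qed.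

Lemma modTE a b : (0 < nat_of b)%N -> nat_of (modT a b) = (nat_of a %% nat_of b)%N.
Proof.
by move=> b0; rewrite /modT subTE mulTE divTE // {1}(divn_eq (nat_of a) (nat_of b)) addKn.
Qed.

(** Since [rec] conses in front, the entries are produced from the last to the first: step [i]
    produces the one of index [N - i - 1]. *)
Definition tab F (N : tree) :=
  rec (fun i r => Node (F (subT N (Node Leaf i))) r) Leaf (nat_of N).

Lemma comp_tab (F : tree -> tree -> tree) N :
  computable2 F -> computable N -> computable (fun t => tab (F t) (N t)).
Proof.
by move=> HF HN; rewrite /tab; comp_tac.
Qed.

Ltac comp_step2 := first
  [ comp_step
  | cbv beta; lazymatch goal with |- computable (fun t => tab (@?F t) (@?N t)) =>
     apply (@comp_tab F N) end ].
Ltac comp_tac ::= repeat comp_step2.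

(** The index handed to [F] is a tail of [N], whose left subtrees are arbitrary: it codes [k]
    without having to be [natT k], hence the existential. *)
Lemma tab_item F N k : (k < nat_of N)%N ->
  exists2 i, nat_of i = k & item k (tab F N) = F i.
Proof.
move=> kN; exists (subT N (natT (nat_of N - k))).
  by rewrite subTE natTK; lia.
rewrite /tab.
have H n j : (j < n <= nat_of N)%N -> item j (rec (fun i r =>
   Node (F (subT N (Node Leaf i))) r) Leaf n) = F (subT N (natT (n - j))).
  elim: n j => // n IH [|j] /= nj; first by [].
  by rewrite /item iterSr /= subSS -IH //; lia.
by apply: H; lia.
Qed.

Lemma nat_of_tab F N : nat_of (tab F N) = nat_of N.
Proof. by rewrite /tab; elim: (nat_of N) => //= n ->. Qed.

Lemma item_default t k : (nat_of t <= k)%N -> item k t = Leaf.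
Proof.
elim: t k => [|a _ t IH] k /= H.
  by rewrite /item; have -> : iter k tl Leaf = Leaf by elim: k {H} => //= k ->.
by case: k H => // k H; rewrite /item iterSr /= -/(item k t) IH.
Qed.

(** * Integers, rationals and polynomials as codes *)

Definition posT z := iteT (hd z) Leaf (tl z).
Definition negT z := iteT (hd z) (tl z) Leaf.
(** Normalises the formal difference [p - n], so that the ring operations work on positive and
    negative parts without cases on signs. *)
Definition mkint p n :=
  iteT (subT n p) (Node (Node Leaf Leaf) (subT n p)) (Node Leaf (subT p n)).
Definition iadd a b := mkint (addT (posT a) (posT b)) (addT (negT a) (negT b)).
Definition imul a b :=
  mkint (addT (mulT (posT a) (posT b)) (mulT (negT a) (negT b)))
        (addT (mulT (posT a) (negT b)) (mulT (negT a) (posT b))).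

Lemma comp_posT : computable posT. Proof. rewrite /posT; comp_tac. Qed.
Lemma comp_negT : computable negT. Proof. rewrite /negT; comp_tac. Qed.
Lemma comp_mkint : computable2 mkint. Proof. rewrite /mkint; comp_tac. Qed.
#[export] Hint Resolve comp_posT comp_negT comp_mkint : comp.
Lemma comp_iadd : computable2 iadd. Proof. rewrite /iadd; comp_tac. Qed.
Lemma comp_imul : computable2 imul. Proof. rewrite /imul; comp_tac. Qed.
#[export] Hint Resolve comp_iadd comp_imul : comp.

Lemma int_ofE z : int_of z = (nat_of (posT z))%:Z - (nat_of (negT z))%:Z.
Proof.
by rewrite /int_of /posT /negT; case: (hd z) => [|? ?] /=; rewrite ?subr0 ?sub0r.
Qed.

Lemma mkintE p n : int_of (mkint p n) = (nat_of p)%:Z - (nat_of n)%:Z.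
Proof.
rewrite /mkint iteTE subTE; case: ifP => H; rewrite /int_of /= subTE; lia.
Qed.

Lemma iaddE a b : int_of (iadd a b) = int_of a + int_of b.
Proof. by rewrite mkintE !addTE !int_ofE; lia. Qed.

Lemma imulE a b : int_of (imul a b) = int_of a * int_of b.
Proof. by rewrite mkintE !addTE !mulTE !int_ofE; lia. Qed.

(** Denominators are coded minus one: [Node Leaf] restores the denominator, and the [tl] in front of
    a product of denominators stores it back. *)
Definition denT a := Node Leaf (tl a).
Definition radd a b :=
  Node (iadd (imul (hd a) (Node Leaf (denT b))) (imul (hd b) (Node Leaf (denT a))))
       (tl (mulT (denT a) (denT b))).
Definition rmul a b :=
  Node (imul (hd a) (hd b)) (tl (mulT (denT a) (denT b))).
(** The sign is kept and the absolute value of the numerator, minus one, becomes the coded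
    denominator. The result is meaningless at 0. *)
Definition rinv a := Node (Node (hd (hd a)) (denT a)) (tl (tl (hd a))).
Definition rnat n := Node (Node Leaf n) Leaf.
Definition ropp a := Node (mkint (negT (hd a)) (posT (hd a))) (tl a).
Definition rnz a := tl (hd a).

Lemma comp_radd : computable2 radd. Proof. rewrite /radd /denT; comp_tac. Qed.
Lemma comp_rmul : computable2 rmul. Proof. rewrite /rmul /denT; comp_tac. Qed.
Lemma comp_rinv : computable rinv. Proof. rewrite /rinv /denT; comp_tac. Qed.
Lemma comp_rnat : computable rnat. Proof. rewrite /rnat; comp_tac. Qed.
Lemma comp_ropp : computable ropp. Proof. rewrite /ropp; comp_tac. Qed.
Lemma comp_rnz : computable rnz. Proof. rewrite /rnz; comp_tac. Qed.
#[export] Hint Resolve comp_radd comp_rmul comp_rinv comp_rnat comp_ropp comp_rnz : comp.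

Lemma rat_of_Node z d : rat_of (Node z d) = (int_of z)%:~R / (nat_of d).+1%:R.
Proof. by []. Qed.

Lemma raddE a b : rat_of (radd a b) = rat_of a + rat_of b.
Proof.
rewrite rat_of_Node nat_of_tl mulTE prednK //.
rewrite iaddE !imulE /rat_of addf_div ?pnatr_eq0 //.
by rewrite natrM rmorphD !rmorphM.
Qed.

Lemma rmulE a b : rat_of (rmul a b) = rat_of a * rat_of b.
Proof.
rewrite rat_of_Node nat_of_tl mulTE prednK //.
by rewrite imulE /rat_of mulf_div natrM !rmorphM.
Qed.

Lemma roppE a : rat_of (ropp a) = - rat_of a.
Proof.
by rewrite /rat_of /= mkintE (int_ofE (hd a)) -mulNr -rmorphN opprB.
Qed.

Lemma rnatE n : rat_of (rnat n) = (nat_of n)%:R.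
Proof. by rewrite /rat_of /= /int_of /= divr1. Qed.

Lemma rnzE a : (0 < nat_of (rnz a))%N = (rat_of a != 0).
Proof.
rewrite /rnz /rat_of mulf_eq0 invr_eq0 pnatr_eq0 orbF intr_eq0 lt0n /int_of.
by case: (hd (hd a)) => [|? ?]; rewrite ?oppr_eq0.
Qed.

Lemma rinvE a : rat_of a != 0 -> rat_of (rinv a) = (rat_of a)^-1.
Proof.
rewrite -rnzE /rnz => a0; rewrite rat_of_Node /rat_of.
rewrite nat_of_tl prednK // invf_div /int_of /=.
case: (hd (hd a)) => [|? ?] //=.
by rewrite !rmorphN /= invrN mulNr mulrN.
Qed.

(* Locked, lest conversion unfold the arithmetic of codes. *)
HB.lock Definition padd p q := tab (fun k => radd (itemT p k) (itemT q k)) (addT p q).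
HB.lock Definition pmul p q :=
  tab (fun k => rec (fun i s => radd s (rmul (itemT p i) (itemT q (subT k i))))
                    Leaf (nat_of (Node Leaf k))) (addT p q).
HB.lock Definition pcst a := Node a Leaf.
HB.lock Definition popp p := pmul (pcst (ropp (rnat (Node Leaf Leaf)))) p.
HB.lock Definition pone := pcst (rnat (Node Leaf Leaf)).

Lemma comp_padd : computable2 padd. Proof. rewrite padd.unlock; comp_tac. Qed.
Lemma comp_pmul : computable2 pmul. Proof. rewrite pmul.unlock; comp_tac. Qed.
Lemma comp_pcst : computable pcst. Proof. rewrite pcst.unlock; comp_tac. Qed.
#[export] Hint Resolve comp_padd comp_pmul comp_pcst : comp.
Lemma comp_popp : computable popp. Proof. rewrite popp.unlock; comp_tac. Qed.
#[export] Hint Resolve comp_popp : comp.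

Lemma rat_of_Leaf : rat_of Leaf = 0.
Proof. by rewrite /rat_of (_ : int_of _ = 0) // mul0r. Qed.

Lemma nth_seq_of T (dec : tree -> T) x0 t k : dec Leaf = x0 ->
  nth x0 (seq_of dec t) k = dec (item k t).
Proof.
move=> <-; elim: t k => [|a _ t IH] k /=; first by rewrite nth_nil item_default.
by case: k => //= k; rewrite IH [in RHS]/item iterSr.
Qed.

Lemma coef_poly_of t k : (poly_of t)`_k = rat_of (item k t).
Proof. by rewrite coef_Poly nth_seq_of // rat_of_Leaf. Qed.

Lemma rat_item_default t k : (nat_of t <= k)%N -> rat_of (item k t) = 0.
Proof. by move=> H; rewrite item_default // rat_of_Leaf. Qed.

(** The table is as long as both codes together, which only appends zero coefficients. *)
Lemma paddE p q : poly_of (padd p q) = poly_of p + poly_of q.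
Proof.
apply/polyP => k; rewrite coefD !coef_poly_of padd.unlock.
have [Hk|Hk] := ltnP k (nat_of (addT p q)).
  by have [i <- ->] := tab_item (fun k => radd (itemT p k) (itemT q k)) Hk; rewrite raddE !itemTE.
rewrite !rat_item_default ?nat_of_tab ?addr0 //; rewrite addTE in Hk; lia.
Qed.

Lemma pmulE p q : poly_of (pmul p q) = poly_of p * poly_of q.
Proof.
apply/polyP => k; rewrite coefM coef_poly_of pmul.unlock.
have [Hk|Hk] := ltnP k (nat_of (addT p q)).
  have [i <- ->] := tab_item (fun k => rec (fun i s => radd s (rmul (itemT p i) (itemT q (subT k i))))
                    Leaf (nat_of (Node Leaf k))) Hk.
  have H n : rat_of (rec (fun i0 s => radd s (rmul (itemT p i0) (itemT q (subT i i0)))) Leaf n)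
    = \sum_(j < n) (poly_of p)`_j * (poly_of q)`_(nat_of i - j).
    elim: n => [|n IH] /=; first by rewrite big_ord0 rat_of_Leaf.
    by rewrite raddE IH rmulE big_ord_recr /= !itemTE subTE natTK !coef_poly_of.
  exact: H.
rewrite rat_item_default ?nat_of_tab // big1 // => i _; rewrite !coef_poly_of.
rewrite addTE in Hk; have [pi|pi] := leqP (nat_of p) i.
  by rewrite rat_item_default ?mul0r.
by rewrite [X in _ * X]rat_item_default ?mulr0 //; lia.
Qed.

Lemma pcstE a : poly_of (pcst a) = (rat_of a)%:P.
Proof. by rewrite pcst.unlock /poly_of /= cons_poly_def mul0r add0r. Qed.

Lemma poneE : poly_of pone = 1.
Proof. by rewrite pone.unlock pcstE rnatE. Qed.

Lemma poppE p : poly_of (popp p) = - poly_of p.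
Proof. by rewrite popp.unlock pmulE pcstE roppE rnatE polyCN mulN1r. Qed.

Lemma poly_of_Leaf : poly_of Leaf = 0.
Proof. by []. Qed.

(** * Zero test in a number field *)

(** The degree has to be searched as the last index of a nonzero coefficient, because a code may end
    with zeros. *)
Definition degT m := rec (fun i d => iteT (rnz (itemT m i)) i d) Leaf (nat_of m).
Definition monT m i := rmul (itemT m i) (rinv (itemT m (degT m))).
(** A Horner scheme from the leading coefficient of [q] downwards: [r] becomes ['X * r + c], minus
    the multiple of the monic associate of [m] that cancels the term of degree [degT m]. *)
Definition remT m q := rec (fun i r =>
  tab (fun j => radd (itemT (Node (itemT q (subT q (Node Leaf i))) r) j)
     (ropp (rmul (itemT r (tl (degT m))) (monT m j)))) (degT m)) Leaf (nat_of q).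
HB.lock Definition nzT m q := let r := remT m q in
  rec (fun i b => iteT (rnz (itemT r i)) (Node Leaf Leaf) b) Leaf (nat_of r).

Lemma comp_degT : computable degT. Proof. rewrite /degT; comp_tac. Qed.
#[export] Hint Resolve comp_degT : comp.
Lemma comp_monT : computable2 monT. Proof. rewrite /monT; comp_tac. Qed.
#[export] Hint Resolve comp_monT : comp.
Lemma comp_remT : computable2 remT. Proof. rewrite /remT; comp_tac. Qed.
#[export] Hint Resolve comp_remT : comp.
Lemma comp_nzT : computable2 nzT. Proof. rewrite nzT.unlock; comp_tac. Qed.
#[export] Hint Resolve comp_nzT : comp.

Lemma size_poly_of t : (size (poly_of t) <= nat_of t)%N.
Proof.
apply: leq_trans (size_Poly _) _.
by elim: t => //= a _ b.
Qed.

Lemma degTE m : poly_of m != 0 -> size (poly_of m) = (nat_of (degT m)).+1.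
Proof.
move=> m0; rewrite /degT.
(* Nothing nonzero lies between the last hit and [n]; the second alternative covers the initial
   value 0, when no nonzero coefficient has been met yet. *)
have H n : let d := nat_of (rec (fun i d => iteT (rnz (itemT m i)) i d) Leaf n) in
    (forall j, (d < j < n)%N -> (poly_of m)`_j = 0) /\
    ((poly_of m)`_d != 0 \/ forall j, (j < n)%N -> (poly_of m)`_j = 0).
  elim: n => [|n [IH1 IH2]] /=; first by split=> [j|]; [lia | right].
  rewrite iteTE rnzE itemTE natTK -coef_poly_of.
  have [c0|c0] := eqVneq (poly_of m)`_n 0 => /=; last first.
    by rewrite natTK; split=> [j|]; [lia | left].
  split=> [j /andP[dj]|].
    by rewrite ltnS leq_eqVlt => /predU1P[->//|jn]; apply: IH1; rewrite dj.
  case: IH2 => [|IH2]; [by left|right=> j].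
  by rewrite ltnS leq_eqVlt => /predU1P[->//|]; apply: IH2.
have [H1 H2] := H (nat_of m); set d := nat_of _ in H1 H2 *.
have cz j : (nat_of m <= j)%N -> (poly_of m)`_j = 0.
  by move=> mj; rewrite nth_default // (leq_trans (size_poly_of m)).
case: H2 => [H2|H2]; last first.
  case/negP: m0; apply/eqP/polyP => j; rewrite coef0.
  by have [/H2|/cz] := ltnP j (nat_of m).
apply/eqP; rewrite eqn_leq; apply/andP; split; last first.
  by rewrite ltnNge; apply: contra H2 => H2; rewrite nth_default.
apply/leq_sizeP => j dj; have [jm|/cz//] := ltnP j (nat_of m).
by apply: H1; rewrite dj.
Qed.

Section Field.
Variables (R : realType) (K : number_field).

Definition V (t : tree) : R := real_of R K (poly_of t).

Lemma VD p q : V (padd p q) = V p + V q.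
Proof. by rewrite /V /real_of paddE rmorphD hornerD. Qed.
Lemma VM p q : V (pmul p q) = V p * V q.
Proof. by rewrite /V /real_of pmulE rmorphM hornerM. Qed.
Lemma VN p : V (popp p) = - V p.
Proof. by rewrite /V /real_of poppE rmorphN hornerN. Qed.
Lemma V0 : V Leaf = 0.
Proof. by rewrite /V /real_of poly_of_Leaf rmorph0 horner0. Qed.
Lemma Vcst a : V (pcst a) = ratr (rat_of a).
Proof. by rewrite /V /real_of pcstE map_polyC hornerC. Qed.
Lemma V1 : V pone = 1.
Proof. by rewrite /V poneE /real_of rmorph1 hornerC. Qed.

Hypothesis vK : valid_field R K.

Lemma root_generator : root (map_poly ratr (minpol K)) (generator R K).
Proof.
have [_ [x [Kx _]]] := vK.
by have [] : Defs.isolated K (generator R K) by apply: getI Kx.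
Qed.

(** A nonzero polynomial of smaller degree is coprime to the irreducible [minpol K], hence does not
    share the root [generator R K]. *)
Lemma real_of_eq0 (r : {poly rat}) :
  (size r < size (minpol K))%N -> (real_of R K r == 0) = (r == 0).
Proof.
move=> szr; apply/eqP/eqP => [r0|->]; last by rewrite /real_of rmorph0 horner0.
apply: contraTeq isT => rn0; have [irr _] := vK.
have cop : coprimep (minpol K) r.
  rewrite irreducible_poly_coprime //; apply: contraL szr => /dvdp_leq H.
  by rewrite -leqNgt H.
have : coprimep (map_poly (ratr : rat -> R) (minpol K)) (map_poly ratr r).
  by rewrite coprimep_map.
by move/coprimep_root/(_ root_generator); rewrite -/(real_of R K r) r0 eqxx.
Qed.

Lemma remTE m q : poly_of m = minpol K ->
  V (remT m q) = V q /\ (nat_of (remT m q) <= nat_of (degT m))%N.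
Proof.
move=> mK; have [irr _] := vK.
have m0 : poly_of m != 0 by rewrite mK irredp_neq0.
have szm := degTE m0; set D := degT m in szm *.
have D0 : (0 < nat_of D)%N.
  by have [] := irr; rewrite -mK szm.
have lm : lead_coef (poly_of m) = rat_of (item (nat_of D) m).
  by rewrite /lead_coef szm coef_poly_of.
have lm0 : lead_coef (poly_of m) != 0 by rewrite lead_coef_eq0.
have monE i : rat_of (monT m i) = (lead_coef (poly_of m))^-1 * (poly_of m)`_(nat_of i).
  by rewrite /monT rmulE rinvE !itemTE -/D -lm // coef_poly_of mulrC.
pose x := generator R K.
(* After [n] steps, [r] has the value at the generator of the polynomial formed by the [n] highest
   coefficients of [q]: the multiples of [m] that were subtracted vanish there. *)
have H n : (n <= nat_of q)%N ->
    let r := rec (fun i r =>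
  tab (fun j => radd (itemT (Node (itemT q (subT q (Node Leaf i))) r) j)
     (ropp (rmul (itemT r (tl D)) (monT m j)))) D) Leaf n in
    V r = \sum_(j < n) ratr (rat_of (item (nat_of q - n + j) q)) * x ^+ j /\
    (nat_of r <= nat_of D)%N.
  elim: n => [|n IH] nq /=; first by rewrite big_ord0 V0.
  have {IH}[IH1 IH2] := IH (ltnW nq).
  set r := rec _ _ n in IH1 IH2 *; set c := itemT q _.
  split; last by rewrite nat_of_tab.
  set r' := tab _ _.
  have cE : rat_of c = rat_of (item (nat_of q - n.+1) q).
    by rewrite /c itemTE subTE /= natTK.
  have E : poly_of r' = 'X * poly_of r + (rat_of c)%:P
      - ((rat_of (item (nat_of D).-1 r)) * (lead_coef (poly_of m))^-1) *: poly_of m.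
    apply/polyP => k; rewrite coefB coefD coefXM coefC coefZ.
    have [kD|kD] := ltnP k (nat_of D).
      rewrite coef_poly_of; have [i ik ->] := tab_item (fun j => radd (itemT (Node c r) j)
     (ropp (rmul (itemT r (tl D)) (monT m j)))) kD.
      rewrite raddE roppE rmulE monE ik !itemTE ik nat_of_tl mulrA; congr (_ - _).
      case: k kD ik => [|k] kD ik /=; first by rewrite add0r.
      by rewrite addr0 coef_poly_of /item iterSr.
    rewrite coef_poly_of rat_item_default ?nat_of_tab //.
    rewrite gtn_eqF ?(leq_trans D0) // addr0.
    case: k kD => [|k]; first by rewrite leqn0 => /eqP D00; rewrite D00 in D0.
    rewrite leq_eqVlt => /predU1P[Dk|Dk] /=.
      by rewrite coef_poly_of Dk /= -Dk coef_poly_of -lm mulfVK // subrr.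
    by rewrite coef_poly_of rat_item_default ?(leq_trans IH2) // nth_default ?szm // mulr0 subr0.
  rewrite /V /real_of E rmorphB /= rmorphD /= rmorphM /= map_polyX map_polyC /=.
  rewrite map_polyZ hornerD hornerN hornerZ mK (eqP root_generator) mulr0 subr0.
  rewrite hornerD hornerM hornerX hornerC -/(real_of R K _) -/(V r) IH1.
  rewrite big_ord_recl /= addn0 mulr1 addrC -cE; congr (_ + _).
  rewrite mulr_sumr; apply: eq_bigr => i _; rewrite /bump /= -/x.
  by rewrite mulrCA -exprS (_ : nat_of q - n = nat_of q - n.+1 + 1)%N ?addnA //; lia.
have [H1 H2] := H _ (leqnn _); split=> //.
rewrite H1 subnn /V /real_of (@horner_coef_wide _ (nat_of q)).
  by apply: eq_bigr => i _; rewrite coef_map /= coef_poly_of.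
by rewrite (leq_trans _ (size_poly_of q)) // size_map_poly.
Qed.

Lemma nzTE m q : poly_of m = minpol K ->
  (0 < nat_of (nzT m q))%N = (V q != 0).
Proof.
move=> mK; have [<- szr] := remTE q mK.
have [irr _] := vK; have m0 : poly_of m != 0 by rewrite mK irredp_neq0.
rewrite nzT.unlock; set r := remT m q in szr *.
rewrite /V real_of_eq0; last first.
  by rewrite -mK (degTE m0) ltnS (leq_trans _ szr) // size_poly_of.
have H n : (0 < nat_of (rec (fun i b => iteT (rnz (itemT r i)) (Node Leaf Leaf) b) Leaf n))%N
   = [exists i : 'I_n, rat_of (item i r) != 0].
  elim: n => [|n IH] /=; first by apply/esym/existsP => -[[]].
  rewrite iteTE rnzE itemTE natTK; case: ifP => [c|c].
    by apply/esym/existsP; exists ord_max.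
  rewrite IH; apply/existsP/existsP => -[i Hi].
    by exists (widen_ord (leqnSn n) i).
  have [ni|ni] := ltnP i n; first by exists (Ordinal ni).
  have E : i = n :> nat by have := ltn_ord i; lia.
  by rewrite E c in Hi.
rewrite H; apply/existsP/idP => [[i ri]|].
  by move: ri; rewrite -coef_poly_of; apply: contra => /eqP ->; rewrite coef0.
move=> r0; have s0 : (0 < size (poly_of r))%N by rewrite size_poly_gt0.
have si : ((size (poly_of r)).-1 < nat_of r)%N.
  by rewrite prednK // size_poly_of.
by exists (Ordinal si); rewrite -coef_poly_of /= -/(lead_coef _) lead_coef_eq0.
Qed.

End Field.

(** * Matrix exponential *)

Section Derivatives.
Variable R : realType.
Implicit Types (f g : R -> R) (x : R).

Definition der f x (d : R) : Prop := is_derive x (1 : R) f d.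

Lemma der_eq f x d e : d = e -> der f x d -> der f x e.
Proof. by move=> ->. Qed.

Lemma der_ext f g x d : f =1 g -> der f x d -> der g x d.
Proof. by move=> /funext ->. Qed.

Lemma der_cst (c : R) x : der (fun=> c) x 0.
Proof. exact: is_derive_cst. Qed.

Lemma der_id x : der id x 1.
Proof. exact: is_derive_id. Qed.

Lemma derD f g x a b : der f x a -> der g x b ->
  der (fun t => f t + g t) x (a + b).
Proof. exact: is_deriveD. Qed.

Lemma derB f g x a b : der f x a -> der g x b ->
  der (fun t => f t - g t) x (a - b).
Proof. exact: is_deriveB. Qed.

Lemma derN f x a : der f x a -> der (fun t => - f t) x (- a).
Proof. exact: is_deriveN. Qed.

Lemma derM f g x a b : der f x a -> der g x b ->
  der (fun t => f t * g t) x (a * g x + f x * b).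
Proof.
move=> Hf Hg; have := is_deriveM Hf Hg; apply: der_eq.
by rewrite /GRing.scale /= addrC mulrC.
Qed.

Lemma derZ (k : R) f x a : der f x a -> der (fun t => k * f t) x (k * a).
Proof.
by move=> Hf; have := derM (der_cst k x) Hf; apply: der_eq; rewrite mul0r add0r.
Qed.

Lemma der_sum n (F : 'I_n -> R -> R) x (d : 'I_n -> R) :
  (forall i, der (F i) x (d i)) ->
  der (fun t => \sum_(i < n) F i t) x (\sum_(i < n) d i).
Proof.
move=> H; have := is_derive_sum H; apply: der_ext => t.
by rewrite fct_sumE.
Qed.

Lemma der_comp f g x a b : der f (g x) a -> der g x b ->
  der (fun t => f (g t)) x (a * b).
Proof. exact: is_derive1_comp. Qed.

Lemma der_affine (a b x : R) : der (fun t => a * t + b) x a.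
Proof.
have := derD (derZ a (der_id x)) (der_cst b x); apply: der_eq.
by rewrite mulr1 addr0.
Qed.

Lemma der_subl f (c x d : R) : der f (c - x) d -> der (fun t => f (c - t)) x (- d).
Proof.
move=> H; have := @der_comp f (fun t => c - t) x d (-1) H.
rewrite mulrN1; apply; have := derB (der_cst c x) (der_id x).
by rewrite sub0r.
Qed.

Lemma der_subr f (c x d : R) : der f (x - c) d -> der (fun t => f (t - c)) x d.
Proof.
move=> H; have := @der_comp f (fun t => t - c) x d 1 H.
rewrite mulr1; apply; have := derB (der_id x) (der_cst c x).
by rewrite subr0.
Qed.

Lemma der_addl f (c x d : R) : der f (c + x) d -> der (fun t => f (c + t)) x d.
Proof.
move=> H; have := @der_comp f (fun t => c + t) x d 1 H.
rewrite mulr1; apply; have := derD (der_cst c x) (der_id x).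
by rewrite add0r.
Qed.

Lemma der_expR (k x : R) : der (fun t => expR (k * t)) x (k * expR (k * x)).
Proof.
have H : der expR (k * x) (expR (k * x)) by exact: is_derive_expR.
have := @der_comp expR (fun t => k * t) x _ k H; rewrite mulrC; apply.
by have := derZ k (der_id x); rewrite mulr1.
Qed.

Lemma der_continuous f x d : der f x d -> {for x, continuous f}.
Proof. by move=> [Hf _]; apply: differentiable_continuous; apply/derivable1_diffP. Qed.

Lemma der_continuousW f f' (A : set R) : (forall x, der f x (f' x)) ->
  {within A, continuous f}.
Proof.
move=> H; apply: continuous_subspaceT => x.
exact: der_continuous (H x).
Qed.

Lemma der_unique f x d e : der f x d -> der f x e -> d = e.
Proof. by move=> [_ <-] [_ <-]. Qed.

Lemma der0_cst f : (forall x, der f x 0) -> forall x y, f x = f y.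
Proof. by move=> H x y; apply: is_derive_0_is_cst. Qed.

Lemma der_mono f f' (a b : R) : a <= b ->
  (forall x, a < x < b -> der f x (f' x)) -> {within `[a, b], continuous f} ->
  (forall x, a < x < b -> 0 <= f' x) -> f a <= f b.
Proof.
rewrite le_eqVlt => /predU1P[-> //|ab] H cf f0.
have [x|c] := MVT ab (df := f') _ cf.
  by rewrite in_itv; apply: H.
rewrite in_itv /= => cab E; rewrite -subr_ge0 E mulr_ge0 ?f0 // subr_ge0; exact: ltW.
Qed.

Lemma der_monoT f f' (a b : R) : a <= b -> (forall x, der f x (f' x)) ->
  (forall x, a < x < b -> 0 <= f' x) -> f a <= f b.
Proof.
move=> ab H; apply: der_mono ab _ _ => [x _|]; first exact: H.
exact: der_continuousW H.
Qed.

End Derivatives.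

Section MatrixExponential.
Variable R : realType.

Lemma cvgn_sum n (u : 'I_n -> R ^nat) (v : 'I_n -> R) :
  (forall l, u l @ \oo --> v l) ->
  (fun N => \sum_l u l N) @ \oo --> \sum_l v l.
Proof.
move=> H; rewrite (_ : (fun N => _) = \sum_l u l); last first.
  by apply/funext => N; rewrite fct_sumE.
elim/big_rec2: _ => [|l f g _ IH]; first exact: cvg_cst.
by apply: cvgD => //; exact: H.
Qed.

Definition mxnorm1 m n (A : 'M[R]_(m, n)) : R := \sum_i \sum_j `|A i j|.

Lemma mxnorm1_ge0 m n (A : 'M[R]_(m, n)) : 0 <= mxnorm1 A.
Proof. by do 2![apply: sumr_ge0 => ? _]. Qed.

Lemma row_le_mxnorm1 m n (A : 'M[R]_(m, n)) i : \sum_j `|A i j| <= mxnorm1 A.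
Proof.
rewrite /mxnorm1 [leRHS](bigD1 i) //= lerDl.
by do 2![apply: sumr_ge0 => ? _].
Qed.

Lemma mxnorm1_exp n (A : 'M[R]_n) k i j : `|(A ^+ k) i j| <= mxnorm1 A ^+ k.
Proof.
elim: k i j => [|k IH] i j.
  by rewrite !expr0 mxE; case: (_ == _); rewrite ?normr1 ?normr0.
rewrite exprS -mulmxE mxE; apply: le_trans (ler_norm_sum _ _ _) _.
rewrite exprS; apply: le_trans (ler_wpM2r _ (row_le_mxnorm1 A i)); last first.
  by apply: exprn_ge0; exact: mxnorm1_ge0.
rewrite mulr_suml; apply: ler_sum => l _; rewrite normrM.
by apply: ler_pM.
Qed.

Lemma exprmxZ n (A : 'M[R]_n) t k : (t *: A) ^+ k = t ^+ k *: A ^+ k.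
Proof.
elim: k => [|k IH]; first by rewrite !expr0 scale1r.
by rewrite !exprS IH -!mulmxE -scalemxAl -scalemxAr scalerA.
Qed.

Section Fix.
Variables (n : nat) (A : 'M[R]_n).

Let c i j : R ^nat := fun k => (A ^+ k) i j / k`!%:R.

(** Comparison with a scalar exponential series. The constant [C] absorbs the powers of [mxnorm1 A]
    that appear when the series is differentiated once or twice. *)
Lemma pseries_expmx_cvg (C : R) (d : R ^nat) x : (forall k, `|d k| <= C * (mxnorm1 A ^+ k / k`!%:R)) ->
  cvgn (pseries d x).
Proof.
move=> H; apply: normed_cvg.
apply: (@series_le_cvg _ _ (fun k => C * exp_coeff (mxnorm1 A * `|x|) k)).
- by move=> k /=.
- move=> k; rewrite /exp_coeff /=.
  have C0 : 0 <= C.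
    by have := H 0%N; rewrite expr0 fact0 divr1 mulr1; apply: le_trans.
  by apply/mulr_ge0/divr_ge0 => //; apply/exprn_ge0/mulr_ge0 => //; exact: mxnorm1_ge0.
- move=> k; rewrite /exp_coeff /= normrM normrX exprMn.
  rewrite mulrAC mulrA; apply: ler_wpM2r; first exact: exprn_ge0.
  by [].
apply: is_cvg_seriesZ; exact: is_cvg_series_exp_coeff.
Qed.

Lemma c_bound i j k : `|c i j k| <= mxnorm1 A ^+ k / k`!%:R.
Proof.
rewrite /c normrM normfV (ger0_norm (ler0n _ _)) ler_wpM2r ?invr_ge0 //.
exact: mxnorm1_exp.
Qed.

Lemma diffs_c i j k : pseries_diffs (c i j) k = (A ^+ k.+1) i j / k`!%:R.
Proof.
by rewrite /pseries_diffs /c factS natrM invfM mulrCA mulVKf.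
Qed.

Lemma expmxE t i j : expmx (t *: A) i j = limn (pseries (c i j) t).
Proof.
rewrite mxE /pseries; congr (limn _); congr series; apply/funext => k.
by rewrite exprmxZ mxE /c -mulrA mulrC.
Qed.

Lemma expmx0 : expmx (0 *: A) = 1.
Proof.
apply/matrixP => i j; rewrite expmxE; apply: cvg_lim => //.
apply: cvg_near_cst; exists 1%N => // k /= k0.
rewrite /pseries /series /= big_ltn // big_nat big1 ?addr0.
  by rewrite /c fact0 divr1 !expr0 mulr1.
by move=> l /andP[l0 _]; rewrite expr0n gtn_eqF // mulr0.
Qed.

(** Termwise differentiation; the two forms come from splitting a factor off [A ^+ k.+1] on the left
    or on the right. Their equality is the commutation of [A] with its exponential. *)
Lemma der_expmx t i j :
  der (fun s => expmx (s *: A) i j) t ((A *m expmx (t *: A)) i j) /\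
  der (fun s => expmx (s *: A) i j) t ((expmx (t *: A) *m A) i j).
Proof.
have cv i' j' x : cvgn (pseries (c i' j') x).
  by apply: (@pseries_expmx_cvg 1) => k; rewrite mul1r; exact: c_bound.
have cv1 x : cvgn (pseries (pseries_diffs (c i j)) x).
  apply: (@pseries_expmx_cvg (mxnorm1 A)) => k.
  rewrite diffs_c normrM normfV (ger0_norm (ler0n _ _)) mulrA -exprS.
  by rewrite ler_wpM2r ?invr_ge0 //; exact: mxnorm1_exp.
have cv2 x : cvgn (pseries (pseries_diffs (pseries_diffs (c i j))) x).
  apply: (@pseries_expmx_cvg (mxnorm1 A ^+ 2)) => k.
  rewrite /pseries_diffs -/(pseries_diffs (c i j) k.+1) diffs_c factS natrM invfM.
  rewrite mulrCA mulVKf // normrM normfV (ger0_norm (ler0n _ _)) mulrA -exprD.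
  by rewrite ler_wpM2r ?invr_ge0 //; exact: mxnorm1_exp.
have D : der (fun s => expmx (s *: A) i j) t (limn (pseries (pseries_diffs (c i j)) t)).
  apply: der_ext (pseries_snd_diffs (cv i j (`|t| + 1)) (cv1 _) (cv2 _) _).
    by move=> s; rewrite expmxE.
  by rewrite (ger0_norm (_ : 0 <= `|t| + 1)) ?addr_ge0 // ltrDl.
(* Serves both splittings: [a l] is the entry of the factor split off, and [h l] the position of the
   matching entry of [A ^+ k]. *)
have S (a : 'I_n -> R) (h : 'I_n -> 'I_n * 'I_n) :
    (forall k, (A ^+ k.+1) i j = \sum_l a l * (A ^+ k) (h l).1 (h l).2) ->
    limn (pseries (pseries_diffs (c i j)) t) =
    \sum_l a l * expmx (t *: A) (h l).1 (h l).2.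
  move=> Hk; apply: cvg_lim => //.
  have -> : pseries (pseries_diffs (c i j)) t =
      fun N => \sum_l a l * pseries (c (h l).1 (h l).2) t N.
    apply/funext => N; rewrite /pseries /series /=.
    under [RHS]eq_bigr do rewrite mulr_sumr.
    rewrite exchange_big; apply: eq_bigr => k _ /=.
    rewrite diffs_c Hk !mulr_suml; apply: eq_bigr => l _.
    by rewrite /c !mulrA.
  apply: cvgn_sum => l; apply: cvgMl_tmp.
  by rewrite expmxE; exact: cv.
split; apply: der_eq D.
  rewrite mxE (S (fun l => A i l) (fun l => (l, j))) //= => k.
  by rewrite exprS -mulmxE mxE.
rewrite mxE (S (fun l => A l j) (fun l => (i, l))) /=.
  by apply: eq_bigr => l _; rewrite mulrC.
by move=> k; rewrite exprSr -mulmxE mxE; apply: eq_bigr => l _; rewrite mulrC.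
Qed.

Lemma expmx_bound t i j : 0 <= t -> `|expmx (t *: A) i j| <= expR (mxnorm1 A * t).
Proof.
move=> t0; rewrite expmxE.
have cvn : cvgn [normed pseries (c i j) t].
  apply: (@series_le_cvg _ _ (exp_coeff (mxnorm1 A * t))).
  - by move=> k /=.
  - move=> k; rewrite /exp_coeff /=.
    by apply/divr_ge0 => //; apply/exprn_ge0/mulr_ge0 => //; exact: mxnorm1_ge0.
  - move=> k; rewrite /exp_coeff /= normrM normrX exprMn (ger0_norm t0).
    by rewrite mulrAC; apply: ler_wpM2r; [exact: exprn_ge0 | exact: c_bound].
  exact: is_cvg_series_exp_coeff.
apply: le_trans (lim_series_norm cvn) _.
apply: ler_lim => //; first exact: is_cvg_series_exp_coeff.
apply: nearW => N; apply: ler_sum => k _.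
rewrite /exp_coeff /= normrM normrX exprMn (ger0_norm t0).
by rewrite mulrAC; apply: ler_wpM2r; [exact: exprn_ge0 | exact: c_bound].
Qed.

End Fix.

Definition ode n (A : 'M[R]_n) (y : R -> 'cV[R]_n) : Prop :=
  forall t i, der (fun s => y s i 0) t ((A *m y t) i 0).

Lemma der_mulmx m n p (X : R -> 'M[R]_(m, n)) (Y : R -> 'M[R]_(n, p)) t
    (X' : 'M[R]_(m, n)) (Y' : 'M[R]_(n, p)) :
  (forall i j, der (fun s => X s i j) t (X' i j)) ->
  (forall i j, der (fun s => Y s i j) t (Y' i j)) ->
  forall i j, der (fun s => (X s *m Y s) i j) t ((X' *m Y t + X t *m Y') i j).
Proof.
move=> HX HY i j.
apply: der_ext (der_eq _ (der_sum (fun k => derM (HX i k) (HY k j)))) => [s|].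
  by rewrite mxE.
by rewrite !mxE -big_split.
Qed.

Lemma ode_expmx n (A : 'M[R]_n) b : ode A (fun t => expmx (t *: A) *m b).
Proof.
move=> t i.
have D0 i' j' : der (fun=> b i' j') t ((0 : 'M[R]_(n, 1)) i' j').
  by rewrite mxE; exact: der_cst.
apply: der_eq (der_mulmx (fun i j => (der_expmx A t i j).1) D0 i 0).
by rewrite mulmx0 addr0 mulmxA.
Qed.

(** The function [W], which transports [y (s + r)] by the flow over the remaining time [t - r], has
    derivative 0. Its values at [r = 0] and [r = t] are the two sides. *)
Lemma ode_unique n (A : 'M[R]_n) y : ode A y ->
  forall s t, y (s + t) = expmx (t *: A) *m y s.
Proof.
move=> Hy s t; pose W r := expmx ((t - r) *: A) *m y (s + r).
have dW r i : der (fun r => W r i 0) r 0.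
  have H1 i' j' : der (fun r => expmx ((t - r) *: A) i' j') r
      ((- (expmx ((t - r) *: A) *m A)) i' j').
    by rewrite mxE; apply: (@der_subl _ (fun u => expmx (u *: A) i' j')); exact: (der_expmx A _ _ _).2.
  have H2 i' (j' : 'I_1) : der (fun r => y (s + r) i' j') r ((A *m y (s + r)) i' j').
    rewrite ord1; exact: (@der_addl _ (fun u => y u i' 0) s r _ (Hy (s + r) i')).
  apply: der_eq (der_mulmx H1 H2 i 0).
  by rewrite mulmxA mulNmx addNr mxE.
have W0 : W 0 = W t.
  by apply/colP => i; apply: (der0_cst (fun r => dW r i)).
by move: W0; rewrite /W subr0 addr0 subrr expmx0 mul1mx.
Qed.

End MatrixExponential.

(** * Sums and products of Skolem functions, simple zeros *)

Section SkolemFunctions.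
Variable R : realType.

(** By uniqueness, exhibiting a solution is enough to evaluate a Skolem function; this spares
    computing the exponentials of Kronecker sums and block matrices. *)
Lemma skolem_ode n (A : 'M[R]_n) (b c : 'cV[R]_n) y : ode A y -> y 0 = b ->
  forall t, skolem_fun A b c t = (c^T *m y t) 0 0.
Proof.
move=> Hy y0 t; rewrite /skolem_fun -mulmxA -y0.
by have := ode_unique Hy 0 t; rewrite add0r => <-.
Qed.

Lemma der_skolem n (A : 'M[R]_n) (b c : 'cV[R]_n) t :
  der (skolem_fun A b c) t (skolem_fun A b (A^T *m c) t).
Proof.
have Dc i j : der (fun=> (c^T : 'rV[R]_n) i j) t ((0 : 'rV[R]_n) i j).
  by rewrite [X in der _ _ X]mxE; exact: der_cst.
have Dy i (j : 'I_1) : der (fun s => (expmx (s *: A) *m b) i j) t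
    ((A *m (expmx (t *: A) *m b)) i j) by rewrite ord1; exact: ode_expmx.
apply: der_ext (der_eq _ (der_mulmx Dc Dy 0 0)) => [s|].
  by rewrite /skolem_fun mulmxA.
by rewrite mul0mx add0r /skolem_fun trmx_mul trmxK !mulmxA.
Qed.

Lemma tens_col n1 n2 (x : 'cV[R]_n1) (y : 'cV[R]_n2) i j :
  (tensmx x y) i j = x (mxtens_unindex i).1 0 * y (mxtens_unindex i).2 0.
Proof. by rewrite mxE (ord1 (mxtens_unindex j).1) (ord1 (mxtens_unindex j).2). Qed.

(** By the product rule, the Kronecker sum of the matrices generates the tensor product of the two
    flows. *)
Lemma skolem_tens n1 n2 (A1 : 'M[R]_n1) (A2 : 'M[R]_n2)
    (b1 c1 : 'cV[R]_n1) (b2 c2 : 'cV[R]_n2) t :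
  skolem_fun (tensmx A1 1%:M + tensmx 1%:M A2) (tensmx b1 b2 : 'cV[R]_(n1 * n2))
    (tensmx c1 c2 : 'cV[R]_(n1 * n2)) t =
  skolem_fun A1 b1 c1 t * skolem_fun A2 b2 c2 t.
Proof.
pose y1 t := expmx (t *: A1) *m b1; pose y2 t := expmx (t *: A2) *m b2.
rewrite (@skolem_ode _ _ _ _ (fun t => tensmx (y1 t) (y2 t) : 'cV[R]_(n1 * n2))).
- change (((tensmx c1 c2)^T *m tensmx (y1 t) (y2 t)) 0 0 =
     skolem_fun A1 b1 c1 t * skolem_fun A2 b2 c2 t).
  by rewrite trmx_tens tensmx_mul tens_col !ord1 /skolem_fun /y1 /y2 !mulmxA.
- move=> s i.
  have H := derM (@ode_expmx _ _ A1 b1 s (mxtens_unindex i).1)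
                 (@ode_expmx _ _ A2 b2 s (mxtens_unindex i).2).
  apply: der_ext (der_eq _ H) => [r|]; first by rewrite tens_col.
  transitivity (((tensmx A1 1%:M + tensmx 1%:M A2) *m tensmx (y1 s) (y2 s)) i 0) => //.
  by rewrite mulmxDl !tensmx_mul !mul1mx [RHS]mxE !tens_col.
- by rewrite /y1 /y2 !scale0r; rewrite -(scale0r A1) -(scale0r A2) !expmx0 !mul1mx.
Qed.

Lemma skolem_block n1 n2 (A1 : 'M[R]_n1) (A2 : 'M[R]_n2)
    (b1 c1 : 'cV[R]_n1) (b2 c2 : 'cV[R]_n2) t :
  skolem_fun (block_mx A1 0 0 A2) (col_mx b1 b2) (col_mx c1 c2) t =
  skolem_fun A1 b1 c1 t + skolem_fun A2 b2 c2 t.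
Proof.
pose y1 t := expmx (t *: A1) *m b1; pose y2 t := expmx (t *: A2) *m b2.
rewrite (@skolem_ode _ _ _ _ (fun t => col_mx (y1 t) (y2 t))).
- by rewrite tr_col_mx mul_row_col mxE /skolem_fun /y1 /y2 !mulmxA.
- move=> s i; rewrite mul_block_col !mul0mx addr0 add0r.
  have [j ->|j ->] := split_ordP i.
    rewrite col_mxEu; apply: der_ext (ode_expmx A1 b1 s j) => r.
    by rewrite col_mxEu.
  rewrite col_mxEd; apply: der_ext (ode_expmx A2 b2 s j) => r.
  by rewrite col_mxEd.
- by rewrite /y1 /y2 !expmx0 !mul1mx.
Qed.

Lemma skolem_sub_scalar n (A : 'M[R]_n) (l : R) b c t :
  skolem_fun (A - l%:M) b c t = expR (- l * t) * skolem_fun A b c t.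
Proof.
rewrite (@skolem_ode _ _ _ _ (fun t => expR (- l * t) *: (expmx (t *: A) *m b))).
- by rewrite -scalemxAr mxE /skolem_fun mulmxA.
- move=> s i.
  have H := derM (der_expR (- l) s) (ode_expmx A b s i).
  apply: der_ext (der_eq _ H) => [r|]; first by rewrite [RHS]mxE.
  rewrite -scalemxAr mulmxBl mul_scalar_mx [RHS]mxE [X in _ = _ * X]mxE.
  by rewrite [X in _ = _ * (_ + X)]mxE [X in _ = _ * (_ - X)]mxE; ring.
- by rewrite mulr0 expR0 scale1r expmx0 mul1mx.
Qed.

(** An upper bound of [mxnorm1 A + 1] that is polynomial in the entries; the initial 1 is the decay
    rate left after the shift. *)
Definition shift_rate n (A : 'M[R]_n) : R := 1 + \sum_i \sum_j (A i j ^+ 2 + 1).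
Definition shiftmx n (A : 'M[R]_n) : 'M[R]_n := A - (shift_rate A)%:M.
Definition vecbound n (c : 'cV[R]_n) : R := \sum_i (c i 0 ^+ 2 + 1).

Lemma ler_norm_sqr1 (x : R) : `|x| <= x ^+ 2 + 1.
Proof.
have : 0 <= (`|x| - 1) ^+ 2 by exact: sqr_ge0.
by rewrite -(real_normK (num_real x)) sqrrB; have := normr_ge0 x; nra.
Qed.

Lemma mxnorm1_shift_rate n (A : 'M[R]_n) : mxnorm1 A + 1 <= shift_rate A.
Proof.
rewrite addrC lerD2l; do 2![apply: ler_sum => ? _]; exact: ler_norm_sqr1.
Qed.

Lemma skolem_delta n (A : 'M[R]_n) i j t :
  skolem_fun A (delta_mx j 0) (delta_mx i 0) t = expmx (t *: A) i j.
Proof. by rewrite /skolem_fun trmx_delta -rowE -colE !mxE. Qed.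

Lemma expmx_shift_bound n (A : 'M[R]_n) t i j : 0 <= t ->
  `|expmx (t *: shiftmx A) i j| <= expR (- t).
Proof.
move=> t0; rewrite -skolem_delta skolem_sub_scalar skolem_delta normrM.
rewrite ger0_norm ?expR_ge0 //.
apply: le_trans (ler_wpM2l (expR_ge0 _) (expmx_bound A i j t0)) _.
rewrite -expRD ler_expR; have := mxnorm1_shift_rate A; nra.
Qed.

Lemma vecbound_ge0 n (c : 'cV[R]_n) : 0 <= vecbound c.
Proof. by apply: sumr_ge0 => i _; rewrite addr_ge0 // sqr_ge0. Qed.

Lemma expmx_shift_col_bound n (A : 'M[R]_n) b t i : 0 <= t ->
  `|(expmx (t *: shiftmx A) *m b) i 0| <= vecbound b * expR (- t).
Proof.
move=> t0; rewrite mxE; apply: le_trans (ler_norm_sum _ _ _) _.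
rewrite mulr_suml; apply: ler_sum => j _; rewrite normrM mulrC.
by apply: ler_pM => //; [exact: ler_norm_sqr1 | exact: expmx_shift_bound].
Qed.

Lemma skolem_shift_bound n (A : 'M[R]_n) b c t : 0 <= t ->
  `|skolem_fun (shiftmx A) b c t| <= vecbound c * vecbound b * expR (- t).
Proof.
move=> t0; rewrite /skolem_fun -mulmxA mxE; apply: le_trans (ler_norm_sum _ _ _) _.
rewrite -mulrA mulr_suml; apply: ler_sum => j _; rewrite normrM mxE.
by apply: ler_pM => //; [exact: ler_norm_sqr1 | exact: expmx_shift_col_bound].
Qed.

End SkolemFunctions.

(** * A quantitative criterion for simple zeros *)

Section ZeroDetection.
Variable R : realType.
Implicit Types f : R -> R.

(** The point [s] is twice the Newton step [f 0 / a]. Taylor's formula gives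
    [f s <= - f 0 + M s^2 / 2 < 0], and [M s < a] keeps [f1] negative on the whole interval, so that
    the zero in between is simple. *)
Lemma newton_zero f f1 f2 (M a s : R) :
  (forall x, der f x (f1 x)) -> (forall x, der f1 x (f2 x)) -> 0 < s ->
  (forall x, 0 <= x <= s -> `|f2 x| <= M) ->
  0 < a -> f1 0 = - a -> 0 < f 0 -> s = 2 * f 0 / a -> 2 * M * f 0 < a ^+ 2 ->
  exists x, [/\ 0 <= x <= s, f x = 0 & f1 x < 0].
Proof.
move=> Df Df1 s0 bM a0 f10 f00 sE MM.
have as_ : a * s = 2 * f 0 by rewrite sE mulrC divfK ?gt_eqF.
have Ms : M * s < a.
  by rewrite -(ltr_pM2r a0) -mulrA (mulrC s) as_; nra.
have b2 x : 0 <= x <= s -> f2 x <= M by move/bM; apply: le_trans (ler_norm _).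
have H1 x : 0 <= x <= s -> f1 x <= - a + M * x.
  move=> /andP[x0 xs].
  have := @der_monoT R (fun t => (M * t + - a) - f1 t) (fun t => M - f2 t) 0 x x0.
  move=> H; have := H (fun t => derB (der_affine M (- a) t) (Df1 t)).
  rewrite mulr0 add0r f10 opprK addNr subr_ge0 addrC; apply=> t /andP[t0 tx].
  rewrite subr_ge0; apply: b2; rewrite (ltW t0) /=; exact: (ltW (lt_le_trans tx xs)).
have H1n x : 0 <= x <= s -> f1 x < 0.
  move=> xs; apply: le_lt_trans (H1 x xs) _; case/andP: xs => x0 xs.
  have [M0|M0] := leP 0 M; nra.
have fs : f s < 0.
  have D t : der (fun t => (M / 2 * (t * t) + (- a * t + f 0)) - f t) t
     ((M / 2 * (1 * t + t * 1) + - a) - f1 t).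
    apply: derB (Df t); apply: derD (der_affine _ _ _).
    exact: (derZ _ (derM (der_id t) (der_id t))).
  have := der_monoT (ltW s0) D.
  rewrite !mulr0 !add0r subrr subr_ge0 => H.
  have {}H : f s <= M / 2 * (s * s) + (- a * s + f 0).
    apply: H => t /andP[t0 ts]; rewrite mul1r mulr1.
    have := H1 t; rewrite (ltW t0) (ltW ts) => /(_ isT); lra.
  nra.
have [|x xs fx0] := @IVT R f 0 s 0 (ltW s0) (der_continuousW Df).
  by rewrite ge_min le_max (ltW fs) (ltW f00) orbT.
by exists x; rewrite in_itv /= in xs; split=> //; exact: H1n.
Qed.

(* As in the Newton-Kantorovich theorem, the bounds on the derivatives force a
   zero within distance [2 |f t / f1 t| <= t] of [t]. *)
Lemma simple_zero_near f f1 f2 (M t : R) :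
  (forall x, der f x (f1 x)) -> (forall x, der f1 x (f2 x)) ->
  (forall x, 0 <= x -> `|f1 x| <= M) -> (forall x, 0 <= x -> `|f2 x| <= M) ->
  0 <= t -> 2 * M * `|f t| < (1 - expR (- t)) * f1 t ^+ 2 ->
  exists2 x, 0 <= x & f x = 0 /\ f1 x != 0.
Proof.
move=> Df Df1 b1 b2 t0 H.
have e1 : 1 - expR (- t) <= t.
  have := expR_ge1Dx (- t); lra.
have e2 : 1 - expR (- t) <= 1 by have := expR_ge0 (- t); lra.
have e0 : 0 <= 1 - expR (- t) by rewrite subr_ge0 -(@expR0 R) ler_expR; lra.
have M0 : 0 <= M by apply: le_trans (b1 0 (lexx _)).
have f1n : f1 t != 0.
  by apply: contraTneq H => ->; rewrite expr0n mulr0 -leNgt !mulr_ge0.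
have [ft0|ftn] := eqVneq (f t) 0; first by exists t.
pose a := `|f1 t|; have a0 : 0 < a by rewrite normr_gt0.
have aM : a <= M by exact: b1.
have a2 : a ^+ 2 = f1 t ^+ 2 by rewrite real_normK ?num_real.
pose d := `|f t|; have d0 : 0 < d by rewrite normr_gt0.
rewrite -a2 -/d in H.
have Hs1 : 2 * M * d < a ^+ 2 by have := sqr_ge0 a; nra.
pose s := 2 * d / a.
have s0 : 0 < s by rewrite divr_gt0 // mulr_gt0.
(* This is where [1 - e^(-t) <= t] is used: with [a <= M], it turns the hypothesis into
   [2 M d < t a M]. *)
have st : s <= t.
  rewrite ler_pdivrMr // -(ler_pM2l (lt_le_trans a0 aM)).
  have : (1 - expR (- t)) * a ^+ 2 <= t * a * M.
    rewrite expr2 -mulrA; apply: ler_pM => //; first by rewrite mulr_ge0 // ltW.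
    exact: ler_pM (ltW a0) (ltW a0) (lexx _) aM.
  by lra.
(* The factor [e] makes the value at [t] positive, and [o] is the direction in which [|f|]
   decreases: [g] starts from [|f t|] with slope [- |f1 t|]. *)
pose e : R := Num.sg (f t); pose o : R := - (Num.sg (f t) * Num.sg (f1 t)).
have ee : e * e = 1 by rewrite -expr2 sqr_sg ftn.
have oo : o * o = 1 by rewrite mulrNN mulrACA -!expr2 !sqr_sg ftn f1n mulr1.
have o1 : `|o| = 1 by rewrite normrN normrM !normr_sg ftn f1n mulr1.
pose g x := e * f (t + o * x).
have Dg (h h' : R -> R) : (forall x, der h x (h' x)) ->
    forall k x, der (fun x => k * h (t + o * x)) x (k * o * h' (t + o * x)).
  move=> Dh k x; apply: der_eq (derZ k (@der_comp _ h (fun x => t + o * x) x _ o (Dh _) _)).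
    by rewrite mulrA [k * _ * _]mulrAC.
  by apply: der_ext (der_affine o t x) => z; rewrite addrC.
have nn x : 0 <= x <= s -> 0 <= t + o * x.
  move=> /andP[x0 xs]; have : `|o * x| <= t.
    by rewrite normrM o1 mul1r ger0_norm // (le_trans xs).
  by rewrite ler_norml => /andP[]; lra.
have e1' : `|e| = 1 by rewrite normr_sg ftn.
have g0 : e * f (t + o * 0) = d by rewrite mulr0 addr0 /e -normrEsg.
have [||||||x [/nn xs /eqP]] := @newton_zero _ _ _ M a s (Dg _ _ Df e) (Dg _ _ Df1 (e * o)) s0.
- move=> x /nn x0; rewrite -[e * o * o]mulrA oo mulr1.
  by rewrite normrM e1' mul1r; exact: b2.
- by [].
- rewrite mulr0 addr0 /e /o mulrN mulrA -expr2 sqr_sg ftn mul1r mulNr.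
  by rewrite -normrEsg.
- by rewrite g0.
- by rewrite g0.
- by rewrite g0.
rewrite mulf_eq0 => /orP[|/eqP fx0 f1x].
  by rewrite -normr_eq0 e1' oner_eq0.
exists (t + o * x) => //; split=> //.
by apply: contraTneq f1x => ->; rewrite mulr0 ltxx.
Qed.

End ZeroDetection.

(** * Vanishing of all derivatives at a point *)

Section Krylov.
Variable R : realType.

(** By [der_skolem], [skolem_fun A b (krylov A c k)] is the [k]-th derivative of
    [skolem_fun A b c]. *)
Definition krylov n (A : 'M[R]_n) (c : 'cV[R]_n) k := iter k (mulmx A^T) c.

Lemma krylov_annihilated n (A : 'M[R]_n) c :
  \sum_(i < n.+1) (char_poly A^T)`_i *: krylov A c i = 0.
Proof.
case: n A c => [|n] A c; first by apply/colP => -[].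
have H := congr1 (mulmx^~ c) (Cayley_Hamilton A^T).
rewrite mul0mx in H; rewrite -[RHS]H.
rewrite /horner_mx /horner_morph /= (@horner_coef_wide _ n.+2); last first.
  by rewrite (leq_trans (size_poly _ _)) // size_char_poly.
rewrite mulmx_suml.
apply: eq_bigr => i _; rewrite coef_map /= -mulmxE mul_scalar_mx -scalemxAl; congr (_ *: _).
elim: (nat_of_ord i) => [|k IH]; first by rewrite expr0 mul1mx.
by rewrite /krylov iterS -/(krylov A c k) IH exprS -mulmxE mulmxA.
Qed.

(** By Cayley-Hamilton, the derivatives of order less than [n] form a solution of a linear system,
    which is 0 if it starts from 0. *)
Lemma skolem_krylov0 n (A : 'M[R]_n) (b c : 'cV[R]_n) :
  (forall k, (k < n)%N -> skolem_fun A b (krylov A c k) 0 = 0) ->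
  forall t, skolem_fun A b c t = 0.
Proof.
case: n A b c => [|n] A b c H t; first by rewrite /skolem_fun mxE big_ord0.
pose F k t := skolem_fun A b (krylov A c k) t.
pose chi := char_poly A^T.
(* The companion matrix of the characteristic polynomial: each row passes to the next derivative,
   and the last one expresses the derivative of order [n.+1] by those below. *)
pose K : 'M[R]_n.+1 :=
  \matrix_(i, j) if (i == n :> nat) then - chi`_j else (j == i.+1 :> nat)%:R.
pose y t : 'cV[R]_n.+1 := \col_i F i t.
have FS : forall s, F n.+1 s = - \sum_(j < n.+1) chi`_j * F j s.
  move=> s; have := krylov_annihilated A c; rewrite big_ord_recr /= => E.
  have c1 : chi`_n.+1 = 1.
    by have /monicP := char_poly_monic A^T; rewrite /lead_coef size_char_poly.
  rewrite -/chi c1 scale1r in E.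
  have /eqP := congr1 (fun d => skolem_fun A b d s) E.
  rewrite /skolem_fun linearD linear_sum /= mulmxDl mulmxDl mxE trmx0 !mul0mx.
  rewrite [X in _ == X]mxE addrC addr_eq0 => /eqP E1; apply: (etrans E1).
  rewrite !mulmx_suml summxE; congr (- _); apply: eq_bigr => j _.
  by rewrite linearZ /= -!scalemxAl mxE.
have Hy : ode K y.
  move=> s i; apply: der_ext (der_eq _ (der_skolem A b (krylov A c i) s)) => [r|].
    by rewrite mxE.
  rewrite -[A^T *m _]/(krylov A c i.+1) -/(F i.+1 s) mxE.
  have [iN|iN] := eqVneq (val i) n.
    rewrite iN FS -sumrN; apply: eq_bigr => j _.
    by rewrite !mxE /= iN eqxx mulNr.
  have i1 : (i.+1 < n.+1)%N by have := ltn_ord i; rewrite /= in iN; lia.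
  rewrite (bigD1 (Ordinal i1)) //= !mxE (negPf iN) eqxx mul1r big1 ?addr0 // => j jn.
  rewrite !mxE (negPf iN) (_ : (j == i.+1 :> nat) = false) ?mul0r //.
  by apply: contraNF jn => /eqP E; apply/eqP/val_inj.
have y0 : y 0 = 0 by apply/colP => i; rewrite !mxE; exact: H.
have := ode_unique Hy 0 t; rewrite add0r y0 mulmx0 => /colP/(_ 0).
by rewrite !mxE.
Qed.

End Krylov.

(** * Comparison of orders of vanishing near 0 *)

Section SmallTimes.
Variable R : realType.

Lemma der_near (f : R -> R) x d e : der f x d -> 0 < e ->
  exists2 eps, 0 < eps & forall t, `|t - x| < eps -> `|f t - f x| < e.
Proof.
move=> /der_continuous /cvgrPdist_lt H e0.
have := H e e0; rewrite nearE => /nbhs_ballP[eps eps0 Hb].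
exists eps => // t tx; rewrite distrC; apply: Hb.
by rewrite /ball /= distrC.
Qed.

(** Induction on the order of vanishing [m], applied to the derivative. If [t F2 <= C F1], then
    [(C + 1) F0 - t F1] has derivative [C F1 - t F2 >= 0] and starts from 0. In the base case [F0]
    stays away from 0 and [F1] is bounded. *)
Lemma zero_growth m (F : nat -> R -> R) :
  (forall k x, der (F k) x (F k.+1 x)) ->
  (forall k, (k < m)%N -> F k 0 = 0) -> 0 < F m 0 ->
  exists2 eps, 0 < eps & exists C, forall t, 0 < t <= eps ->
    [/\ 0 < F 0%N t, t * F 1%N t <= C * F 0%N t & (0 < m)%N -> 0 < F 1%N t].
Proof.
elim: m F => [|m IH] F DF F0 Fm.
  have [e1 e10 H1] := der_near (DF 0%N 0) (divr_gt0 Fm (ltr0Sn R 1)).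
  have [e2 e20 H2] := der_near (DF 1%N 0) (@ltr01 R).
  exists (Num.min (Num.min (e1 / 2) (e2 / 2)) 1).
    by rewrite !lt_min !divr_gt0 // ltr01.
  exists ((`|F 1%N 0| + 1) / (F 0%N 0 / 2)) => t.
  rewrite !le_min -!andbA => /and4P[t0 t1 t2 t3].
  have E : F 0%N 0 / 2 < F 0%N t.
    have : `|F 0%N t - F 0%N 0| < F 0%N 0 / 2.
      apply: H1; rewrite subr0 gtr0_norm //; lra.
    by rewrite ltr_norml => /andP[]; lra.
  split=> //; first by apply: lt_trans E; rewrite divr_gt0.
  have E1 : F 1%N t <= `|F 1%N 0| + 1.
    have : `|F 1%N t - F 1%N 0| < 1.
      by apply: H2; rewrite subr0 gtr0_norm //; lra.
    by rewrite ltr_norml => /andP[]; have := ler_norm (F 1%N 0); lra.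
  apply: (@le_trans _ _ (t * (`|F 1%N 0| + 1))); first by rewrite ler_wpM2l // ltW.
  apply: (@le_trans _ _ (`|F 1%N 0| + 1)); first by rewrite ler_piMl // addr_ge0.
  rewrite -mulrA ler_peMr ?addr_ge0 // mulrC ler_pdivlMr ?divr_gt0 //.
  by rewrite mul1r ltW.
have [eps eps0 [C H]] := IH (fun k => F k.+1) (fun k => DF k.+1) (fun k km => F0 k.+1 km) Fm.
exists eps => //; exists (C + 1) => t /andP[t0 te].
have P s : 0 < s < t -> 0 < F 1%N s /\ s * F 2%N s <= C * F 1%N s.
  move=> /andP[s0 st]; have [|] := H s _; last by [].
  by rewrite s0 (le_trans (ltW st) te).
have Z : F 0%N 0 = 0 by exact: F0.
have [F1t _ _] : [/\ 0 < F 1%N t, t * F 2%N t <= C * F 1%N t & (0 < m)%N -> 0 < F 2%N t].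
  by apply: H; rewrite t0.
split=> //.
  rewrite -Z; have [c /[!in_itv] /= ct E] :=
    MVT t0 (fun x _ => DF 0%N x) (der_continuousW (DF 0%N)).
  rewrite -subr_gt0 E mulr_gt0 ?subr_gt0 //; exact: (P c ct).1.
have := @der_monoT R (fun s => (C + 1) * F 0%N s - s * F 1%N s)
  (fun s => (C + 1) * F 1%N s - (1 * F 1%N s + s * F 2%N s)) 0 t (ltW t0).
rewrite Z mulr0 mul0r subr0 subr_ge0; apply.
  by move=> x; apply: derB (derZ _ (DF 0%N x)) (derM (der_id x) (DF 1%N x)).
by move=> s /P[_ ?]; lra.
Qed.

(** At order 0, the time [t = 0] will do. From order 2 on, [zero_growth] bounds [t F1^2] by
    [C F0 F1], and [F1] tends to 0 at 0. *)
Lemma order_not1_dominates (F : nat -> R -> R) m (M : R) :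
  (forall k x, der (F k) x (F k.+1 x)) ->
  (forall k, (k < m)%N -> F k 0 = 0) -> F m 0 != 0 -> m != 1%N -> 0 < M ->
  exists2 t, 0 <= t & (1 - expR (- t)) * F 1%N t ^+ 2 < 2 * M * `|F 0%N t|.
Proof.
move=> DF F0 Fm m1 M0.
wlog Fp : F DF F0 Fm / 0 < F m 0.
  move=> W; have := Fm; rewrite neq_lt => /orP[Fn|]; last exact: W.
  have [||||t t0 H] := W (fun k t => - F k t).
  - by move=> k x; exact: derN.
  - by move=> k km; rewrite F0 ?oppr0.
  - by rewrite oppr_eq0.
  - by rewrite oppr_gt0.
  by exists t => //; move: H; rewrite sqrrN normrN.
have [m0|mp] := posnP m.
  exists 0 => //; rewrite oppr0 expR0 subrr mul0r -m0 !mulr_gt0 // normr_gt0.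
  by rewrite gt_eqF.
have [eps eps0 [C H]] := zero_growth DF F0 Fp.
have F10 : F 1%N 0 = 0 by apply: F0; lia.
have e0 : 0 < 2 * M / (`|C| + 1) by rewrite divr_gt0 ?mulr_gt0 // ltr_wpDl.
have [e e1 He] := der_near (DF 1%N 0) e0.
pose t := Num.min eps (e / 2).
have t0 : 0 < t by rewrite lt_min eps0 divr_gt0.
have [|P1 P2 /(_ mp) P3] := H t; first by rewrite t0 ge_min lexx.
exists t; first exact: ltW.
have F1t : (`|C| + 1) * F 1%N t < 2 * M.
  have := He t; rewrite subr0 F10 subr0 (gtr0_norm t0) (gtr0_norm P3) => Ht.
  rewrite mulrC -ltr_pdivlMr ?ltr_wpDl //; apply: Ht.
  by rewrite gt_min orbC; apply/orP; left; lra.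
rewrite (gtr0_norm P1).
have E : 1 - expR (- t) <= t by have := expR_ge1Dx (- t); lra.
apply: (@le_lt_trans _ _ (t * F 1%N t ^+ 2)).
  by rewrite ler_wpM2r ?sqr_ge0.
apply: (@le_lt_trans _ _ (C * F 0%N t * F 1%N t)).
  by rewrite expr2 mulrA ler_wpM2r // ltW.
rewrite mulrAC ltr_pM2r //; apply: le_lt_trans F1t.
by rewrite ler_wpM2r ?(ltW P3) //; have := ler_norm C; lra.
Qed.

End SmallTimes.

(** * The function whose sign changes detect simple zeros *)

Section SignFunction.
Variables (R : realType) (n : nat) (A : 'M[R]_n) (b c : 'cV[R]_n).

Let B := shiftmx A.
Let c1 := B^T *m c.
Let c2 := B^T *m c1.

(** Bounds the first and second derivatives of the shifted function on [[0, +oo)]; the final 1 makes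
    it positive. *)
Definition deriv_bound : R := (vecbound c1 + vecbound c2) * vecbound b + 1.

Definition sign_fun (t : R) : R :=
  (2 * deriv_bound * skolem_fun B b c t) ^+ 2 -
  ((1 - expR (- t)) * skolem_fun B b c1 t ^+ 2) ^+ 2.

Let M := deriv_bound.

Let M0 : 0 < M.
Proof.
by rewrite ltr_wpDl // mulr_ge0 ?addr_ge0 ?vecbound_ge0.
Qed.

Let bound d t : vecbound d * vecbound b <= M -> 0 <= t ->
  `|skolem_fun B b d t| <= M.
Proof.
move=> dM t0; apply: le_trans (skolem_shift_bound A b d t0) _.
apply: le_trans dM; rewrite ler_piMr ?mulr_ge0 ?vecbound_ge0 //.
by rewrite -expR0 ler_expR oppr_le0.
Qed.

Let bound1 t : 0 <= t -> `|skolem_fun B b c1 t| <= M.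
Proof.
apply: bound; rewrite /M /deriv_bound mulrDl -addrA lerDl addr_ge0 //.
by rewrite mulr_ge0 ?vecbound_ge0.
Qed.

Let bound2 t : 0 <= t -> `|skolem_fun B b c2 t| <= M.
Proof.
apply: bound; rewrite /M /deriv_bound mulrDl addrAC lerDr addr_ge0 //.
by rewrite mulr_ge0 ?vecbound_ge0.
Qed.

Let e0 (t : R) : 0 <= t -> 0 <= 1 - expR (- t).
Proof. by move=> t0; rewrite subr_ge0 -(@expR0 R) ler_expR; lra. Qed.

(** The derivative of [e^(-lt) f] is [e^(-lt) (f' - l f)], which at a zero of [f] is a nonzero
    multiple of [f']. *)
Lemma nontangential_shift t :
  nontangential_zero (skolem_fun A b c) t <->
  skolem_fun B b c t = 0 /\ skolem_fun B b c1 t != 0.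
Proof.
have E d : skolem_fun B b d t = expR (- shift_rate A * t) * skolem_fun A b d t.
  exact: skolem_sub_scalar.
have en : expR (- shift_rate A * t) != 0 by rewrite gt_eqF ?expR_gt0.
have -> : skolem_fun B b c1 t =
    expR (- shift_rate A * t) * (skolem_fun A b (A^T *m c) t
       - shift_rate A * skolem_fun A b c t).
  have D1 := der_skolem B b c t.
  have D2 := derM (der_expR (- shift_rate A) t) (der_skolem A b c t).
  have := der_unique D1 (der_ext (fun s => esym (skolem_sub_scalar A _ b c s)) D2).
  by rewrite -/c1 => ->; ring.
rewrite /nontangential_zero derive1E (derive_val (is_derive := der_skolem A b c t)).
rewrite E; split=> -[].
  by move=> -> f1; rewrite !mulr0 subr0; split=> //; rewrite mulf_neq0.
move/eqP; rewrite mulf_eq0 (negPf en) => /eqP ->; rewrite mulr0 subr0.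
by rewrite mulf_eq0 negb_or => /andP[].
Qed.

Lemma sign_fun_neg : ~ (skolem_fun B b c 0 = 0 /\ skolem_fun B b c1 0 != 0) ->
  (exists2 t, 0 <= t & sign_fun t < 0) <->
  (exists2 t, 0 <= t & nontangential_zero (skolem_fun A b c) t).
Proof.
move=> H0; split=> -[t t0].
  rewrite /sign_fun subr_lt0 -/M -[X in X < _]real_normK ?num_real //.
  rewrite ltr_pXn2r ?nnegrE //; last by apply: mulr_ge0; [exact: e0 | exact: sqr_ge0].
  rewrite normrM gtr0_norm ?mulr_gt0 // => H.
  have [x x0 Hx] := simple_zero_near (der_skolem B b c) (der_skolem B b c1) bound1 bound2 t0 H.
  by exists x; [exact: x0 | exact: (nontangential_shift x).2 Hx].
move/nontangential_shift => [f0 f1]; exists t => //.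
rewrite /sign_fun f0 mulr0 expr0n /= sub0r oppr_lt0 exprn_gt0 //.
apply: mulr_gt0; last by rewrite exprn_even_gt0.
rewrite subr_gt0 -(@expR0 R) ltr_expR oppr_lt0 lt_neqAle t0 andbT.
(* The factor [1 - e^(-t)] is nonzero because [H0] forbids a simple zero at time 0. *)
by apply/eqP => t00; apply: H0; rewrite -t00 in f0 f1.
Qed.

Lemma sign_fun_pos k : skolem_fun B b (krylov B c k) 0 != 0 ->
  ~ (skolem_fun B b c 0 = 0 /\ skolem_fun B b c1 0 != 0) ->
  exists2 t, 0 <= t & 0 < sign_fun t.
Proof.
move=> fk H0.
(* The order of vanishing at 0, which [H0] prevents from being 1. *)
have [m fm mmin] := ex_minnP (ex_intro (fun k => skolem_fun B b (krylov B c k) 0 != 0) k fk).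
have [|||||t t0 Ht] := @order_not1_dominates R (fun k => skolem_fun B b (krylov B c k)) m M.
- by move=> j x; exact: der_skolem.
- by move=> j jm; apply/eqP; apply: contraTT jm => /mmin; rewrite leqNgt.
- by [].
- apply/eqP => m1; apply: H0; rewrite m1 in fm; split=> //.
  by apply/eqP; apply: contraT => /(mmin 0%N); rewrite m1.
- exact: M0.
exists t => //; rewrite /sign_fun subr_gt0 -/M.
rewrite -[X in _ < X]real_normK ?num_real // ltr_pXn2r ?nnegrE //.
  by rewrite normrM gtr0_norm ?mulr_gt0.
by apply: mulr_ge0; [exact: e0 | exact: sqr_ge0].
Qed.

End SignFunction.

(** * Reachable states *)

Section Reachability.
Variable R : realType.
Notation mu := (@lebesgue_measure R).

Lemma integrable_subitv (f : R -> R) (a b c d : R) : a <= c -> d <= b ->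
  mu.-integrable `[a, b] (EFin \o f) -> mu.-integrable `[c, d] (EFin \o f).
Proof.
move=> ac db; apply: integrableS => //.
by apply: subset_itv; rewrite bnd_simp.
Qed.

Lemma bounded_integrable (f : R -> R) (a b M : R) :
  measurable_fun `[a, b] f -> (forall s, a <= s <= b -> `|f s| <= M) ->
  mu.-integrable `[a, b] (EFin \o f).
Proof.
move=> mf bf; apply: measurable_bounded_integrable => //.
  by have := lebesgue_measure_itv `[a, b]; rewrite /= => ->; case: ifP => _; rewrite -?EFinB ltry.
exists M; split; first exact: num_real.
move=> x Mx y /=; rewrite in_itv /= => /bf; move/le_trans; apply; exact: ltW.
Qed.

Lemma continuous_integrable (f : R -> R) (a b : R) :
  {within `[a, b], continuous f} -> mu.-integrable `[a, b] (EFin \o f).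
Proof. by apply: continuous_compact_integrable; exact: segment_compact. Qed.

Lemma Rintegral_lipschitz (u : R -> R) (T s t : R) :
  measurable_fun `[0, T] u -> (forall s, 0 <= s <= T -> `|u s| <= 1) ->
  0 <= s -> s <= t -> t <= T ->
  `|\int[mu]_(r in `[0, t]) u r - \int[mu]_(r in `[0, s]) u r| <= t - s.
Proof.
move=> mu_ bu s0 st tT.
have iu := bounded_integrable mu_ bu.
have iut : mu.-integrable `[0, t] (EFin \o u) by apply: integrable_subitv iu.
rewrite Rintegral_itvB ?bnd_simp //.
have iust : mu.-integrable `]s, t] (EFin \o u).
  by apply: integrableS iut => //; apply: subset_itv; rewrite bnd_simp.
apply: le_trans (le_normr_Rintegral _ iust) _ => //.
have -> : t - s = \int[mu]_(r in `]s, t]) 1.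
  rewrite Rintegral_cst // mul1r; have := lebesgue_measure_itv `]s, t].
  rewrite /= lte_fin => ->.
  by case: ltP => // ts; rewrite -?EFinB //= (le_anti (_ : s <= t <= s)) ?subrr // st.
apply: le_Rintegral => //.
- by apply/integrable_norm.
- have H : mu.-integrable `[s, t] (EFin \o cst (1 : R)).
    by apply: continuous_integrable => x; exact: cst_continuous.
  by apply: integrableS H => //; apply: subset_itv; rewrite bnd_simp.
- move=> x /=; rewrite in_itv /= => /andP[sx xt]; apply: bu.
  by rewrite (le_trans s0 (ltW sx)) (le_trans xt tT).
Qed.

(** Over [N + 1] equal steps the increments add up to at most [L T^2 / (N + 1)], which falls below
    any positive gap [f T - f 0]. *)
Lemma le_of_quadratic_increments (f : R -> R) (T L : R) : 0 <= T ->
  (forall s t, 0 <= s -> s <= t -> t <= T -> f t - f s <= L * (t - s) ^+ 2) ->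
  f T <= f 0.
Proof.
move=> T0 H; rewrite leNgt; apply/negP => fT.
have d0 : 0 < f T - f 0 by rewrite subr_gt0.
pose B := Num.max 0 (L * T ^+ 2).
have [N /= HN] : exists N : nat, B / (f T - f 0) < N.+1%:R.
  exists (Num.bound (B / (f T - f 0))).
  apply: lt_le_trans (archi_boundP _) _; last by rewrite ler_nat.
  by rewrite divr_ge0 ?le_max ?lexx // ltW.
pose h := T / N.+1%:R.
have h0 : 0 <= h by rewrite divr_ge0.
have K k : (k <= N.+1)%N -> f (k%:R * h) - f 0 <= k%:R * (L * h ^+ 2).
  elim: k => [|k IH] kN; first by rewrite !mul0r subrr.
  have := IH (ltnW kN); have := H (k%:R * h) (k.+1%:R * h).
  have -> : k.+1%:R * h - k%:R * h = h by rewrite -natr1; ring.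
  rewrite -natr1 => /(_ (mulr_ge0 (ler0n _ _) h0)) H1 H2.
  have {}H1 : f ((k%:R + 1) * h) - f (k%:R * h) <= L * h ^+ 2.
    apply: H1; first by rewrite mulrDl lerDl mul1r.
    rewrite natr1 /h mulrA ler_pdivrMr // mulrC ler_wpM2l // ler_nat //.
  by rewrite [leRHS]mulrDl mul1r; lra.
have := K _ (leqnn _).
rewrite {1}/h mulrC divfK ?pnatr_eq0 // leNgt => /negP; apply.
have -> : N.+1%:R * (L * h ^+ 2) = L * T ^+ 2 / N.+1%:R.
  by rewrite /h; field; rewrite addrC natr1 pnatr_eq0.
rewrite ltr_pdivrMr // [ltRHS]mulrC -ltr_pdivrMr //.
apply: le_lt_trans HN; rewrite ler_wpM2r ?invr_ge0 ?(ltW d0) //.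
by rewrite le_max lexx orbT.
Qed.

Section Bound.
Variables (n : nat) (A : 'M[R]_n) (b w : 'cV[R]_n).
Variables (T : R) (u : R -> 'cV[R]_1) (x : R -> 'cV[R]_n).
Hypotheses (T0 : 0 <= T) (umeas : forall j, measurable_fun `[0, T] (fun s => u s j 0)).
Hypotheses (usat : forall s, 0 <= s <= T -> saturated (u s)).
Hypothesis solx : lti_solution A b T u 0 x.

Let v s := u s 0 0.
(** The state splits as [x = X + U b]. The part [X] is differentiable, as an integral of a
    continuous function, whereas [U] is only Lipschitz because the control is merely measurable. *)
Let U t := \int[mu]_(s in `[0, t]) v s.
Let X i t := \int[mu]_(s in `[0, t]) (A *m x s) i 0.
Let g := skolem_fun A b w.
Let h := skolem_fun A (A *m b) w.
Let r j s := (w^T *m expmx ((T - s) *: A)) 0 j.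

Let vbound s : 0 <= s <= T -> `|v s| <= 1.
Proof. by move=> /usat; rewrite /saturated /= ler_norml. Qed.

Let xcont i : {within `[0, T], continuous (fun s => x s i 0)}.
Proof.
have [cx _ _ _] := solx.
move=> s; exact: (@continuous_comp (subspace `[0, T]) _ _ x (fun M : 'cV[R]_n => M i 0) s (cx s) (@coord_continuous _ _ _ i 0 (x s))).
Qed.

Let Axcont i : {within `[0, T], continuous (fun s => (A *m x s) i 0)}.
Proof.
rewrite (_ : (fun s => _) = \sum_j (fun s => A i j * x s j 0)); last first.
  by apply/funext => s; rewrite mxE fct_sumE.
move=> s; elim/big_ind: _ => [|f1 f2 H1 H2|j _].
- exact: cst_continuous.
- exact: continuousD.
- by apply: continuousM; [exact: cst_continuous | exact: xcont].
Qed.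

Let xE i t : 0 <= t <= T -> x t i 0 = X i t + b i 0 * U t.
Proof.
move=> /andP[t0 tT]; have [_ _ _ /(_ t)] := solx.
rewrite t0 tT => /(_ isT i) E; rewrite /X E mxE add0r.
have iv : mu.-integrable `[0, t] (EFin \o v).
  by apply: (@integrable_subitv _ 0 T) => //; apply: bounded_integrable vbound; exact: umeas.
have iAx : mu.-integrable `[0, t] (EFin \o (fun s => (A *m x s) i 0)).
  by apply: (@integrable_subitv _ 0 T) => //; apply: continuous_integrable; exact: Axcont.
transitivity (\int[mu]_(s in `[0, t]) ((A *m x s) i 0 + b i 0 * v s)).
  apply: eq_Rintegral; by move=> s _; rewrite mxE; congr (_ + _); rewrite mxE big_ord1.
rewrite RintegralD // ?RintegralZl //.
exact: (integrableZl _ (b i 0) iv).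
Qed.

Let dX i t : 0 < t < T -> der (X i) t ((A *m x t) i 0).
Proof.
move=> /andP[t0 tT].
have iAx : mu.-integrable `[0, T] (EFin \o (fun s => (A *m x s) i 0)).
  by apply: continuous_integrable; exact: Axcont.
have ct : {for t, continuous (fun s => (A *m x s) i 0)}.
  apply: (@within_continuous_continuous _ _ _ 0 T); first exact: lt_trans tT.
    exact: Axcont.
  by rewrite in_itv /= t0.
have [D1 D2] := continuous_FTC1_closed tT iAx t0 ct.
by split=> //; rewrite -derive1E.
Qed.

Let Xcont i : {within `[0, T], continuous (X i)}.
Proof.
apply: parameterized_integral_continuous => //.
by apply: continuous_integrable; exact: Axcont.
Qed.

Let K s := (w^T *m expmx ((T - s) *: A) *m \col_j X j s) 0 0.

Let der_row s i (j : 'I_n) : der (fun s => (w^T *m expmx ((T - s) *: A)) i j) s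
  ((- (w^T *m expmx ((T - s) *: A) *m A)) i j).
Proof.
have D0 k l : der (fun=> (w^T : 'rV[R]_n) k l) s ((0 : 'rV[R]_n) k l).
  by rewrite [X in der _ _ X]mxE; exact: der_cst.
have DE k l : der (fun s => expmx ((T - s) *: A) k l) s
    ((- (expmx ((T - s) *: A) *m A)) k l).
  rewrite [X in der _ _ X]mxE.
  by apply: (@der_subl _ (fun u => expmx (u *: A) k l)); exact: (der_expmx A _ _ _).2.
apply: der_eq (der_mulmx D0 DE i j).
by rewrite mul0mx add0r mulmxN mulmxA.
Qed.

(** The derivative of the exponential contributes [- A X] and that of [X] contributes [A x]; the
    terms in [X] cancel and [A b U] remains. *)
Let dK s : 0 < s < T -> der K s (h (T - s) * U s).
Proof.
move=> s0T; have DX j (k : 'I_1) : der (fun s => (\col_j X j s) j k) s ((A *m x s) j k).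
  by rewrite ord1; apply: der_ext (dX j s0T) => t; rewrite mxE.
apply: der_eq (der_mulmx (der_row s) DX 0 0).
have -> : x s = \col_j X j s + U s *: b.
  apply/colP => j; rewrite !mxE xE 1?[b _ _ * _]mulrC //.
  by case/andP: s0T => s0 sT; rewrite !ltW.
rewrite !mulmxDr mulNmx -!mulmxA addKr -!scalemxAr mxE mulrC.
by rewrite /h /skolem_fun !mulmxA.
Qed.

Let Kcont : {within `[0, T], continuous K}.
Proof.
rewrite (_ : K = \sum_j ((fun s => (w^T *m expmx ((T - s) *: A)) 0 j) * X j)); last first.
  by apply/funext => s; rewrite /K mxE fct_sumE; apply: eq_bigr => j _; rewrite [X in _ * X]mxE.
move=> s; elim/big_ind: _ => [|f1 f2 H1 H2|j _].
- exact: cst_continuous.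
- exact: continuousD.
- apply: continuousM; last exact: Xcont.
  exact: (der_continuousW (fun s => der_row s 0 j)).
Qed.

(** A form of [w^T x(T) <= \int_0^T |g|], stated with a smooth majorant [gam] of [|g|] and a
    primitive [Gam] of it, since [|g|] need not be differentiable. *)
Lemma reach_bound (gam gam' Gam : R -> R) (L : R) :
  (forall s, der Gam s (gam s)) -> (forall s, der gam s (gam' s)) ->
  (forall s, 0 <= s <= T -> `|gam' s| <= L) ->
  (forall s, 0 <= s <= T -> `|skolem_fun A (A *m b) w s| <= L) ->
  (forall s, 0 <= s <= T -> `|skolem_fun A b w s| <= gam s) ->
  (w^T *m x T) 0 0 <= Gam T - Gam 0.
Proof.
move=> DG Dg bg' bh bg.
(* If U were differentiable, [psi] would be nonincreasing since |U'| <= 1; as U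
   is only Lipschitz, its increments are bounded up to quadratic errors. *)
pose psi s := K s + g (T - s) * U s + Gam (T - s).
have psiE s : 0 <= s <= T ->
    psi s = (w^T *m expmx ((T - s) *: A) *m x s) 0 0 + Gam (T - s).
  move=> s0T; congr (_ + _).
  have -> : x s = \col_j X j s + U s *: b.
    by apply/colP => j; rewrite !mxE xE // [b _ _ * _]mulrC.
  by rewrite mulmxDr mxE -scalemxAr [X in _ = _ + X]mxE mulrC.
have U_lip s t : 0 <= s -> s <= t -> t <= T -> `|U t - U s| <= t - s.
  by apply: Rintegral_lipschitz vbound; exact: umeas.
suff : psi T <= psi 0.
  rewrite !psiE ?lexx ?T0 // subrr subr0 expmx0 mulmx1.
  have [_ x0 _ _] := solx; rewrite x0 mulmx0 [X in _ <= X + _]mxE add0r; lra.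
apply: (@le_of_quadratic_increments _ T (L + L)) => // s t s0 st tT.
have L0 : 0 <= L by apply: le_trans (bh 0 _) => //; rewrite lexx.
have c1 a : a <= t -> 0 <= a -> 0 <= T - a <= T.
  by move=> at_ a0; rewrite subr_ge0 (le_trans at_ tT) gerBl.
(* The increment of [psi] is cut in three: the smooth part with [U] frozen at time [s], the
   increment of [U], and that of [Gam]. The first-order terms [gam (T - t) * (t - s)] of the last
   two cancel. *)
have P1 : K t + g (T - t) * U s - (K s + g (T - s) * U s) <= L * (t - s) ^+ 2.
  have := @der_mono R (fun a => (L * (t - s) * a + 0) - (K a + g (T - a) * U s))
    (fun a => L * (t - s) - (h (T - a) * U a + (- h (T - a)) * U s)) s t st.
  move=> H; have {}H : L * (t - s) * s + 0 - (K s + g (T - s) * U s) <=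
      L * (t - s) * t + 0 - (K t + g (T - t) * U s).
    apply: H.
    - move=> a /andP[sa at_]; apply: derB (der_affine _ _ _) (derD _ _).
        by apply: dK; rewrite (le_lt_trans s0 sa) (lt_le_trans at_ tT).
      have Dgg : der (fun a => g (T - a)) a (- h (T - a)).
        apply: der_subl; apply: der_eq (der_skolem A b w (T - a)).
        rewrite /h /skolem_fun trmx_mul trmxK -!mulmxA; congr ((_ *m _) 0 0).
        rewrite !mulmxA; congr (_ *m _); apply/matrixP => i j.
        have [H1 H2] := der_expmx A (T - a) i j; exact: der_unique H1 H2.
      by have := derM Dgg (der_cst (U s) a); apply: der_eq; rewrite mulr0 addr0.
    - have sub : `[s, t]%classic `<=` `[0, T]%classic by apply: subset_itv; rewrite bnd_simp.
      have C1 := der_continuousW (A := `[s, t]) (der_affine (L * (t - s)) 0).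
      have C2 : {within `[s, t], continuous (fun a => g (T - a) * U s)}.
        have D z := derM (der_subl (der_skolem A b w (T - z))) (der_cst (U s) z).
        exact: der_continuousW D.
      exact: (within_continuousB C1 (within_continuousD (continuous_subspaceW sub Kcont) C2)).
    - move=> a /andP[sa at_]; rewrite mulNr -mulrBr subr_ge0.
      apply: le_trans (ler_norm _) _; rewrite normrM; apply: ler_pM => //.
        by apply: bh; apply: c1; [exact: ltW | exact: le_trans (ltW sa)].
      apply: le_trans (U_lip s a s0 (ltW sa) _) _; first exact: le_trans (ltW at_) tT.
      by rewrite lerD2r ltW.
  rewrite expr2 mulrA; lra.
have P2 : g (T - t) * (U t - U s) <= gam (T - t) * (t - s).
  apply: le_trans (ler_norm _) _; rewrite normrM; apply: ler_pM => //.
    by apply: bg; apply: c1 => //; exact: le_trans st.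
  exact: U_lip.
have P3 : Gam (T - t) - Gam (T - s) <= - gam (T - t) * (t - s) + L * (t - s) ^+ 2.
  have := @der_monoT R (fun a => ((- gam (T - t) + L * (t - s)) * a + 0) - Gam (T - a))
    (fun a => (- gam (T - t) + L * (t - s)) - - gam (T - a)) s t st.
  move=> H; have {}H : (- gam (T - t) + L * (t - s)) * s + 0 - Gam (T - s) <=
    (- gam (T - t) + L * (t - s)) * t + 0 - Gam (T - t).
    apply: H => a; first by apply: derB (der_affine _ _ _) (der_subl _); exact: DG.
    move=> /andP[sa at_].
    have gl : gam (T - t) - gam (T - a) <= L * (t - s).
      have := @der_monoT R (fun r => gam r + (L * r + 0)) (fun r => gam' r + L) (T - t) (T - a).
      move=> H; have {}H : gam (T - t) + (L * (T - t) + 0) <= gam (T - a) + (L * (T - a) + 0).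
        apply: H.
        - by rewrite lerD2l lerN2 ltW.
        - by move=> z; apply: derD (Dg z) (der_affine _ _ _).
        - move=> z /andP[z1 z2].
          have : `|gam' z| <= L.
            apply: bg'; have := c1 t (lexx _) (le_trans s0 st) => /andP[z3 _].
            rewrite (le_trans z3 (ltW z1)) (le_trans (ltW z2)) //.
            by rewrite gerBl (le_trans s0) // ltW.
          by rewrite ler_norml => /andP[]; lra.
      have : L * (t - a) <= L * (t - s) by rewrite ler_wpM2l // lerD2l lerN2 ltW.
      lra.
    lra.
  rewrite expr2 mulrA; lra.
rewrite /psi; lra.
Qed.

End Bound.
End Reachability.

(** * Responses to step controls *)

Section StepResponse.
Variable R : realType.
Notation mu := (@lebesgue_measure R).

Lemma expmx_comm n (A : 'M[R]_n) t : A *m expmx (t *: A) = expmx (t *: A) *m A.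
Proof.
apply/matrixP => i j; have [H1 H2] := der_expmx A t i j; exact: der_unique H1 H2.
Qed.

Lemma continuous_col n (x : R -> 'cV[R]_n) :
  (forall i, continuous (fun s => x s i 0)) -> continuous x.
Proof.
move=> H s B [P HP HB].
have := @filter_forall _ _ (fun i r => P i 0 (x r i 0)) (nbhs s)
  (nbhs_filter s)
  (fun i => H i s _ (HP i 0)).
rewrite /= /nbhs /=; apply: (@filterS _ (nbhs s) (nbhs_filter s)) => r Hr.
by apply: HB => i j; rewrite ord1.
Qed.

Lemma lti_solution_linear n m (A : 'M[R]_n) (B : 'M[R]_(n, m)) (T a c : R)
    u1 u2 x1 x2 :
  lti_solution A B T u1 0 x1 -> lti_solution A B T u2 0 x2 ->
  lti_solution A B T (fun s => a *: u1 s + c *: u2 s) 0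
    (fun s => a *: x1 s + c *: x2 s).
Proof.
move=> [c1 z1 i1 e1] [c2 z2 i2 e2].
have vE s i : (A *m (a *: x1 s + c *: x2 s) + B *m (a *: u1 s + c *: u2 s)) i 0
   = a * (A *m x1 s + B *m u1 s) i 0 + c * (A *m x2 s + B *m u2 s) i 0.
  by rewrite !mulmxDr -!scalemxAr !mxE; ring.
have int i : mu.-integrable `[0, T] (EFin \o (fun s =>
    a * (A *m x1 s + B *m u1 s) i 0 + c * (A *m x2 s + B *m u2 s) i 0)).
  exact: (integrableD _ (integrableZl _ a (i1 i)) (integrableZl _ c (i2 i))).
split.
- by move=> s; apply: cvgD; apply: cvgZl_tmp; [exact: c1 | exact: c2].
- by rewrite z1 z2 !scaler0 addr0.
- move=> i; apply: eq_integrable (int i) => // s _ /=.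
  by rewrite vE.
- move=> t t0T i; have /andP[t0 tT] := t0T.
  rewrite !mxE add0r.
  transitivity (\int[mu]_(s in `[0, t]) (a * (A *m x1 s + B *m u1 s) i 0
      + c * (A *m x2 s + B *m u2 s) i 0)); last first.
    by apply: eq_Rintegral => s _; rewrite vE.
  have j1 := integrable_subitv (lexx 0) tT (i1 i).
  have j2 := integrable_subitv (lexx 0) tT (i2 i).
  rewrite RintegralD //; first last.
  - exact: (integrableZl _ c j2).
  - exact: (integrableZl _ a j1).
  rewrite !RintegralZl // (e1 t t0T) (e2 t t0T) mxE !add0r //.
Qed.

Section Step.
Variables (n : nat) (A : 'M[R]_n) (b d : 'cV[R]_n).
Hypothesis Ad : A *m d = - b.

Definition step_input (tau s : R) : 'cV[R]_1 := const_mx (\1_`[tau, +oo[ s).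
(** When [A d = - b], the trajectory leaves 0 at time [tau] and relaxes to the equilibrium [d]; the
    maximum holds it at 0 before. *)
Definition step_response (tau s : R) : 'cV[R]_n :=
  d - expmx (Num.max 0 (s - tau) *: A) *m d.

Lemma der_step t i : der (fun t => (d - expmx (t *: A) *m d) i 0) t
  ((expmx (t *: A) *m b) i 0).
Proof.
apply: der_ext (der_eq _ (derB (der_cst (d i 0) t) (ode_expmx A d t i))) => [r|].
  by rewrite [RHS]mxE [X in _ = _ + X]mxE.
by rewrite mulmxA expmx_comm -mulmxA Ad mulmxN mxE opprK add0r.
Qed.

Lemma continuous_step_response tau : continuous (step_response tau).
Proof.
apply: continuous_col => i s.
apply: (@continuous_comp _ _ _ (fun s => Num.max 0 (s - tau))
   (fun t => (d - expmx (t *: A) *m d) i 0)).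
  rewrite (_ : (fun s => _) = (fun s => (s - tau + `|s - tau|) / 2)); last first.
    by apply/funext => r; rewrite maxr_absE add0r sub0r normrN.
  apply: cvgMr_tmp; apply: cvgD; last apply: cvg_norm.
    by apply: cvgB; [exact: cvg_id | exact: cvg_cst].
  by apply: cvgB; [exact: cvg_id | exact: cvg_cst].
exact: der_continuous (der_step _ i).
Qed.

Lemma step_response_le tau s : s <= tau -> step_response tau s = 0.
Proof.
move=> st; rewrite /step_response max_l ?subr_le0 // expmx0 mul1mx subrr.
by [].
Qed.

Lemma step_solution tau T : 0 <= tau ->
  lti_solution A b T (step_input tau) 0 (step_response tau).
Proof.
move=> tau0.
pose F i s := (expmx ((s - tau) *: A) *m b) i 0.
have vE i s : (A *m step_response tau s + b *m step_input tau s) i 0 =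
    ((F i) \_ `[tau, +oo[) s.
  rewrite patchE /step_input indicE.
  case: (boolP (s \in _)) => [|] H.
    rewrite inE /= in_itv /= andbT in H.
    rewrite /step_response max_r ?subr_ge0 // mulmxBr Ad mulmxA expmx_comm -mulmxA Ad.
    rewrite mulmxN opprK [LHS]mxE [X in _ + X]mxE big_ord1 [X in _ * X]mxE mulr1.
    by rewrite [X in X + _]mxE [X in X + _ + _]mxE /F; ring.
  have st : s < tau.
    by rewrite ltNge; apply: contra H => H; rewrite inE /= in_itv /= H.
  rewrite step_response_le ?(ltW st) // mulmx0 add0r mxE big_ord1 mxE mulr0.
  by [].
have mstep : measurable_fun `[0, T] (\1_`[tau, +oo[ : R -> R).
  by apply: measurable_indic.
have int i : mu.-integrable `[0, T] (EFin \o (fun s =>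
    (A *m step_response tau s + b *m step_input tau s) i 0)).
  rewrite (_ : _ \o _ = EFin \o (fun s => (A *m step_response tau s) i 0) \+
     (fun s => (b i 0)%:E * (EFin \o \1_`[tau, +oo[) s)%E); last first.
    apply/funext => s /=; rewrite [X in EFin X]mxE [X in _ + X]mxE big_ord1.
    by rewrite EFinD EFinM /step_input [const_mx _ _ _]mxE.
  apply: integrableD => //.
    apply: continuous_integrable.
    rewrite (_ : (fun s => _) = (fun M : 'cV[R]_n => (A *m M) i 0) \o step_response tau) //.
    apply: continuous_subspaceT => s; apply: continuous_comp.
      exact: continuous_step_response.
    rewrite (_ : (fun M : 'cV[R]_n => _) = \sum_j (fun M : 'cV[R]_n => A i j * M j 0)); last first.
      by apply/funext => M; rewrite mxE fct_sumE.
    elim/big_ind: _ => [|f1 f2 H1 H2|j _].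
    - exact: cst_continuous.
    - exact: continuousD.
    - by apply: continuousM; [exact: cst_continuous | exact: coord_continuous].
  apply: integrableZl => //; apply: (bounded_integrable (M := 1)) => // s _.
  by rewrite indicE; case: (_ \in _); rewrite ?normr1 ?normr0.
split=> //.
- exact/continuous_subspaceT/continuous_step_response.
- exact: step_response_le.
- move=> t /andP[t0 tT] i; rewrite [X in _ = X + _]mxE add0r.
  transitivity (\int[mu]_(s in `[0, t]) ((F i) \_ `[tau, +oo[) s); last first.
    by apply: eq_Rintegral => s _; rewrite vE.
  rewrite -Rintegral_mkcondr.
  have [ttau|taut] := leP t tau.
    rewrite step_response_le // mxE.
    (* Before the switch the domain of integration is empty, except for a single point when
       [t = tau]. *)
    rewrite (_ : _ `&` _ = [set x | x = tau /\ t = tau]).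
      have [->|tn] := eqVneq t tau.
        rewrite (_ : [set x | _] = [set tau]) ?Rintegral_set1 //.
        by apply/seteqP; split => x /=; [case | ].
      rewrite (_ : [set x | _] = set0) ?Rintegral_set0 //.
      by apply/seteqP; split => x //= -[_ /eqP]; rewrite (negPf tn).
    apply/seteqP; split => x /=; rewrite !in_itv /= ?andbT.
      by move=> [/andP[x0 xt] tx]; split; apply/eqP; rewrite eq_le; lra.
    by move=> [-> ->]; rewrite tau0 lexx.
  rewrite (_ : _ `&` _ = `[tau, t]%classic); last first.
    apply/seteqP; split => x /=; rewrite !in_itv /= ?andbT.
      by move=> [/andP[x0 xt] tx]; rewrite tx.
    by move=> /andP[tx xt]; rewrite (le_trans tau0 tx).
  rewrite /Rintegral.
  have DF s : der (fun s => (d - expmx ((s - tau) *: A) *m d) i 0) s (F i s).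
    by apply: (@der_subr _ (fun s => (d - expmx (s *: A) *m d) i 0)); exact: der_step.
  have DFF s : der (F i) s ((A *m (expmx ((s - tau) *: A) *m b)) i 0).
    by apply: (@der_subr _ (fun s => (expmx (s *: A) *m b) i 0)); exact: ode_expmx.
  rewrite (@continuous_FTC2 _ _ (fun s => (d - expmx ((s - tau) *: A) *m d) i 0)) //=.
  + rewrite subrr expmx0 mul1mx subrr [X in _ - X]mxE subr0.
    by rewrite /step_response max_r // subr_ge0 ltW.
  + exact: der_continuousW DFF.
  + split.
    * by move=> s _; exact: (DF s).(ex_derive).
    * by apply: cvg_at_right_filter; exact: der_continuous (DF _).
    * by apply: cvg_at_left_filter; exact: der_continuous (DF _).
  + move=> s _; rewrite derive1E; exact: (derive_val (is_derive := DF s)).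
Qed.

End Step.
End StepResponse.

(** * When the level is attained *)

Section Hyperplane.
Variable R : realType.

Lemma exp_decay (C e t0 : R) : 0 < e -> exists2 t, t0 <= t /\ 0 <= t & C * expR (- t) < e.
Proof.
move=> e0; pose t := `|C| / e + `|t0|; have t_ge0 : 0 <= t.
  by rewrite addr_ge0 // divr_ge0 // ltW.
exists t; first by split=> //; rewrite (le_trans (ler_norm _)) // lerDr divr_ge0 // ltW.
apply: (@le_lt_trans _ _ (`|C| / (1 + t))).
  apply: (le_trans (ler_wpM2r (expR_ge0 _) (ler_norm C))); apply: ler_wpM2l => //.
  rewrite expRN lef_pV2 ?posrE ?expR_gt0 ?ltr_pwDl //; exact: expR_ge1Dx.
rewrite ltr_pdivrMr ?ltr_pwDl // mulrDr mulr1 /t mulrDr mulrCA divff ?gt_eqF // mulr1.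
by rewrite addrCA ltrDl ltr_wpDr // mulr_ge0 // ltW.
Qed.

(** Used with [r] the level, [s = q T] the missing tail and [t] the gain by one sign switch: twice
    the gain outweighs the tail. *)
Lemma overshoot (e r s t : R) :
  e * s <= `|s| -> `|s| < 2 * (e * t) -> e * r < e * (r - s + 2 * t).
Proof. by lra. Qed.

Lemma norm_1B2 : `|1 - 2 * 1 : R| <= 1.
Proof. by rewrite ler_norml; lra. Qed.

Lemma der_locally0 (f : R -> R) (T t d : R) : T < t ->
  (forall s, T < s -> f s = 0) -> der f t d -> d = 0.
Proof.
move=> Tt f0 D; apply: der_unique (der_cst 0 t).
apply: near_eq_is_derive D; near=> s; apply: f0.
by near: s; exact: lt_nbhsr.
Unshelve. all: by end_near. Qed.

Lemma skolem_shift_time n (A : 'M[R]_n) b c s t :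
  skolem_fun A (expmx (s *: A) *m b) c t = skolem_fun A b c (s + t).
Proof.
rewrite /skolem_fun -!mulmxA; congr ((_ *m _) 0 0).
exact: esym (ode_unique (ode_expmx A b) s t).
Qed.

(** All derivatives vanish at time [T + 1], and [skolem_krylov0] applies to the flow restarted
    there, in both time directions. *)
Lemma skolem_eventually0 n (A : 'M[R]_n) b c (T : R) :
  (forall t, T < t -> skolem_fun A b c t = 0) ->
  forall t, skolem_fun A b c t = 0.
Proof.
move=> H; have K k t : T < t -> skolem_fun A b (krylov A c k) t = 0.
  elim: k t => [|k IH] t Tt; first exact: H.
  exact: der_locally0 Tt IH (der_skolem A b (krylov A c k) t).
move=> t; have -> : t = (T + 1) + (t - (T + 1)) by ring.
rewrite -skolem_shift_time; apply: skolem_krylov0 => k _.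
by rewrite skolem_shift_time addr0 K // ltrDl.
Qed.

Variables (n : nat) (A0 : 'M[R]_n) (b d w : 'cV[R]_n).
Let A := shiftmx A0.
Hypothesis Ad : A *m d = - b.

(** The tail integral of [g] over [[t, +oo)]: it has derivative [- g] and tends to 0 at infinity. In
    particular [q 0] is the level. *)
Let q := skolem_fun A d w.
Let g := skolem_fun A b w.

Lemma skolem_trmul (b' w' : 'cV[R]_n) t : skolem_fun A b' (A^T *m w') t = skolem_fun A (A *m b') w' t.
Proof.
rewrite /skolem_fun trmx_mul trmxK -!mulmxA; congr ((_ *m _) 0 0).
by rewrite !mulmxA expmx_comm.
Qed.

Let Dq t : der q t (- g t).
Proof.
apply: der_eq (der_skolem A d w t); rewrite skolem_trmul Ad.
by rewrite /g /skolem_fun mulmxN mxE.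
Qed.

(** Apply [reach_bound] to plus and minus the [i]-th coordinate, with majorant
    [vecbound b * e^(-s)], whose integral over [[0, +oo)] is [vecbound b]. *)
Lemma can_reach_bounded y i : can_reach A b (@saturated R) 0 y ->
  `|y i 0| <= vecbound b.
Proof.
move=> [T [u [x [T0 mu_ su sol <-]]]].
have E (e : R) : `|e| = 1 -> e * x T i 0 <= vecbound b.
  move=> e1; have dl (v : 'cV[R]_n) : ((e *: delta_mx i 0)^T *m v) 0 0 = e * v i 0 :> R.
    rewrite mxE (bigD1 i) //= big1 ?addr0 => [|k ki]; rewrite !mxE.
      by rewrite !eqxx mulr1.
    by rewrite (negPf ki) mulr0 mul0r.
  have D (k s : R) : der (fun s => k * expR (- s)) s (- k * expR (- s)).
    have := derZ k (der_expR (-1) s); rewrite !mulN1r mulrN -mulNr.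
    by apply: der_ext => z; rewrite mulN1r.
  have sb (b' : 'cV[R]_n) s : 0 <= s ->
     `|skolem_fun A b' (e *: delta_mx i 0) s| <= vecbound b' * expR (- s).
    move=> s0; rewrite /skolem_fun -mulmxA dl normrM e1 mul1r.
    exact: expmx_shift_col_bound.
  have e_le1 s : 0 <= s -> expR (- s) <= 1 :> R.
    by move=> s0; rewrite -expR0 ler_expR oppr_le0.
  have := reach_bound (Gam := fun s => - vecbound b * expR (- s))
    (gam := fun s => vecbound b * expR (- s))
    (gam' := fun s => - vecbound b * expR (- s))
    (L := vecbound b + vecbound (A *m b)) (w := e *: delta_mx i 0) T0 mu_ su sol.
  rewrite dl oppr0 expR0 mulr1 => H; apply: le_trans (H _ _ _ _ _) _.
  - by move=> s; have := D (- vecbound b) s; rewrite opprK.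
  - by move=> s; exact: D.
  - move=> s /andP[s0 _]; rewrite normrM normrN !ger0_norm ?expR_ge0 ?vecbound_ge0 //.
    by apply: ler_wpDr; [exact: vecbound_ge0 | rewrite ler_piMr ?vecbound_ge0 ?e_le1].
  - move=> s /andP[s0 _]; apply: le_trans (sb _ _ s0) _.
    by apply: ler_wpDl; [exact: vecbound_ge0 | rewrite ler_piMr ?vecbound_ge0 ?e_le1].
  - by move=> s /andP[s0 _]; exact: sb.
  by rewrite mulNr opprK gerDr oppr_le0 mulr_ge0 ?vecbound_ge0 ?expR_ge0.
rewrite ler_norml lerNl -mulN1r E ?normrN1 //=.
by rewrite -[X in X <= _]mul1r E ?normr1.
Qed.

(** Up to time [T] a saturated control yields at most [q 0 - q T], so the point is that the tail
    [q T] is positive. *)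
Lemma not_can_reach y : (forall t, 0 <= t -> 0 <= g t) ->
  (exists2 t, 0 <= t & 0 < g t) ->
  can_reach A b (@saturated R) 0 y -> (w^T *m y) 0 0 < (w^T *m d) 0 0.
Proof.
move=> g0 [t1 t10 gt1] [T [u [x [T0 mu_ su sol <-]]]].
have bq (b' : 'cV[R]_n) s : 0 <= s -> `|skolem_fun A b' w s| <= vecbound w * vecbound b'.
  move=> s0; apply: le_trans (skolem_shift_bound A0 b' w s0) _.
  by rewrite ler_piMr ?mulr_ge0 ?vecbound_ge0 // -expR0 ler_expR oppr_le0.
have := reach_bound (Gam := fun s => - q s) (gam := g)
    (gam' := skolem_fun A (A *m b) w) (w := w)
    (L := vecbound w * vecbound (A *m b)) T0 mu_ su sol.
move=> H; apply: le_lt_trans (H _ _ _ _ _) _ => {H}.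
- by move=> s; have := derN (Dq s); rewrite opprK.
- by move=> s; apply: der_eq (der_skolem A b w s); rewrite skolem_trmul.
- by move=> s /andP[s0 _]; exact: bq.
- by move=> s /andP[s0 _]; exact: bq.
- by move=> s /andP[s0 _]; rewrite (ger0_norm (g0 s s0)) lexx.
have q0 : q 0 = (w^T *m d) 0 0 by rewrite /q /skolem_fun expmx0 mulmx1.
rewrite opprK q0 addrC ltrBlDr ltrDl.
have mono s t : 0 <= s -> s <= t -> q t <= q s.
  move=> s0 st; rewrite -lerN2.
  apply: (der_monoT st (f := fun t => - q t) (f' := g)) => z.
    by have := derN (Dq z); rewrite opprK.
  by move=> /andP[sz _]; apply: g0; exact: le_trans (ltW sz).
have qge0 t : 0 <= t -> 0 <= q t.
  move=> t0; rewrite leNgt; apply/negP => qt.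
  have [|s [ts s0] Hs] := @exp_decay (vecbound w * vecbound d) (- q t) t.
    by rewrite oppr_gt0.
  have := skolem_shift_bound A0 d w s0.
  rewrite ler_norml -/(q s) => /andP[H _].
  have : - q t <= vecbound w * vecbound d * expR (- s).
    rewrite lerNl; exact: le_trans H (mono t s t0 ts).
  rewrite leNgt => /negP; apply; exact: Hs.
(* If [q T = 0], then [q], nonincreasing and nonnegative, vanishes after [T]; so does [g], which is
   then 0 everywhere, against [gt1]. *)
rewrite lt_neqAle qge0 // andbT; apply/eqP => qT.
have gz : forall t, T < t -> g t = 0.
  move=> t Tt; apply/eqP; rewrite -oppr_eq0; apply/eqP.
  apply: der_locally0 Tt _ (Dq t) => s Ts; apply: le_anti.
  rewrite qge0 ?(le_trans T0) ?(ltW Ts) // andbT qT; apply: mono => //; exact: ltW.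
by have := skolem_eventually0 gz t1; rewrite -/(g t1) => E; rewrite E ltxx in gt1.
Qed.

Let increment (e t : R) : 0 <= t -> 0 < e * - g t ->
  exists p1 p2, [/\ 0 <= p1, p1 < p2 & 0 < e * (q p2 - q p1)].
Proof.
move=> t0 et; have Dg z := derN (der_skolem A b w z).
have De z := derZ e (Dg z).
have [eps eps0 H] := der_near (De t) et.
exists t, (t + eps / 2); have pt : t < t + eps / 2 by rewrite ltrDl divr_gt0.
split=> //.
have [z /[!in_itv] /= /andP[z1 z2] ->] := MVT pt (fun x _ => Dq x) (der_continuousW Dq).
rewrite mulrA; apply: mulr_gt0; last by rewrite subr_gt0.
have : `|e * - g z - e * - g t| < e * - g t.
  by apply: H; rewrite ger0_norm ?subr_ge0 ?(ltW z1) //; lra.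
rewrite ltr_norml => /andP[H1 _]; move: H1; rewrite ltrBrDr addNr; apply.
Qed.

(** Use the control 1, switched to -1 on [[T - p2, T - p1)], where the integrand contributes against
    the sign [e] of the level [a]. The value [v = a - q T + 2 (q p2 - q p1)] exceeds [a] in absolute
    value for large [T]. Scaling the control by [a / v] keeps it saturated and hits [a] exactly. *)
Lemma can_reach_hyperplane :
  (exists2 t, 0 <= t & g t < 0) -> (exists2 t, 0 <= t & 0 < g t) ->
  exists2 y, (w^T *m y) 0 0 = (w^T *m d) 0 0 &
    can_reach A b (@saturated R) 0 y.
Proof.
move=> [t1 t10 gt1] [t2 t20 gt2].
pose a := (w^T *m d) 0 0.
have q0 : q 0 = a by rewrite /q /skolem_fun expmx0 mulmx1.
have [e [ea e1 [p1 [p2 [p10 p12 dq]]]]] : exists e, [/\ e * a = `|a|, `|e| = 1 &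
    exists p1 p2, [/\ 0 <= p1, p1 < p2 & 0 < e * (q p2 - q p1)]].
  (* For [a >= 0] the interval is taken near a point where [g] is negative, otherwise near one where
     [g] is positive. *)
  have [a0|a0] := lerP 0 a.
    exists 1; rewrite mul1r normr1; split=> //; first by rewrite ger0_norm.
    by apply: (increment t10); rewrite mul1r oppr_gt0.
  exists (-1); rewrite mulN1r normrN1; split=> //; first by rewrite ltr0_norm.
  by apply: (increment t20); rewrite mulN1r opprK.
pose del := e * (q p2 - q p1).
(* The horizon contains the switching interval and leaves a tail [q T] smaller than the gain
   [2 * del]. *)
have [T [Tp2 T0] HT] := @exp_decay (vecbound w * vecbound d) (2 * del) p2
  (mulr_gt0 (ltr0Sn R 1) dq).
have qT : `|q T| < 2 * del by apply: le_lt_trans HT; exact: skolem_shift_bound.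
pose X s : 'cV[R]_n := step_response A d 0 s +
  ((-2) *: step_response A d (T - p2) s + 2 *: step_response A d (T - p1) s).
pose v := (w^T *m X T) 0 0.
have wstep p : 0 <= p -> (w^T *m step_response A d (T - p) T) 0 0 = a - q p.
  move=> p0; rewrite /step_response (_ : T - (T - p) = p) ?max_r //; last by ring.
  by rewrite mulmxBr mxE [X in _ + X]mxE /q /skolem_fun mulmxA.
have vE : v = a - q T + 2 * (q p2 - q p1).
  have E (x y z : 'cV[R]_n) : (w^T *m (x + (-2 *: y + 2 *: z))) 0 0 =
      (w^T *m x) 0 0 + (-2 * (w^T *m y) 0 0 + 2 * (w^T *m z) 0 0).
    rewrite !mulmxDr -!scalemxAr [LHS]mxE; congr (_ + _).
    by rewrite [LHS]mxE; congr (_ + _); rewrite [LHS]mxE.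
  have key (x y z : 'cV[R]_n) : (w^T *m x) 0 0 = a - q T -> (w^T *m y) 0 0 = a - q p2 ->
      (w^T *m z) 0 0 = a - q p1 ->
      (w^T *m (x + (-2 *: y + 2 *: z))) 0 0 = a - q T + 2 * (q p2 - q p1).
    have ar (r1 r2 r3 : R) : r1 + (-2 * (a - r2) + 2 * (a - r3)) = r1 + 2 * (r2 - r3) by ring.
    by move=> h0 h2 h1; rewrite E h0 h1 h2 ar.
  apply: key; [| exact: wstep (le_trans p10 (ltW p12)) | exact: wstep p10].
  by rewrite -(wstep T T0) subrr.
have ev : `|a| < e * v.
  have : e * q T <= `|q T| by rewrite (le_trans (ler_norm _)) // normrM e1 mul1r.
  by rewrite vE -ea => /overshoot; apply.
have v0 : v != 0.
  by apply: contraTneq ev => ->; rewrite mulr0 -leNgt.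
have av : `|a| < `|v|.
  by apply: lt_le_trans ev _; rewrite (le_trans (ler_norm _)) // normrM e1 mul1r.
pose k := a / v.
have k1 : `|k| <= 1.
  by rewrite normrM normfV ler_pdivrMr ?normr_gt0 // mul1r ltW.
exists (k *: X T).
  by rewrite -scalemxAr mxE -/v /k divfK.
have T10 : 0 <= T - p2 by rewrite subr_ge0.
have T20 : 0 <= T - p1 by rewrite subr_ge0 (le_trans (ltW p12)).
have S1 := lti_solution_linear (-2) 2 (step_solution Ad T T10) (step_solution Ad T T20).
have S2 := lti_solution_linear k k (step_solution Ad T (lexx 0)) S1.
have uE s : 0 <= s -> (k *: step_input 0 s + k *: (-2 *: step_input (T - p2) s + 2 *: step_input (T - p1) s)) 0 0
   = k * (1 - 2 * \1_`[T - p2, +oo[ s + 2 * \1_`[T - p1, +oo[ s).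
  move=> s0; rewrite !mxE.
  have -> : \1_`[0, +oo[ s = 1 :> R by rewrite indicE mem_set //= in_itv /= s0.
  have ar (r1 r2 : R) : k * 1 + k * (-2 * r1 + 2 * r2) = k * (1 - 2 * r1 + 2 * r2).
    by ring.
  exact: ar.
exists T, (fun s => k *: step_input 0 s + k *: (-2 *: step_input (T - p2) s + 2 *: step_input (T - p1) s)),
  (fun s => k *: step_response A d 0 s + k *: (-2 *: step_response A d (T - p2) s + 2 *: step_response A d (T - p1) s)).
split=> //.
- move=> j; rewrite (_ : (fun s => _) = (fun s => k * \1_`[0, +oo[ s
     + k * ((-2) * \1_`[T - p2, +oo[ s + 2 * \1_`[T - p1, +oo[ s))); last first.
    by apply/funext => s; rewrite !mxE.
  have mi r : measurable_fun `[0, T] (\1_`[r, +oo[ : R -> R).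
    by apply: measurable_indic.
  apply: measurable_funD; first by apply: measurable_funM => //; exact: measurable_cst.
  apply: measurable_funM; first exact: measurable_cst.
  by apply: measurable_funD; apply: measurable_funM => //; exact: measurable_cst.
- move=> s /andP[s0 sT]; rewrite /saturated /= -ler_norml uE // normrM.
  rewrite -[leRHS]mulr1; apply: ler_pM => //; rewrite !indicE.
  case: (boolP (s \in `[T - p1, +oo[%classic)) => H1.
    rewrite inE /= in_itv /= andbT in H1.
    rewrite mem_set; last first.
      by rewrite /= in_itv /= andbT; apply: le_trans H1; rewrite lerD2l lerN2 ltW.
    by rewrite !mulr1 subrK normr1.
  rewrite mulr0 addr0; case: (_ \in _); first exact: norm_1B2.
  by rewrite mulr0 subr0 normr1.
- by rewrite /X [RHS]scalerDr.
Qed.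

(** The equilibrium is the limit of the step responses, which are reachable and hence in the box. *)
Lemma equilibrium_bounded i : `|d i 0| <= vecbound b.
Proof.
have reach T : 0 <= T -> can_reach A b (@saturated R) 0 (step_response A d 0 T).
  move=> T0; exists T, (step_input 0), (step_response A d 0); split=> //.
  - move=> j; rewrite (_ : (fun s => _) = \1_`[0, +oo[); last first.
      by apply/funext => s; rewrite mxE.
    by apply: measurable_indic.
  - by move=> s /andP[s0 _]; rewrite /saturated /= mxE indicE -ler_norml; case: (_ \in _); rewrite ?normr1 ?normr0.
  - exact: step_solution.
rewrite leNgt; apply/negP => H.
have [|T [_ T0] HT] := @exp_decay (vecbound d) (`|d i 0| - vecbound b) 0.
  by rewrite subr_gt0.
have := can_reach_bounded i (reach T T0).
rewrite /step_response subr0 max_r // mxE [X in _ + X]mxE.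
have := expmx_shift_col_bound A0 d i T0; rewrite -/A.
set z := (_ *m _) i 0 => H1 H2.
have := ler_normD (d i 0 - z) z; rewrite subrK; lra.
Qed.

End Hyperplane.

(** * Eigenvalues and matrix inversion *)

Section Eigenvalues.

(** Compare the sums of absolute values of the entries on both sides of [v A = z v]. *)
Lemma eigenvalue_bound (F : numFieldType) n (A : 'M[F]_n) z : eigenvalue A z ->
  `|z| <= \sum_i \sum_j `|A i j|.
Proof.
move=> /eigenvalueP[v vA v0]; set beta := \sum_i _.
have N0 : 0 < \sum_j `|v 0 j|.
  rewrite lt_neqAle sumr_ge0 // andbT eq_sym; apply: contraNneq v0 => /eqP.
  rewrite psumr_eq0 // => /allP H; apply/eqP/rowP => j; rewrite mxE.
  by apply/eqP; rewrite -normr_eq0; apply: (implyP (H j _)); rewrite ?mem_index_enum.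
rewrite -(ler_pM2r N0) mulr_sumr.
apply: (@le_trans _ _ (\sum_j \sum_i `|v 0 i| * `|A i j|)).
  apply: ler_sum => j _; rewrite -normrM.
  have := congr1 (fun u : 'rV[F]_n => u 0 j) vA; rewrite !mxE => <-.
  by apply: le_trans (ler_norm_sum _ _ _) _; apply: ler_sum => i _; rewrite normrM.
rewrite exchange_big mulr_sumr; apply: ler_sum => i _ /=.
rewrite -mulr_sumr mulrC; apply: ler_wpM2r => //.
by rewrite /beta [leRHS](bigD1 i) //= lerDl; do 2![apply: sumr_ge0 => ? _].
Qed.

Lemma eigenvalue_sub_scalar (F : fieldType) n (A : 'M[F]_n) l z :
  eigenvalue (A - l%:M) z -> eigenvalue A (z + l).
Proof.
move=> /eigenvalueP[v vA v0]; apply/eigenvalueP; exists v => //.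
by rewrite scalerDl -vA mulmxBr mul_mx_scalar subrK.
Qed.

Variable R : realType.

(** An eigenvalue [z] satisfies [|z + shift_rate A| <= mxnorm1 A <= shift_rate A - 1], which forces
    its real part below 0. *)
Lemma stable_shiftmx n (A : 'M[R]_n) : stable (shiftmx A).
Proof.
move=> z; rewrite /shiftmx map_mxB map_scalar_mx /= => /eigenvalue_sub_scalar.
move=> /eigenvalue_bound; set s := \sum_i _.
have -> : s = (mxnorm1 A)%:C%C.
  rewrite /mxnorm1 rmorph_sum /=; apply: eq_bigr => i _.
  rewrite rmorph_sum /=; apply: eq_bigr => j _.
  by rewrite mxE /= normc_def /= expr0n /= addr0 sqrtr_sqr.
case: z => a c; rewrite normc_def /= lecE /= addr0 => /andP[_ H].
have {}H : a + shift_rate A <= mxnorm1 A.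
  apply: le_trans H; apply: le_trans (ler_norm _) _.
  by rewrite -sqrtr_sqr ler_wsqrtr // lerDl sqr_ge0.
have := mxnorm1_shift_rate A; lra.
Qed.

Lemma unitmx_shiftmx n (A : 'M[R]_n) : shiftmx A \in unitmx.
Proof.
rewrite -row_free_unit -kermx_eq0; apply: contraT => K0.
have : eigenvalue (shiftmx A) 0.
  by rewrite /eigenvalue /eigenspace (_ : 0%:M = 0) ?subr0 // raddf0.
move=> /eigenvalue_sub_scalar/eigenvalue_bound; rewrite add0r -/(mxnorm1 A) => H.
have := mxnorm1_shift_rate A; have := ler_norm (shift_rate A); lra.
Qed.

End Eigenvalues.

(** * Inversion by the Faddeev-LeVerrier recurrence *)

Section FaddeevLeVerrier.
Variables (F : numFieldType) (n' : nat).
Notation n := n'.+1.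
Variable A : 'M[F]_n.

(** The coefficients of the adjugate of ['X - A], from the highest degree down. Integers are the
    only divisors, so the programs never invert an element of the number field. *)
Fixpoint faddeev (k : nat) : 'M[F]_n :=
  if k is k'.+1 then
    A *m faddeev k' - (\tr (A *m faddeev k') / k'.+1%:R)%:M
  else 1%:M.

Let P := char_poly_mx A.
Let B := \adj P.
Let chi := char_poly A.
Let Bc k : 'M[F]_n := map_mx (fun p : {poly F} => p`_k) B.

Lemma deriv_det m (M : 'M[{poly F}]_m) :
  (\det M)^`() = \sum_i \det (\matrix_(k, j) if k == i then (M k j)^`() else M k j).
Proof.
rewrite /determinant raddf_sum /= exchange_big; apply: eq_bigr => s _.
rewrite -mulr_sumr.
have D (r : seq 'I_m) : uniq r -> (\prod_(i <- r) M i (s i))^`() =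
    \sum_(i <- r) \prod_(k <- r) (if k == i then (M k (s k))^`() else M k (s k)).
  elim: r => [|a r IH] /=; first by rewrite !big_nil derivC.
  move=> /andP[ar ur]; rewrite big_cons derivM IH // [RHS]big_cons; congr (_ + _).
    rewrite big_cons eqxx; congr (_ * _); apply: eq_big_seq => i ir.
    by case: eqP => // ia; rewrite -ia ir in ar.
  rewrite mulr_sumr; apply: eq_big_seq => i ir; rewrite big_cons.
  by case: eqP => // ia; rewrite ia ir in ar.
have {}D : (\prod_i M i (s i))^`() =
    \sum_i \prod_k (\matrix_(k, j) if k == i then (M k j)^`() else M k j) k (s k).
  rewrite D ?index_enum_uniq //; apply: eq_bigr => i _; apply: eq_bigr => k _.
  by rewrite mxE.
by case: (perm.odd_perm s); rewrite ?expr1 ?expr0 ?mulN1r ?mul1r ?derivN D.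
Qed.

(** Row [i] of the characteristic matrix differentiates to a unit row, so the [i]-th term of
    [deriv_det] is a principal cofactor. *)
Lemma trace_adj : \tr B = chi^`().
Proof.
rewrite /chi /char_poly deriv_det /mxtrace; apply: eq_bigr => i _.
rewrite (expand_det_row _ i) (bigD1 i) //= big1 ?addr0 => [|j ji]; last first.
  by rewrite !mxE eqxx eq_sym (negPf ji) mulr0n sub0r derivN derivC oppr0 mul0r.
rewrite !mxE !eqxx mulr1n derivB derivX derivC subr0 mul1r /cofactor.
congr (_ * \det _); apply/matrixP => k l; rewrite !mxE.
by rewrite [lift i k == i]eq_sym (negPf (neq_lift i k)).
Qed.

Let adjE : (P *m B) = chi%:M.
Proof. exact: mul_mx_adj. Qed.

(** The coefficient of degree [k] in [('X - A) * \adj ('X - A) = chi]. *)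
Let Bc_rec k : (if k is k'.+1 then Bc k' else 0) - A *m Bc k = (chi`_k)%:M.
Proof.
apply/matrixP => i j.
have E : \sum_l (P i l * B l j)`_k = chi`_k *+ (i == j).
  rewrite -coefMn -coef_sum; congr (_`_k).
  by have := congr1 (fun M : 'M[{poly F}]_n => M i j) adjE; rewrite [RHS]mxE => <-; rewrite mxE.
rewrite [RHS]mxE -E.
have -> : \sum_l (P i l * B l j)`_k = \sum_l ((i == l)%:R * ('X * B l j)`_k - A i l * (B l j)`_k).
  apply: eq_bigr => l _; rewrite /P !mxE mulrBl coefB coefCM; congr (_ - _).
  by case: (i == l); rewrite ?mulr1n ?mulr0n ?mul1r ?mul0r ?coef0.
rewrite sumrB [LHS]mxE [X in _ + X]mxE mxE; congr (_ - _).
  rewrite (bigD1 i) //= eqxx mul1r big1 ?addr0 => [|l li]; last first.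
    by rewrite eq_sym (negPf li) mul0r.
  by rewrite coefXM; case: k {E} => [|k]; rewrite ?mxE.
by apply: eq_bigr => l _; rewrite !mxE.
Qed.

(** Descending induction from a bound on the degrees: beyond the degree of [chi] the recurrence
    reads [Bc k = A *m Bc k.+1]. *)
Let Bc_large k : (n <= k)%N -> Bc k = 0.
Proof.
pose N := \max_i \max_j size (B i j).
have [m Hm] := ubnP (N - k); elim: m k Hm => // m IH k Hm nk.
have [Nk|kN] := leqP N k.
  apply/matrixP => i j; rewrite [LHS]mxE [RHS]mxE nth_default //; apply: leq_trans Nk.
  apply: leq_trans (@leq_bigmax _ (fun i => \max_j size (B i j)) i).
  exact: (@leq_bigmax _ (fun j => size (B i j)) j).
have := Bc_rec k.+1; rewrite (IH k.+1) ?mulmx0 ?subr0; try lia.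
by move=> ->; rewrite nth_default ?size_char_poly ?raddf0 // ltnS.
Qed.

Let chi_n : chi`_n = 1.
Proof. by have /monicP := char_poly_monic A; rewrite /lead_coef size_char_poly. Qed.

(** The trace recovers the coefficient of [chi]: by [trace_adj], [\tr (A *m Bc j)] is
    [(j - n) chi_j], and [n - j] is the divisor [k.+1]. *)
Let faddeevE k : (k < n)%N -> faddeev k = Bc (n' - k).
Proof.
elim: k => [|k IH] kn.
  have := Bc_rec n; rewrite (Bc_large (leqnn _)) mulmx0 subr0 subn0 => ->.
  by rewrite chi_n.
rewrite /= IH; last exact: ltnW.
set j := (n' - k)%N; have jE : j = (n' - k.+1).+1 by rewrite /j; lia.
have := Bc_rec j; rewrite {1}jE => E.
have AB : A *m Bc j = Bc (n' - k.+1) - (chi`_j)%:M by rewrite -E opprB addrC subrK.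
have tB : \tr (Bc (n' - k.+1)) = chi`_j *+ j.
  rewrite jE -coef_deriv -trace_adj /mxtrace coef_sum.
  by apply: eq_bigr => i _; rewrite mxE.
have -> : \tr (A *m Bc j) / k.+1%:R = - chi`_j.
  rewrite AB raddfB /= tB mxtrace_scalar -opprB -mulrnBr; last by rewrite /j; lia.
  have -> : (n - j = k.+1)%N by rewrite /j; lia.
  by rewrite mulNr -[chi`_j *+ _]mulr_natr mulfK // pnatr_eq0.
by rewrite AB raddfN opprK subrK.
Qed.

Lemma faddeev_inverse : A \in unitmx ->
  exists2 s, s != 0 & A *m faddeev n' = s%:M.
Proof.
move=> uA; exists (- chi`_0).
  rewrite oppr_eq0 char_poly_det mulf_eq0 negb_or signr_eq0 /=.
  by rewrite -unitfE -unitmxE.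
have := Bc_rec 0; rewrite sub0r faddeevE // subnn => E.
by rewrite raddfN /= -E opprK.
Qed.

End FaddeevLeVerrier.

(** * Target sets *)

Section Targets.
Variable R : realType.

Definition slab n (w : 'cV[R]_n) (a B : R) : set 'cV[R]_n :=
  [set x | (w^T *m x) 0 0 = a /\ forall i, `|x i 0| <= B].

(* Rows [w; -w; I; -I] and right-hand sides [a; -a; B; ...; B]: the first two
   rows cut out a hyperplane, all of them a slab. *)
Definition facet n (w : 'cV[R]_n) (i : nat) (j : 'I_n) : R :=
  if i == 0%N then w j 0 else if i == 1%N then - w j 0
  else if (i - 2 < n)%N then (i - 2 == j :> nat)%N%:R
  else - (i - 2 - n == j :> nat)%N%:R.

Definition facet_level (a B : R) (i : nat) : R :=
  if i == 0%N then a else if i == 1%N then - a else B.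

Section Polyhedron.
Variables (k n : nat) (M : 'M[R]_(k, n)) (d : 'cV[R]_k) (w : 'cV[R]_n) (a B : R).
Hypothesis ME : forall i j, M i j = facet w i j.
Hypothesis dE : forall i, d i 0 = facet_level a B i.

Lemma polyhedron_facets x : polyhedron M d x <->
  forall i, (i < k)%N -> \sum_j facet w i j * x j 0 <= facet_level a B i.
Proof.
have E i : (M *m x) i 0 = \sum_j facet w i j * x j 0.
  by rewrite mxE; apply: eq_bigr => j _; rewrite ME.
split=> H i; last by rewrite E dE; exact: H.
by move=> ik; have := H (Ordinal ik); rewrite E dE.
Qed.

Lemma facets_hyperplane (x : 'cV[R]_n) :
  (forall i, (i < 2)%N -> \sum_j facet w i j * x j 0 <= facet_level a B i) <->
  (w^T *m x) 0 0 = a.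
Proof.
have E0 : \sum_j facet w 0 j * x j 0 = (w^T *m x) 0 0.
  by rewrite mxE; apply: eq_bigr => j _; rewrite mxE.
have E1 : \sum_j facet w 1 j * x j 0 = - (w^T *m x) 0 0.
  by rewrite mxE -sumrN; apply: eq_bigr => j _; rewrite mxE /facet /= mulNr.
split=> [H|H [|[|i]] // _]; rewrite ?E0 ?E1 /facet_level /= ?H //.
have := H 0%N isT; have := H 1%N isT; rewrite E0 E1 /facet_level /=.
by rewrite lerN2 => h1 h2; apply: le_anti; rewrite h1 h2.
Qed.

Lemma polyhedron_hyperplane : k = 2%N ->
  polyhedron M d = [set x | (w^T *m x) 0 0 = a].
Proof.
by move=> k2; apply/seteqP; split=> x; rewrite polyhedron_facets k2 facets_hyperplane.
Qed.

Lemma polyhedron_slab : k = (2 + (n + n))%N -> polyhedron M d = slab w a B.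
Proof.
move=> kE; apply/seteqP.
have E2 (i : 'I_n) (x : 'cV[R]_n) : \sum_j facet w (2 + i) j * x j 0 = x i 0.
  rewrite (bigD1 i) //= /facet /= addKn ltn_ord eqxx mul1r big1 ?addr0 // => j ji.
  by rewrite (_ : (i == j :> nat) = false) ?mul0r // eq_sym; apply/negbTE.
have E3 (i : 'I_n) (x : 'cV[R]_n) : \sum_j facet w (2 + (n + i)) j * x j 0 = - x i 0.
  rewrite (bigD1 i) //= /facet /= addKn addKn ltnNge leq_addr /= eqxx mulN1r.
  rewrite big1 ?addr0 // => j ji.
  by rewrite (_ : (i == j :> nat) = false) ?oppr0 ?mul0r // eq_sym; apply/negbTE.
split=> x; rewrite polyhedron_facets kE.
  move=> H; split; first by apply/facets_hyperplane => i i2; apply: H; lia.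
  move=> i; have := H (2 + i)%N; have := H (2 + (n + i))%N; rewrite E2 E3.
  rewrite /facet_level /= ler_norml lerNl => -> //; last by have := ltn_ord i; lia.
  by apply; have := ltn_ord i; lia.
move=> [H1 H2] i ik.
have [i2|i2] := ltnP i 2; first by move: i i2 {ik}; apply/facets_hyperplane.
have lB : facet_level a B i = B by rewrite /facet_level; case: i {ik} i2 => [|[|]].
rewrite lB; have [i3|i3] := ltnP (i - 2) n.
  have iE : i = (2 + Ordinal i3)%N by rewrite /=; lia.
  by rewrite iE E2; apply: le_trans (H2 _); exact: ler_norm.
have i4 : (i - 2 - n < n)%N by lia.
have iE : i = (2 + (n + Ordinal i4))%N by rewrite /=; lia.
by rewrite iE E3; apply: le_trans (H2 (Ordinal i4)); rewrite -normrN ler_norm.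
Qed.

End Polyhedron.

Section Slab.
Variables (n : nat) (w : 'cV[R]_n) (a B : R).

(** The compactness of boxes is at hand for row vectors, so the slab is presented as the image under
    transposition of a closed part of a box. *)
Lemma compact_slab : compact (slab w a B).
Proof.
pose S : set 'rV[R]_n := [set v | forall i, `[- B, B]%classic (v 0 i)].
pose f (v : 'rV[R]_n) := \sum_j w j 0 * v 0 j.
have cf : continuous f.
  rewrite /f (_ : (fun v => _) = \sum_j (fun v : 'rV[R]_n => w j 0 * v 0 j)); last first.
    by apply/funext => v; rewrite fct_sumE.
  move=> v; elim/big_ind: _ => [|f1 f2 H1 H2|j _].
  - exact: cst_continuous.
  - exact: continuousD.
  - by apply: continuousM; [exact: cst_continuous | exact: coord_continuous].
have cS : compact (S `&` f @^-1` [set a]).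
  apply: (subclosed_compact _ (rV_compact (fun i => @segment_compact _ (- B) B))).
    apply: closedI; last by apply: preimage_closed => [v _|]; [exact: cf | exact: closed_eq].
    rewrite (_ : S = \bigcap_(i in setT) (fun v : 'rV[R]_n => v 0 i) @^-1` `[- B, B]); last first.
      by apply/seteqP; split => v Hv; [move=> i _; exact: Hv | move=> i; exact: (Hv i I)].
    apply: closed_bigI => i _; apply: preimage_closed => [v _|].
      exact: coord_continuous.
    exact: interval_closed.
  by move=> v [].
have ct : continuous (fun v : 'rV[R]_n => v^T).
  move=> v P [Q HQ HP].
  exists (fun i j => Q j i) => [i j|M HM].
    by have := HQ j i; rewrite mxE.
  by apply: HP => i j; rewrite mxE.
have -> : slab w a B = (fun v : 'rV[R]_n => v^T) @` (S `&` f @^-1` [set a]).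
  apply/seteqP; split => x /=.
    move=> [xa xB]; exists x^T; last by rewrite trmxK.
    split; last by rewrite /= -xa mxE; apply: eq_bigr => j _; rewrite !mxE.
    by move=> i; rewrite /= in_itv /= mxE -ler_norml.
  move=> [v [vS vf] <-]; split.
    by rewrite -vf mxE; apply: eq_bigr => j _; rewrite !mxE.
  by move=> i; rewrite mxE ler_norml; have := vS i; rewrite /= in_itv.
by apply: continuous_compact cS; exact: continuous_subspaceT.
Qed.

Lemma convex_slab : convex_set (slab w a B).
Proof.
move=> x y l /set_mem[xa xB] /set_mem[ya yB]; apply/mem_set.
have l0 : 0 <= l%:num by [].
have l1 : l%:num <= 1 by [].
rewrite /conv /=; split.
  rewrite mulmxDr -!scalemxAr mxE [X in X + _]mxE [X in _ + X]mxE.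
  by rewrite xa ya /unstable.onem; ring.
move=> i; rewrite mxE [X in X + _]mxE [X in _ + X]mxE.
apply: le_trans (ler_normD _ _) _; rewrite !normrM.
have l2 : 0 <= unstable.onem l%:num by rewrite subr_ge0.
rewrite (ger0_norm l0) (ger0_norm l2).
have key (t p q : R) : 0 <= t -> t <= 1 -> q <= B -> p <= B ->
    t * q + (1 - t) * p <= B.
  move=> t0 t1 qB pB; have := ler_wpM2l t0 qB.
  have : (1 - t) * p <= (1 - t) * B by rewrite ler_wpM2l ?subr_ge0.
  lra.
exact: key.
Qed.

(** The point [d] keeps a margin 1 from the walls of the box, so that a small enough basis of the
    kernel of [w] can be added to it. *)
Lemma affine_dim_slab (d : 'cV[R]_n) : w != 0 -> (w^T *m d) 0 0 = a ->
  (forall i, `|d i 0| + 1 <= B) ->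
  exists2 k, n = k.+1 & affine_dim (slab w a B) k.
Proof.
move=> w0 wd dB.
have rw : \rank w = 1%N.
  by apply/eqP; rewrite eqn_leq rank_leq_col lt0n mxrank_eq0.
have rK : (\rank (kermx w) = n - 1)%N by rewrite mxrank_ker rw.
have n0 : (0 < n)%N by rewrite -rw rank_leq_row.
exists n.-1; first by rewrite prednK.
(* The basis has [\rank (kermx w)] rows; quantifying over that number allows replacing it by [n.-1]
   in the type. *)
have [D0 [D0f D0E]] : exists D0 : 'M[R]_(n.-1, n), row_free D0 /\ (D0 :=: kermx w)%MS.
  have : exists r (D0 : 'M[R]_(r, n)), [/\ r = n.-1, row_free D0 & (D0 :=: kermx w)%MS].
    exists (\rank (kermx w)), (row_base (kermx w)).
    by split; [rewrite rK subn1 | exact: row_base_free | exact: eq_row_base].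
  by move=> [r [D0 [rE D0f D0E]]]; subst r; exists D0.
(* Scaling brings all entries of the basis below the margin 1. *)
pose eps := (1 + mxnorm1 D0)^-1.
have e1 : 0 < 1 + mxnorm1 D0 by rewrite ltr_wpDr // mxnorm1_ge0.
have e0 : eps != 0 by rewrite invr_eq0 gt_eqF.
exists d, (eps *: D0); split.
- by split=> // i; apply: le_trans (dB i); rewrite lerDl.
- by rewrite /row_free (eqmx_scale _ e0).
- move=> i; split.
    have : (row i (eps *: D0) <= kermx w)%MS.
      by rewrite -D0E (submx_trans (row_sub _ _)) // scalemx_sub.
    by move=> /sub_kermxP Z; rewrite mulmxDr -trmx_mul Z trmx0 addr0.
  move=> j; rewrite !mxE; apply: le_trans (ler_normD _ _) _.
  apply: le_trans (dB j); rewrite lerD2l normrM gtr0_norm ?invr_gt0 //.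
  rewrite /eps mulrC ler_pdivrMr // mul1r.
  apply: (@le_trans _ _ (mxnorm1 D0)); last by rewrite lerDr.
  apply: le_trans (row_le_mxnorm1 D0 i).
  by rewrite (bigD1 j) //= lerDl sumr_ge0.
- move=> y [ya _]; rewrite (eqmx_scale _ e0) D0E; apply/sub_kermxP.
  apply: trmx_inj; rewrite trmx_mul trmxK mulmxBr trmx0; apply/matrixP => i j.
  by rewrite !ord1 [LHS]mxE [X in _ + X]mxE ya wd subrr mxE.
Qed.

End Slab.
End Targets.

(** * The reduction *)

HB.lock Definition ent T i j := itemT (itemT T i) j.
HB.lock Definition psum F N := rec (fun i s => padd s (F i)) Leaf (nat_of N).
HB.lock Definition mxT F m n := tab (fun i => tab (F i) n) m.
HB.lock Definition deltaT i j := iteT (subT i j) Leaf (iteT (subT j i) Leaf pone).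

Lemma comp_ent : computable3 ent. Proof. rewrite ent.unlock; comp_tac. Qed.
Lemma comp_deltaT : computable2 deltaT. Proof. rewrite deltaT.unlock; comp_tac. Qed.
#[export] Hint Resolve comp_ent comp_deltaT : comp.

Lemma comp_psum (F : tree -> tree -> tree) N :
  computable2 F -> computable N -> computable (fun t => psum (F t) (N t)).
Proof. by move=> HF HN; rewrite psum.unlock; comp_tac. Qed.

Lemma comp_mxT (F : tree -> tree -> tree -> tree) m n :
  computable3 F -> computable m -> computable n ->
  computable (fun t => mxT (F t) (m t) (n t)).
Proof. by move=> HF Hm Hn; rewrite mxT.unlock; comp_tac. Qed.

Ltac comp_step3 := first
  [ cbv beta; lazymatch goal with
    | |- computable (fun t => psum (@?F t) (@?N t)) => apply (@comp_psum F N)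
    | |- computable (fun t => mxT (@?F t) (@?m t) (@?n t)) =>
      apply (@comp_mxT F m n)
    end
  | comp_step2 ].
Ltac comp_tac ::= repeat comp_step3.

(* Triples (n, A, b, c) encoding the function c^T e^(At) b. *)
Definition dimT t := hd t.
Definition matT t := hd (tl t).
Definition inT t := hd (tl (tl t)).
Definition outT t := tl (tl (tl t)).
Definition mkT n A b c := Node n (Node A (Node b c)).

Lemma comp_dimT : computable dimT. Proof. rewrite /dimT; comp_tac. Qed.
Lemma comp_matT : computable matT. Proof. rewrite /matT; comp_tac. Qed.
Lemma comp_inT : computable inT. Proof. rewrite /inT; comp_tac. Qed.
Lemma comp_outT : computable outT. Proof. rewrite /outT; comp_tac. Qed.
Lemma comp_mkT : computable4 mkT. Proof. rewrite /mkT; comp_tac. Qed.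
#[export] Hint Resolve comp_dimT comp_matT comp_inT comp_outT comp_mkT : comp.

(** Code of 1, the number of columns of a vector; the index of that column is [Leaf]. *)
Definition vec1 := Node Leaf Leaf.
Definition pdot N u v := psum (fun i => pmul (ent u i Leaf) (ent v i Leaf)) N.
Definition pvecbound N u :=
  psum (fun i => padd (pmul (ent u i Leaf) (ent u i Leaf)) pone) N.
Definition trmulT t v :=
  mxT (fun i _ => psum (fun j => pmul (ent (matT t) j i) (ent v j Leaf)) (dimT t))
    (dimT t) vec1.
Definition rateT t := padd pone (psum (fun i => psum (fun j =>
  padd (pmul (ent (matT t) i j) (ent (matT t) i j)) pone) (dimT t)) (dimT t)).
Definition shiftT t :=
  mkT (dimT t) (mxT (fun i j => padd (ent (matT t) i j)
       (popp (pmul (deltaT i j) (rateT t)))) (dimT t) (dimT t)) (inT t) (outT t).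
Definition derT t := mkT (dimT t) (matT t) (inT t) (trmulT t (outT t)).
Definition scaleT p t := mkT (dimT t) (matT t) (inT t)
  (mxT (fun i _ => pmul p (ent (outT t) i Leaf)) (dimT t) vec1).
(** Quotient and remainder by [m] follow the numbering of pairs by [mxtens_unindex]. *)
Definition tensvT n m u v :=
  mxT (fun i _ => pmul (ent u (divT i m) Leaf) (ent v (modT i m) Leaf))
    (mulT n m) vec1.
Definition tensmT t s := mxT (fun i j =>
    padd (pmul (ent (matT t) (divT i (dimT s)) (divT j (dimT s)))
               (deltaT (modT i (dimT s)) (modT j (dimT s))))
         (pmul (deltaT (divT i (dimT s)) (divT j (dimT s)))
               (ent (matT s) (modT i (dimT s)) (modT j (dimT s)))))
    (mulT (dimT t) (dimT s)) (mulT (dimT t) (dimT s)).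
Definition tensT t s := mkT (mulT (dimT t) (dimT s)) (tensmT t s)
  (tensvT (dimT t) (dimT s) (inT t) (inT s))
  (tensvT (dimT t) (dimT s) (outT t) (outT s)).
Definition sumvT n m u v :=
  mxT (fun i _ => iteT (subT n i) (ent u i Leaf) (ent v (subT i n) Leaf))
    (addT n m) vec1.
Definition summT t s := mxT (fun i j =>
    iteT (subT (dimT t) i)
      (iteT (subT (dimT t) j) (ent (matT t) i j) Leaf)
      (iteT (subT (dimT t) j) Leaf
        (ent (matT s) (subT i (dimT t)) (subT j (dimT t)))))
    (addT (dimT t) (dimT s)) (addT (dimT t) (dimT s)).
Definition sumT t s := mkT (addT (dimT t) (dimT s)) (summT t s)
  (sumvT (dimT t) (dimT s) (inT t) (inT s))
  (sumvT (dimT t) (dimT s) (outT t) (outT s)).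
Definition mx1T a := Node (Node a Leaf) Leaf.
Definition expT a c := mkT vec1 (mx1T a) (mx1T pone) (mx1T c).

Lemma comp_pdot : computable3 pdot. Proof. rewrite /pdot; comp_tac. Qed.
Lemma comp_pvecbound : computable2 pvecbound.
Proof. rewrite /pvecbound; comp_tac. Qed.
Lemma comp_trmulT : computable2 trmulT. Proof. rewrite /trmulT; comp_tac. Qed.
Lemma comp_rateT : computable rateT. Proof. rewrite /rateT; comp_tac. Qed.
#[export] Hint Resolve comp_pdot comp_pvecbound comp_trmulT comp_rateT : comp.
Lemma comp_shiftT : computable shiftT. Proof. rewrite /shiftT; comp_tac. Qed.
Lemma comp_derT : computable derT. Proof. rewrite /derT; comp_tac. Qed.
Lemma comp_scaleT : computable2 scaleT. Proof. rewrite /scaleT; comp_tac. Qed.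
Lemma comp_tensvT : computable4 tensvT. Proof. rewrite /tensvT; comp_tac. Qed.
Lemma comp_tensmT : computable2 tensmT. Proof. rewrite /tensmT; comp_tac. Qed.
Lemma comp_sumvT : computable4 sumvT. Proof. rewrite /sumvT; comp_tac. Qed.
Lemma comp_summT : computable2 summT. Proof. rewrite /summT; comp_tac. Qed.
#[export] Hint Resolve comp_shiftT comp_derT comp_scaleT comp_tensvT comp_tensmT
  comp_sumvT comp_summT : comp.
Lemma comp_tensT : computable2 tensT. Proof. rewrite /tensT; comp_tac. Qed.
Lemma comp_sumT : computable2 sumT. Proof. rewrite /sumT; comp_tac. Qed.
Lemma comp_expT : computable2 expT. Proof. rewrite /expT /mx1T; comp_tac. Qed.
#[export] Hint Resolve comp_tensT comp_sumT comp_expT : comp.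

(** * Correctness of the operations on coded systems *)

Section Codes.
Variables (R : realType) (K : number_field).
Local Notation V := (V R K).

Definition mv T i j : R := V (item j (item i T)).
Definition decmx m n T : 'M[R]_(m, n) := Defs.realmx R K (mx_of m n T).

Lemma decmxE m n T i j : decmx m n T i j = mv T i j.
Proof.
by rewrite /decmx /Defs.realmx !mxE (@nth_seq_of _ (seq_of poly_of)) // nth_seq_of.
Qed.

Lemma entE T i j : V (ent T i j) = mv T (nat_of i) (nat_of j).
Proof. by rewrite ent.unlock !itemTE. Qed.

Lemma deltaTE i j : V (deltaT i j) = (nat_of i == nat_of j)%:R.
Proof.
rewrite deltaT.unlock !iteTE !subTE !subn_gt0.
by case: ltngtP => _; rewrite ?V0 ?V1.
Qed.

Lemma psumE F N (f : nat -> R) :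
  (forall i, (nat_of i < nat_of N)%N -> V (F i) = f (nat_of i)) ->
  V (psum F N) = \sum_(i < nat_of N) f i.
Proof.
move=> H; rewrite psum.unlock.
suff E n : (n <= nat_of N)%N ->
    V (rec (fun i s => padd s (F i)) Leaf n) = \sum_(i < n) f i by exact: E.
elim: n => [|n IH] nN /=; first by rewrite big_ord0 V0.
by rewrite VD IH 1?ltnW // big_ord_recr /= H ?natTK.
Qed.

Lemma mxTE F m n (f : nat -> nat -> R) i j :
  (forall i j, (nat_of i < nat_of m)%N -> (nat_of j < nat_of n)%N ->
     V (F i j) = f (nat_of i) (nat_of j)) ->
  (i < nat_of m)%N -> (j < nat_of n)%N -> mv (mxT F m n) i j = f i j.
Proof.
move=> H im jn; rewrite /mv mxT.unlock.
have [i' iE ->] := tab_item (fun i => tab (F i) n) im.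
have [j' jE ->] := tab_item (F i') jn.
by rewrite H ?iE ?jE.
Qed.

Definition VE := (@VN R K, @VD R K, @VM R K, @V0 R K, @V1 R K, entE, deltaTE).

Section Triple.
Variable t : tree.
Let n := nat_of (dimT t).
Definition Amx := decmx n n (matT t).
Definition bvec := decmx n 1 (inT t).
Definition cvec := decmx n 1 (outT t).
Definition skT := skolem_fun Amx bvec cvec.

Lemma pdotE u v : V (pdot (dimT t) u v) = ((decmx n 1 u)^T *m decmx n 1 v) 0 0.
Proof.
rewrite mxE (@psumE _ _ (fun i => mv u i 0 * mv v i 0)) => [|i _].
  by apply: eq_bigr => i _; rewrite mxE !decmxE.
by rewrite !VE.
Qed.

Lemma pvecboundE u : V (pvecbound (dimT t) u) = vecbound (decmx n 1 u).
Proof.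
rewrite (@psumE _ _ (fun i => mv u i 0 ^+ 2 + 1)) => [|i _]; last by rewrite !VE.
by apply: eq_bigr => i _; rewrite decmxE.
Qed.

Lemma trmulTE v : decmx n 1 (trmulT t v) = Amx^T *m decmx n 1 v.
Proof.
apply/matrixP => i j; rewrite decmxE !mxE.
rewrite (@mxTE _ _ _ (fun i _ => \sum_(k < n) mv (matT t) k i * mv v k 0)) //.
  by apply: eq_bigr => k _; rewrite mxE !decmxE (ord1 j).
move=> i' j' _ _; apply: (@psumE _ _ (fun k => mv (matT t) k (nat_of i') * mv v k 0)) => k _.
by rewrite !VE.
Qed.

Lemma rateTE : V (rateT t) = shift_rate Amx.
Proof.
rewrite /rateT !VE; congr (_ + _).
rewrite (@psumE _ _ (fun i => \sum_(j < n) (mv (matT t) i j ^+ 2 + 1))) => [|i _].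
  by apply: eq_bigr => i _; apply: eq_bigr => j _; rewrite decmxE.
by apply: (@psumE _ _ (fun j => mv (matT t) (nat_of i) j ^+ 2 + 1)) => j _; rewrite !VE.
Qed.

Lemma shiftTE : decmx n n (matT (shiftT t)) = shiftmx Amx.
Proof.
apply/matrixP => i j; rewrite /shiftmx [RHS]mxE [X in _ = _ + X]mxE [X in _ = _ - X]mxE.
rewrite !decmxE (@mxTE _ _ _ (fun i j => mv (matT t) i j - (i == j)%:R * shift_rate Amx)) //.
  by rewrite mulr_natl.
by move=> i' j' _ _; rewrite VD VN VM rateTE !VE.
Qed.

End Triple.

Lemma skT_shift t x : skT (shiftT t) x = skolem_fun (shiftmx (Amx t)) (bvec t) (cvec t) x.
Proof. by rewrite -shiftTE. Qed.

Lemma skT_der t x : skT (derT t) x = skolem_fun (Amx t) (bvec t) ((Amx t)^T *m cvec t) x.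
Proof. by rewrite -trmulTE. Qed.

Lemma skT_scale p t x : skT (scaleT p t) x = V p * skT t x.
Proof.
rewrite /skT /skolem_fun.
have -> : cvec (scaleT p t) = V p *: cvec t.
  apply/matrixP => i j; rewrite [RHS]mxE !decmxE.
  rewrite (@mxTE _ _ _ (fun i _ => V p * mv (outT t) i 0)) ?(ord1 j) //.
  by move=> i' j' _ _; rewrite !VE.
by rewrite linearZ /= -!scalemxAl mxE.
Qed.

Lemma skT_exp a c x : skT (expT a c) x = V c * expR (V a * x).
Proof.
rewrite /skT (@skolem_ode _ _ _ _ _ (fun x => const_mx (expR (V a * x)))).
- by rewrite mxE big_ord1 [X in X * _]mxE [X in _ * X]mxE decmxE.
- move=> s i; rewrite mxE big_ord1 decmxE (ord1 i) /= mxE.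
  apply: der_ext (der_expR (V a) s) => r; by rewrite mxE.
- apply/matrixP => i j; rewrite decmxE !ord1 mxE mulr0 expR0.
  by rewrite /mv /= V1.
Qed.

Lemma skT_tens t s x : skT (tensT t s) x = skT t x * skT s x.
Proof.
rewrite -skolem_tens /skT /skolem_fun.
have dE : nat_of (dimT (tensT t s)) = (nat_of (dimT t) * nat_of (dimT s))%N.
  by rewrite /tensT mulTE.
(* The coded dimension equals the product only propositionally; generalising it aligns the types of
   the matrices. *)
rewrite /Amx /bvec /cvec; move: (nat_of (dimT (tensT t s))) dE => N NE; subst N.
set n := nat_of (dimT t); set m := nat_of (dimT s).
have m0 (i : 'I_(n * m)) : (0 < m)%N.
  by case: (posnP m) => // m0; case: i => i; rewrite m0 muln0.
have vE u v : decmx (n * m) 1 (tensvT (dimT t) (dimT s) u v) = tensmx (decmx n 1 u) (decmx m 1 v).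
  apply/matrixP => i j; rewrite tens_col !decmxE /= (ord1 j).
  rewrite (@mxTE _ _ _ (fun i _ => mv u (i %/ m) 0 * mv v (i %% m) 0)) ?mulTE //.
  by move=> i' j' _ _; rewrite !VE divTE ?modTE // (m0 i).
have -> : decmx (n * m) (n * m) (matT (tensT t s)) =
    tensmx (decmx n n (matT t)) 1%:M + tensmx 1%:M (decmx m m (matT s)).
  apply/matrixP => i j; rewrite decmxE [RHS]mxE [X in _ = X + _]mxE [X in _ = _ + X]mxE.
  rewrite !decmxE /= [X in _ = _ * X + _]mxE [X in _ = _ + X * _]mxE.
  rewrite (@mxTE _ _ _ (fun i j =>
     mv (matT t) (i %/ m) (j %/ m) * (i %% m == j %% m)%N%:R +
     (i %/ m == j %/ m)%N%:R * mv (matT s) (i %% m) (j %% m))) ?mulTE //.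
  by move=> i' j' _ _; rewrite !VE !divTE ?modTE ?(m0 i).
by rewrite !vE.
Qed.

Lemma skT_sum t s x : skT (sumT t s) x = skT t x + skT s x.
Proof.
rewrite -skolem_block /skT /skolem_fun.
have dE : nat_of (dimT (sumT t s)) = (nat_of (dimT t) + nat_of (dimT s))%N.
  by rewrite /sumT addTE.
rewrite /Amx /bvec /cvec; move: (nat_of (dimT (sumT t s))) dE => N NE; subst N.
set n := nat_of (dimT t); set m := nat_of (dimT s).
have vE u v : decmx (n + m) 1 (sumvT (dimT t) (dimT s) u v) = col_mx (decmx n 1 u) (decmx m 1 v).
  apply/matrixP => i j; rewrite decmxE.
  rewrite (@mxTE _ _ _ (fun i _ => if (i < n)%N then mv u i 0 else mv v (i - n) 0)) ?addTE //.
    rewrite (ord1 j); case: (split_ordP i) => k ->.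
      by rewrite col_mxEu decmxE.
    by rewrite col_mxEd decmxE /= addKn.
  move=> i' j' _ _; rewrite iteTE subTE subn_gt0.
  by case: ifP => _; rewrite !VE ?subTE.
have -> : decmx (n + m) (n + m) (matT (sumT t s)) =
    block_mx (decmx n n (matT t)) 0 0 (decmx m m (matT s)).
  apply/matrixP => i j; rewrite decmxE.
  rewrite (@mxTE _ _ _ (fun i j => if (i < n)%N then
       if (j < n)%N then mv (matT t) i j else 0 else
       if (j < n)%N then 0 else mv (matT s) (i - n) (j - n))) ?addTE //.
    case: (split_ordP i) => k ->; case: (split_ordP j) => l ->.
    - by rewrite block_mxEul decmxE.
    - by rewrite block_mxEur mxE.
    - by rewrite block_mxEdl mxE.
    - by rewrite block_mxEdr decmxE /= !addKn.
  move=> i' j' _ _; rewrite !iteTE !subTE !subn_gt0.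
  by case: ifP => _; case: ifP => _; rewrite !VE ?subTE.
by rewrite !vE.
Qed.

End Codes.

(** * The programs of the reduction *)

Definition ptwo := padd pone pone.
Definition pmone := popp pone.
Definition rampT := sumT (expT Leaf pone) (expT pmone pmone).
Definition boundT t := let s := shiftT t in let c1 := trmulT s (outT s) in
  padd (pmul (padd (pvecbound (dimT s) c1) (pvecbound (dimT s) (trmulT s c1)))
             (pvecbound (dimT s) (inT s))) pone.
Definition signT t := let s := shiftT t in
  let p := scaleT (pmul ptwo (boundT t)) s in
  let q := tensT rampT (tensT (derT s) (derT s)) in
  sumT (tensT p p) (scaleT pmone (tensT q q)).
Definition krylovT t k := rec (fun _ v => trmulT t v) (outT t) (nat_of k).
(** A sum of squares, so that a single zero test decides whether all derivatives of order less than
    the dimension vanish at 0. *)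
Definition orderT t := psum (fun k =>
  let r := pdot (dimT t) (krylovT t k) (inT t) in pmul r r) (dimT t).
Definition yesT := sumT (expT Leaf pone) (expT pmone (popp ptwo)).
Definition noT := expT Leaf pone.
Definition selT m t := let s := shiftT t in
  iteT (nzT m (orderT s))
    (iteT (nzT m (pdot (dimT s) (outT s) (inT s))) (signT t)
      (iteT (nzT m (pdot (dimT s) (trmulT s (outT s)) (inT s))) yesT (signT t)))
    noT.

Lemma comp_boundT : computable boundT. Proof. rewrite /boundT; comp_tac. Qed.
#[export] Hint Resolve comp_boundT : comp.
Lemma comp_signT : computable signT. Proof. rewrite /signT; comp_tac. Qed.
Lemma comp_krylovT : computable2 krylovT. Proof. rewrite /krylovT; comp_tac. Qed.
#[export] Hint Resolve comp_signT comp_krylovT : comp.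
Lemma comp_orderT : computable orderT. Proof. rewrite /orderT; comp_tac. Qed.
#[export] Hint Resolve comp_orderT : comp.
Lemma comp_selT : computable2 selT. Proof. rewrite /selT; comp_tac. Qed.
#[export] Hint Resolve comp_selT : comp.

Definition prodT t X i j := psum (fun k => pmul (ent (matT t) i k) (ent X k j)) (dimT t).
Definition faddeevT t := rec (fun k X => mxT (fun i j =>
    padd (prodT t X i j) (popp (pmul (deltaT i j)
      (pmul (psum (fun l => prodT t X l l) (dimT t)) (pcst (rinv (rnat (Node Leaf k))))))))
    (dimT t) (dimT t)) (mxT deltaT (dimT t) (dimT t)) (nat_of (tl (dimT t))).
(** The product of the matrix with [faddeevT t] is scalar, hence given by its entry at position 0,
    0. *)
Definition pivotT t := prodT t (faddeevT t) Leaf Leaf.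
(** The level times the pivot [p]: [p w^T d = - w^T X b] with [X] the matrix of [faddeevT t].
    Accordingly [facetT] takes [p w] as normal vector. *)
Definition levelT t := popp (psum (fun i => pmul (ent (outT t) i Leaf)
  (psum (fun k => pmul (ent (faddeevT t) i k) (ent (inT t) k Leaf)) (dimT t))) (dimT t)).
Definition facetT t i j := let w := pmul (pivotT t) (ent (outT t) j Leaf) in
  iteT i (iteT (tl i) (iteT (subT (dimT t) (tl (tl i))) (deltaT (tl (tl i)) j)
                            (popp (deltaT (subT (tl (tl i)) (dimT t)) j)))
                      (popp w)) w.
Definition facet_levelT t i := iteT i (iteT (tl i)
  (padd (pvecbound (dimT t) (inT t)) pone) (popp (levelT t))) (levelT t).
Definition slab_size t := Node Leaf (Node Leaf (addT (dimT t) (dimT t))).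
(** All rows of the slab are written in any case; decoding reads the first [k] of them, so that
    [k = 2] leaves the hyperplane. *)
Definition ltiT K k t := Node K (Node (dimT t) (Node (matT t) (Node (inT t) (Node k
  (Node (mxT (facetT t) (slab_size t) (dimT t))
  (Node (mxT (fun i _ => facet_levelT t i) (slab_size t) vec1) Leaf)))))).
Definition reductionT (slab : bool) t :=
  let h := shiftT (selT (hd (hd t)) (mkT (hd (tl t)) (hd (tl (tl t)))
      (hd (tl (tl (tl t)))) (hd (tl (tl (tl (tl t))))))) in
  ltiT (hd t) (if slab then slab_size h else Node Leaf (Node Leaf Leaf)) h.

Lemma comp_prodT : computable4 prodT. Proof. rewrite /prodT; comp_tac. Qed.
#[export] Hint Resolve comp_prodT : comp.
Lemma comp_faddeevT : computable faddeevT. Proof. rewrite /faddeevT; comp_tac. Qed.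
#[export] Hint Resolve comp_faddeevT : comp.
Lemma comp_pivotT : computable pivotT. Proof. rewrite /pivotT; comp_tac. Qed.
Lemma comp_levelT : computable levelT. Proof. rewrite /levelT; comp_tac. Qed.
#[export] Hint Resolve comp_pivotT comp_levelT : comp.
Lemma comp_facetT : computable3 facetT. Proof. rewrite /facetT; comp_tac. Qed.
Lemma comp_facet_levelT : computable2 facet_levelT.
Proof. rewrite /facet_levelT; comp_tac. Qed.
Lemma comp_slab_size : computable slab_size. Proof. rewrite /slab_size; comp_tac. Qed.
#[export] Hint Resolve comp_facetT comp_facet_levelT comp_slab_size : comp.
Lemma comp_ltiT : computable3 ltiT. Proof. rewrite /ltiT; comp_tac. Qed.
#[export] Hint Resolve comp_ltiT : comp.
Lemma comp_reductionT slab : computable (reductionT slab).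
Proof. by case: slab; rewrite /reductionT; comp_tac. Qed.

Section ReachIff.
Variables (R : realType) (n : nat) (A0 : 'M[R]_n) (b d w : 'cV[R]_n).
Let A := shiftmx A0.
Hypothesis Ad : A *m d = - b.
Hypothesis Gpos : exists2 x, 0 <= x & 0 < skolem_fun A0 b w x.

(** All targets between the slab and the hyperplane have the same answer, since the reachable states
    lie in the box; this treats both shapes at once. *)
Lemma reach_iff (Y : set 'cV[R]_n) :
  (forall y : 'cV[R]_n, Y y -> (w^T *m y) 0 0 = (w^T *m d) 0 0) ->
  (forall y : 'cV[R]_n, (forall i, `|y i 0| <= vecbound b + 1) ->
     (w^T *m y) 0 0 = (w^T *m d) 0 0 -> Y y) ->
  (exists2 x, 0 <= x & skolem_fun A0 b w x < 0) <->
  (exists2 y, Y y & can_reach A b (@saturated R) 0 y).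
Proof.
move=> Y1 Y2.
have E x : skolem_fun A b w x = expR (- shift_rate A0 * x) * skolem_fun A0 b w x.
  exact: skolem_sub_scalar.
have [p p0 Gp] := Gpos.
have gp : exists2 x, 0 <= x & 0 < skolem_fun A b w x.
  by exists p; [exact: p0 | rewrite E; exact: mulr_gt0 (expR_gt0 _) Gp].
split=> [[x x0 Gx]|[y Yy ry]].
  have gx : exists2 x, 0 <= x & skolem_fun A b w x < 0.
    by exists x; [exact: x0 | rewrite E pmulr_rlt0 //; exact: expR_gt0].
  have [y ya ry] := can_reach_hyperplane Ad gx gp.
  exists y => //; apply: Y2 => // i.
  by apply: le_trans (can_reach_bounded i ry) _; rewrite lerDl.
apply: contrapT => H.
have := not_can_reach Ad (w := w) _ gp ry; rewrite (Y1 y Yy) ltxx => F.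
suff : false by []; apply: F => x x0; rewrite E.
apply: mulr_ge0; first exact: expR_ge0.
by rewrite leNgt; apply/negP => Gx; apply: H; exists x.
Qed.

End ReachIff.

(** * Correctness of the selected function and of the target data *)

Section Correctness.
Variables (R : realType) (K : number_field).
Local Notation V := (@V R K).
Local Notation skT := (@skT R K).
Local Notation Amx := (@Amx R K).
Local Notation bvec := (@bvec R K).
Local Notation cvec := (@cvec R K).
Local Notation decmx := (@decmx R K).

Lemma boundTE t : V (boundT t) = deriv_bound (Amx t) (bvec t) (cvec t).
Proof.
rewrite /boundT VD VM VD V1 !(pvecboundE _ _ (shiftT t)) !(trmulTE _ _ (shiftT t)).
have -> : Amx (shiftT t) = shiftmx (Amx t) by exact: (@shiftTE R K t).
reflexivity.
Qed.

Lemma skT_ramp x : skT rampT x = 1 - expR (- x).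
Proof. by rewrite skT_sum !skT_exp !VE mul0r expR0 mulr1 !mulN1r. Qed.

Lemma skT_sign t x : skT (signT t) x = sign_fun (Amx t) (bvec t) (cvec t) x.
Proof.
rewrite /signT skT_sum skT_scale !skT_tens skT_scale skT_ramp.
rewrite skT_der skT_shift VM boundTE !VE /sign_fun.
rewrite -shiftTE; rewrite -[decmx _ _ _]/(Amx (shiftT t)).
rewrite -[bvec (shiftT t)]/(bvec t) -[cvec (shiftT t)]/(cvec t).
by rewrite !expr2; ring.
Qed.

Lemma krylovTE t k : decmx (nat_of (dimT t)) 1 (krylovT t k) =
  krylov (Amx t) (cvec t) (nat_of k).
Proof.
rewrite /krylovT /krylov; elim: (nat_of k) => //= m IH.
by rewrite trmulTE IH.
Qed.

Lemma pdot_skolem t u : V (pdot (dimT t) u (inT t)) =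
  skolem_fun (Amx t) (bvec t) (decmx (nat_of (dimT t)) 1 u) 0.
Proof. by rewrite pdotE /skolem_fun expmx0 mulmx1. Qed.

Lemma orderTE t : V (orderT t) = \sum_(k < nat_of (dimT t))
  skolem_fun (Amx t) (bvec t) (krylov (Amx t) (cvec t) k) 0 ^+ 2.
Proof.
apply: (@psumE _ _ _ _ (fun k =>
  skolem_fun (Amx t) (bvec t) (krylov (Amx t) (cvec t) k) 0 ^+ 2)) => k _.
by rewrite VM pdot_skolem krylovTE.
Qed.

Hypothesis vK : valid_field R K.

Lemma skT_sel m t : poly_of m = minpol K ->
  (exists2 x, 0 <= x & 0 < skT (selT m t) x) /\
  ((exists2 x, 0 <= x & skT (selT m t) x < 0) <->
   (exists2 x, 0 <= x & nontangential_zero (skT t) x)).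
Proof.
move=> mK; rewrite /selT.
pose A := Amx t; pose b := bvec t; pose c := cvec t; pose B := shiftmx A.
have AE : Amx (shiftT t) = B by exact: (@shiftTE R K t).
have phiE : V (pdot (dimT (shiftT t)) (outT (shiftT t)) (inT (shiftT t))) =
    skolem_fun B b c 0 by rewrite pdot_skolem AE.
have psiE : V (pdot (dimT (shiftT t)) (trmulT (shiftT t) (outT (shiftT t))) (inT (shiftT t))) =
    skolem_fun B b (B^T *m c) 0 by rewrite pdot_skolem trmulTE AE.
rewrite !iteTE !(nzTE vK _ mK) phiE psiE orderTE AE.
(* If the sum of squares is 0, the function is identically 0 and has no nontangential zero. *)
case: ifPn => [sn|]; rewrite ?negbK; last first.
  move=> /eqP s0; rewrite /noT; have E x : skT (expT Leaf pone) x = 1.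
    by rewrite skT_exp !VE mul0r expR0 mulr1.
  split; first by exists 0; rewrite ?E.
  split=> -[x x0]; first by rewrite E ltNge ler01.
  move=> /nontangential_shift[_] /negP[]; apply/eqP.
  have Z : forall x, skolem_fun B b c x = 0.
    apply: skolem_krylov0 => k kn; apply/eqP; rewrite -sqrf_eq0; apply/eqP.
    have H := psumr_eq0P _ s0; have {}H := H (fun i _ => sqr_ge0 _) (Ordinal kn) isT.
    exact: H.
  apply: der_unique (der_skolem B b c x) _.
  by apply: (@der_ext _ (fun=> 0)) => [r|]; [rewrite Z | exact: der_cst].
have [k fk] : exists k, skolem_fun B b (krylov B c k) 0 != 0.
  apply: contrapT => H; case/negP: sn; rewrite big1 // => k _.
  by apply/eqP; rewrite sqrf_eq0; apply: contrapT => /negP Hk; apply: H; exists k.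
(* The generic case, reached by two of the branches: the one where the value at 0 is nonzero and the
   one where the derivative at 0 vanishes too. *)
have main : ~ (skolem_fun B b c 0 = 0 /\ skolem_fun B b (B^T *m c) 0 != 0) ->
  (exists2 x, 0 <= x & 0 < skT (signT t) x) /\
  ((exists2 x, 0 <= x & skT (signT t) x < 0) <->
   (exists2 x, 0 <= x & nontangential_zero (skT t) x)).
  move=> H0; have E x := skT_sign t x; split.
    by have [x x0 Gx] := sign_fun_pos fk H0; exists x; rewrite ?E.
  rewrite -(sign_fun_neg H0).
  split=> -[x x0 Gx]; exists x; try exact: x0; first by rewrite -E.
  by rewrite E.
case: ifPn => [fn|]; rewrite ?negbK.
  by apply: main => -[H _]; case/negP: fn; apply/eqP; exact: H.
move=> /eqP f0; case: ifPn => [f1|]; rewrite ?negbK; last first.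
  by move=> /eqP f1; apply: main => -[_ /negP]; apply; apply/eqP; exact: f1.
have E x : skT yesT x = 1 - 2 * expR (- x).
  by rewrite skT_sum !skT_exp !VE mul0r expR0 mulr1 !mulN1r mulNr.
split.
  have [x [_ x0] Hx] := @exp_decay R 2 1 0 ltr01.
  by exists x => //; rewrite E subr_gt0.
split=> _; last by exists 0 => //; rewrite E oppr0 expR0; lra.
by exists 0; [exact: lexx | exact: (nontangential_shift A b c 0).2 (conj f0 f1)].
Qed.

Section Target.
Variable t : tree.
Let n := nat_of (dimT t).

Lemma prodTE X i j : V (prodT t X i j) =
  \sum_(k < n) mv R K (matT t) (nat_of i) k * mv R K X k (nat_of j).
Proof.
apply: (@psumE _ _ _ _ (fun k => mv R K (matT t) (nat_of i) k * mv R K X k (nat_of j))) => k _.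
by rewrite !VE.
Qed.

Lemma faddeevTE : (0 < n)%N -> Amx t \in unitmx ->
  Amx t *m decmx n n (faddeevT t) = (V (pivotT t))%:M /\ V (pivotT t) != 0.
Proof.
have -> : Amx t = decmx n n (matT t) by [].
rewrite /n; case E : (nat_of (dimT t)) => [|n'] // _ uA.
set A := decmx _ _ _ in uA *.
have prodE X i j (i0 j0 : 'I_n'.+1) : nat_of i = i0 -> nat_of j = j0 ->
    V (prodT t X i j) = (A *m decmx n'.+1 n'.+1 X) i0 j0.
  move=> iE jE; rewrite prodTE iE jE /n E mxE; apply: eq_bigr => k _.
  by rewrite !decmxE.
have step : decmx n'.+1 n'.+1 (faddeevT t) = faddeev A n'.
  rewrite /faddeevT nat_of_tl E [n'.+1.-1]/=.
  set F := (F in rec F _ _); set X0 := (X in rec _ X _).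
  suff H k : decmx n'.+1 n'.+1 (rec F X0 k) = faddeev A k by exact: H.
  elim: k => [|k IH] /=.
    apply/matrixP => i j; rewrite decmxE [RHS]mxE.
    rewrite (@mxTE _ _ _ _ _ (fun i j => (i == j)%:R)) ?E // => i' j' _ _.
    by rewrite deltaTE.
  set X := rec _ _ k in IH *.
  apply/matrixP => i j; rewrite decmxE [RHS]mxE [X in _ = _ + X]mxE [X in _ = _ - X]mxE.
  rewrite -IH.
  (* The specification expected by [mxTE] is a function of naturals, hence [inord]; its default
     value is never met, the indices being in range. *)
  rewrite (@mxTE _ _ _ _ _ (fun i j => (A *m decmx n'.+1 n'.+1 X) (inord i) (inord j) -
      (i == j)%:R * (\tr (A *m decmx n'.+1 n'.+1 X) / k.+1%:R))) ?E //.
    by rewrite !inord_val mulr_natl.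
  move=> i' j' i'n j'n.
  rewrite VD VN VM VM (prodE X i' j' (inord (nat_of i')) (inord (nat_of j'))) ?inordK //.
  rewrite deltaTE Vcst; congr (_ - _ * (_ * _)).
    rewrite (@psumE _ _ _ _ (fun l => (A *m decmx n'.+1 n'.+1 X) (inord l) (inord l))).
      rewrite E; apply: eq_bigr => l _; by rewrite inord_val.
    by move=> l ln; apply: prodE; rewrite inordK // -E.
  by rewrite rinvE rnatE /= natTK ?pnatr_eq0 // fmorphV rmorph_nat.
have [s s0 sE] := faddeev_inverse uA.
have pE : V (pivotT t) = s.
  by rewrite /pivotT (prodE _ _ _ ord0 ord0) // step sE mxE.
by rewrite step sE pE.
Qed.

Lemma levelTE : V (levelT t) =
  - ((cvec t)^T *m (decmx n n (faddeevT t) *m bvec t)) 0 0.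
Proof.
rewrite /levelT VN; congr (- _); rewrite mxE.
rewrite (@psumE _ _ _ _ (fun i => mv R K (outT t) i 0 *
   \sum_(k < n) mv R K (faddeevT t) i k * mv R K (inT t) k 0)) => [|i _].
  apply: eq_bigr => i _; rewrite mxE decmxE; congr (_ * _).
  by rewrite mxE; apply: eq_bigr => k _; rewrite !decmxE.
rewrite VM entE; congr (_ * _).
apply: (@psumE _ _ _ _ (fun k => mv R K (faddeevT t) (nat_of i) k * mv R K (inT t) k 0)) => k _.
by rewrite !VE.
Qed.

Lemma facetTE (i j : tree) (j0 : 'I_n) : nat_of j = j0 ->
  V (facetT t i j) = facet (V (pivotT t) *: cvec t) (nat_of i) j0.
Proof.
move=> jE; rewrite /facetT /facet; cbv zeta.
rewrite !iteTE !nat_of_tl subTE !nat_of_tl subn_gt0 mxE decmxE.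
have -> : (nat_of i - 2 = (nat_of i).-2)%N by lia.
case iE : (nat_of i) => [|[|k]] /=.
- by rewrite VM entE jE.
- by rewrite VN VM entE jE.
rewrite -/n; case: ltnP => _.
  by rewrite deltaTE !nat_of_tl jE iE.
by rewrite VN deltaTE subTE !nat_of_tl jE iE.
Qed.

End Target.
End Correctness.

Lemma skolem_fun_dim0 (R : realType) n (A : 'M[R]_n) b c x :
  n = 0%N -> skolem_fun A b c x = 0.
Proof. by move=> n0; subst n; rewrite /skolem_fun mxE big_ord0. Qed.

(** * The instance produced by the reduction *)

Section Output.
Variables (R : realType) (Kc h0 : tree).
Let K := field_of Kc.
Let h := shiftT h0.
Let n := nat_of (dimT h).
Hypothesis Gpos : exists2 x, 0 <= x & 0 < @skT R K h0 x.

Let p := V R K (pivotT h).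
Let w := cvec R K h.
Let b := bvec R K h.
Let a := V R K (levelT h).
Let B := vecbound b + 1.
Let X := decmx R K n n (faddeevT h).
Let d := - p^-1 *: (X *m b).

Let AE : Amx R K h = shiftmx (Amx R K h0).
Proof. exact: (@shiftTE R K h0). Qed.

(** In dimension 0 the selected function would be 0, against [Gpos]. *)
Let n0 : (0 < n)%N.
Proof.
rewrite lt0n; apply/eqP => nE; have [x _] := Gpos.
by rewrite /skT skolem_fun_dim0 ?ltxx.
Qed.

Let AX : Amx R K h *m X = p%:M /\ p != 0.
Proof.
by apply: faddeevTE; [exact: n0 | rewrite AE; exact: unitmx_shiftmx].
Qed.

Let Ad : Amx R K h *m d = - b.
Proof.
have [E p0] := AX; rewrite /d -scalemxAr mulmxA E mul_scalar_mx scalerA.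
by rewrite mulNr mulVf // scaleN1r.
Qed.

Let wd : ((p *: w)^T *m d) 0 0 = a.
Proof.
have [_ p0] := AX; have E : (p *: w)^T = p *: w^T by rewrite linearZ.
rewrite /a levelTE E /d -scalemxAr -scalemxAl scalerA mulNr mulVf // scaleN1r.
by rewrite [LHS]mxE.
Qed.

Let wy (y : 'cV[R]_n) : ((p *: w)^T *m y) 0 0 = a <-> (w^T *m y) 0 0 = (w^T *m d) 0 0.
Proof.
have [_ p0] := AX.
have E (v : 'cV[R]_n) : ((p *: w)^T *m v) 0 0 = p * (w^T *m v) 0 0.
  by rewrite linearZ /= -scalemxAl [LHS]mxE.
by rewrite -wd !E; split=> [|-> //]; apply: mulfI.
Qed.

Let w0 : p *: w != 0.
Proof.
have [_ p0] := AX; rewrite scaler_eq0 negb_or p0 /=; apply/eqP => wE.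
have [x _] := Gpos.
have -> : @skT R K h0 x = (w^T *m expmx (x *: Amx R K h0) *m b) 0 0 by [].
by rewrite wE trmx0 !mul0mx mxE ltxx.
Qed.

Section Rows.
Variable k : tree.
Let o := ltiT Kc k h.
Hypothesis kn : (nat_of k <= 2 + (n + n))%N.

Let size_slab : nat_of (slab_size h) = (2 + (n + n))%N.
Proof. by rewrite /slab_size /= addTE. Qed.

Let ME i j : decmx R K (nat_of k) n (mxT (facetT h) (slab_size h) (dimT h)) i j =
  facet (p *: w) i j.
Proof.
rewrite decmxE (@mxTE _ _ _ _ _ (fun i j => V R K (facetT h (natT i) (natT j)))).
- have -> := @facetTE R K h (natT i) (natT j) j (natTK j).
  by rewrite natTK.
- move=> i' j' _ jn.
  have -> := @facetTE R K h i' j' (Ordinal jn) erefl.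
  have -> := @facetTE R K h (natT (nat_of i')) (natT (nat_of j')) (Ordinal jn) (natTK _).
  by rewrite natTK.
- by rewrite size_slab; apply: leq_trans kn.
- exact: ltn_ord.
Qed.

Let dE i : decmx R K (nat_of k) 1 (mxT (fun i _ => facet_levelT h i) (slab_size h) vec1) i 0
  = facet_level a B i.
Proof.
rewrite decmxE (@mxTE _ _ _ _ _ (fun i _ => facet_level a B i)) //.
  move=> i' j' _ _; rewrite /facet_levelT /facet_level !iteTE nat_of_tl.
  case: (nat_of i') => [|[|m]] //=; first exact: VN.
  by rewrite VD V1 (pvecboundE _ _ h).
by rewrite size_slab; apply: leq_trans kn.
Qed.

Lemma lti_target_hyperplane : nat_of k = 2%N ->
  @lti_target R o = [set x | ((p *: w)^T *m x) 0 0 = a].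
Proof. by move=> k2; exact: (polyhedron_hyperplane ME dE k2). Qed.

Lemma lti_target_slab : nat_of k = (2 + (n + n))%N ->
  @lti_target R o = slab (p *: w) a B.
Proof. by move=> k2; exact: (polyhedron_slab ME dE k2). Qed.

Lemma lti_answer :
  (forall y, @lti_target R o y -> ((p *: w)^T *m y) 0 0 = a) ->
  (forall y, slab (p *: w) a B y -> @lti_target R o y) ->
  (exists2 x, 0 <= x & @skT R K h0 x < 0) <->
  (exists2 y, @lti_target R o y &
     can_reach (lti_A R o) (lti_b R o) (@saturated R) 0 y).
Proof.
move=> Y1 Y2; have Ad' := Ad; rewrite AE in Ad'.
have H := @reach_iff R n (Amx R K h0) b d w Ad' Gpos (@lti_target R o).
have {}H := H (fun y Yy => (wy y).1 (Y1 y Yy))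
  (fun y yB ya => Y2 y (conj ((wy y).2 ya) yB)).
by apply: (iff_trans H); rewrite -AE.
Qed.

Lemma lti_stable : stable (lti_A R o).
Proof.
have H := @stable_shiftmx R _ (Amx R K h0); rewrite -AE in H; exact: H.
Qed.

End Rows.

Lemma slab_codim1 : compact_convex_codim1 (slab (p *: w) a B).
Proof.
split; [exact: compact_slab | exact: convex_slab |].
apply: (affine_dim_slab w0 wd) => i; rewrite lerD2r.
have Ad' := Ad; rewrite AE in Ad'.
exact: (equilibrium_bounded Ad').
Qed.

Lemma level_set_hyperplane : hyperplane [set x | ((p *: w)^T *m x) 0 0 = a].
Proof. by exists (p *: w), a. Qed.

End Output.

(** Isolates what depends on the target. The answer is never negated: nontangential zeros correspond
    to reachability, by the first alternative of [reduces]. *)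
Lemma skolem_reduces (R : realType) (slab : bool)
    (shape : forall n, set 'cV[R]_n -> Prop) :
  (forall Kc h0, (exists2 x, 0 <= x & 0 < @skT R (field_of Kc) h0 x) ->
     let h := shiftT h0 in
     let o := ltiT Kc (if slab then slab_size h else Node Leaf (Node Leaf Leaf)) h in
     [/\ shape _ (@lti_target R o), stable (lti_A R o) &
     (exists2 x, 0 <= x & @skT R (field_of Kc) h0 x < 0) <->
     (exists2 y, @lti_target R o y &
       can_reach (lti_A R o) (lti_b R o) (@saturated R) 0 y)]) ->
  reduces (continuous_nontangential_skolem R)
          (stable_saturated_reachability shape).
Proof.
move=> H; have [q Hq] := comp_reductionT slab.
exists q; left => t vK; exists (reductionT slab t).
pose tr := mkT (hd (tl t)) (hd (tl (tl t)))
      (hd (tl (tl (tl t)))) (hd (tl (tl (tl (tl t))))).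
have [Gp Gn] := @skT_sel R (field_of (hd t)) vK (hd (hd t)) tr (erefl _).
have [H1 H2 H3] := H (hd t) _ Gp.
split; first exact: Hq.
  by split; [exact: vK | exact: H2 | exact: H1].
exact: iff_trans (iff_sym Gn) H3.
Qed.

Theorem theorem6p2 (R : realType) :
  reduces (continuous_nontangential_skolem R)
          (stable_saturated_reachability (@hyperplane R)) /\
  reduces (continuous_nontangential_skolem R)
          (stable_saturated_reachability (@compact_convex_codim1 R)).
Proof.
split.
  apply: (@skolem_reduces R false) => Kc h0 Gp h o.
  have T := @lti_target_hyperplane R Kc h0 (Node Leaf (Node Leaf Leaf)) isT erefl.
  split; first by rewrite T; exact: level_set_hyperplane.
    exact: lti_stable.
  apply: lti_answer => // y; rewrite T //.
  by case.
apply: (@skolem_reduces R true) => Kc h0 Gp h o.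
have hk : nat_of (slab_size h) = (2 + (nat_of (dimT h) + nat_of (dimT h)))%N.
  by rewrite /slab_size /= addTE.
have T := @lti_target_slab R Kc h0 (slab_size h) (eq_leq hk) hk.
split; first by rewrite T; exact: slab_codim1.
  exact: lti_stable.
apply: lti_answer => // y; rewrite T //.
by case.
Qed.
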